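(* Suppose $\varphi\in\mathcal U(\mathbb D)\setminus\{\mathrm{id}_{\mathbb D}\}$ is non-elliptic. Let $\Delta$ be any abelian subset of $\mathcal Z(\varphi)$, i.e. $\psi_1\circ\psi_2=\psi_2\circ\psi_1$ for all $\psi_1,\psi_2\in\Delta$. Then there exists a univalent map $h_{\varphi,\Delta}:\mathbb D\to\mathbb C$ with the following property: to each $\psi\in\Delta$ there corresponds a constant $c_{\varphi,\psi}\in\mathbb C$ such that $$h_{\varphi,\Delta}\circ\varphi=h_{\varphi,\Delta}+1\quad\text{and}\quad h_{\varphi,\Delta}\circ\psi=h_{\varphi,\Delta}+c_{\varphi,\psi}.$$
   Context: $\mathbb D=\{z\in\mathbb C:|z|<1\}$. Univalent means injective and holomorphic. $\mathcal U(\mathbb D)$ is the set of all univalent self-maps of $\mathbb D$. The centralizer of $\varphi\in\mathcal U(\mathbb D)$ is $\mathcal Z(\varphi)=\{\psi\in\mathcal U(\mathbb D):\varphi\circ\psi=\psi\circ\varphi\}$. A holomorphic self-map of $\mathbb D$ is non-elliptic if it has no fixed point in $\mathbb D$. *)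

(* Defs.v *)
From Stdlib Require Import Reals.
From Coquelicot Require Import Coquelicot.

Open Scope C_scope.

(* A map from the unit disc to C is represented by a total function [C -> C];
   every notion below depends only on its values on the disc.  In particular
   equality of two maps on the disc is [eq_on_disc], not Leibniz equality. *)

Definition disc (z : C) : Prop := (Cmod z < 1)%R.

Definition eq_on_disc (f g : C -> C) : Prop := forall z, disc z -> f z = g z.

(* The two structures are given explicitly so that the derivative is the
   complex one; since the disc is open, it only sees the values on the disc. *)
Definition holomorphic (f : C -> C) : Prop :=
  forall z, disc z -> @ex_derive C_AbsRing C_NormedModule f z.

Definition univalent (f : C -> C) : Prop :=
  holomorphic f /\
  forall z w, disc z -> disc w -> f z = f w -> z = w.

Definition self_map (f : C -> C) : Prop := forall z, disc z -> disc (f z).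

Definition univalent_self_map (f : C -> C) : Prop := univalent f /\ self_map f.

Definition commute (f g : C -> C) : Prop :=
  eq_on_disc (fun z => f (g z)) (fun z => g (f z)).

Definition centralizer (phi psi : C -> C) : Prop :=
  univalent_self_map psi /\ commute phi psi.

Definition non_elliptic (f : C -> C) : Prop :=
  ~ exists z, disc z /\ f z = z.

Definition abelian (Delta : (C -> C) -> Prop) : Prop :=
  forall psi1 psi2, Delta psi1 -> Delta psi2 -> commute psi1 psi2.

(* Main.v *)
Require Import Defs.
From Stdlib Require Import Reals.
From Coquelicot Require Import Coquelicot.
From Stdlib Require Import Lra Lia Classical ClassicalEpsilon FunctionalExtensionality.
From mathcomp.classical Require boolp classical_sets filter.
Import Defs.
Open Scope R_scope.

(** The idea of the proof.  Let Gamma be the commuting family that consists of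
    Delta and phi.  Among all univalent self-maps g of the disc that commute with
    Gamma, take a sequence g_n for which the pseudo-hyperbolic distance from
    g_n 0 to g_n (phi 0) tends to its infimum kappa.  Let f_n = [renorm] g_n be
    g_n followed by the disc automorphism that sends g_n 0 to 0.  Then f_n
    semi-conjugates each chi in Gamma to a self-map X_n chi of the disc,
    conjugate to chi by an automorphism.  All limits below are taken along one
    ultrafilter.

    Case kappa > 0 ([positive_step_linearizable]).  The f_n converge to a map H
    that is not constant, hence univalent by Hurwitz's theorem, and each X_n chi
    converges to a self-map Psi_chi with Psi_chi o H = H o chi.  Composing g_n
    with chi stays in the commutant, so by minimality Psi_chi preserves the
    distance from H 0 to H (phi 0), and by the equality case of the Schwarz-Pick
    lemma it is an automorphism of the disc.  The Psi_chi commute with one another, and Psi_phi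
    has no fixed point, again by Hurwitz.  An automorphism without fixed points in the disc
    preserves the quadratic vector field that vanishes at its fixed points outside; the
    time L along this field is univalent, and the automorphism and those
    that commute with it translate it ([aut_linearization]).  The required
    map is L o H, with L scaled so that Psi_phi acts as the translation by 1.

    Case kappa = 0 ([zero_step_linearizable]).  Now f_n (phi 0) tends to 0, hence
    so does f_n, and h_n = f_n / f_n (phi 0) plays the role of H.  The
    displacement X_n chi v - v has no zeros, and Harnack's inequality shows that
    it is asymptotically the same at v = 0 and at v = f_n z ([displacement]).  So
    h_n o chi - h_n - h_n (chi 0) is small compared with h_n (chi 0); for
    chi = phi, where h_n (phi 0) = 1, this means that phi acts under h_n nearly
    as the translation by 1.  A small ball is disjoint from its image under phi,
    so that its image under h_n contains no large disc, and Bloch's argument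
    bounds the derivative of h_n there ([bloch], [h_locally_bounded]).  The limit of
    the h_n exists, is univalent by Hurwitz's theorem, and satisfies the
    functional equations.  A member of Gamma with a fixed point is the identity,
    because it fixes the images of this point under phi as well
    ([commuting_fixed_point]).

    The complex analysis behind this is derived from Goursat's theorem: Cauchy's
    formula on circles about 0, Schwarz's lemma and the Schwarz-Pick lemma,
    logarithms of functions without zeros, and Harnack's inequality for bounded
    functions without zeros ([harnack]).  The last one says that the values at two
    points are bounded by powers of each other, which is a quantitative form of
    Hurwitz's theorem. *)

(** * Complex derivatives and continuity *)

Notation cderiv f z l := (@is_derive C_AbsRing C_NormedModule f z l).
Notation ccont f z := (@continuous C_UniformSpace C_UniformSpace f z).

(* The rules of differentiation state derivatives as beta-redexes typed in the
   normed module; this exposes an equation between complex numbers. *)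
Ltac cbeta := cbv beta; match goal with |- @eq _ ?a ?b => change (@eq C a b) end.

Lemma Cmod_minus_sym (a b : C) : Cmod (a - b) = Cmod (b - a).
Proof. rewrite <- (Cmod_opp (a - b)). f_equal. ring. Qed.

Lemma Cmod_dist_triangle (a b c : C) :
  Cmod (a - c) <= Cmod (a - b) + Cmod (b - c).
Proof. replace (a - c)%C with ((a - b) + (b - c))%C by ring. apply Cmod_triangle. Qed.

Lemma Cmod_minus_le (a b : C) : Cmod (a - b) <= Cmod a + Cmod b.
Proof. unfold Cminus. rewrite <- (Cmod_opp b). apply Cmod_triangle. Qed.

Lemma Cmod_minus_ge (a b : C) : Cmod a - Cmod b <= Cmod (a - b).
Proof.
  assert (Cmod a <= Cmod (a - b) + Cmod b); [|lra].
  replace a with ((a - b) + b)%C at 1 by ring. apply Cmod_triangle.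
Qed.

Lemma Cmod_plus_ge (a b : C) : Cmod a - Cmod b <= Cmod (a + b).
Proof.
  replace (a + b)%C with (a - (- b))%C by ring.
  rewrite <- (Cmod_opp b). apply Cmod_minus_ge.
Qed.

Lemma Cmod_near (z w : C) d : Cmod (w - z) < d -> Cmod w < Cmod z + d.
Proof. intros H. assert (Q := Cmod_minus_ge w z). lra. Qed.

Lemma Cmod_pos (a : C) : a <> 0 -> 0 < Cmod a.
Proof. apply Cmod_gt_0. Qed.

Lemma Cmod_minus_pos (a b : C) : a <> b -> 0 < Cmod (a - b).
Proof. intros H. apply Cmod_gt_0. now apply Cminus_eq_contra. Qed.

Lemma Cminus_0 (a b : C) : (a - b = 0)%C -> a = b.
Proof. intros H. now apply Ceq_minus. Qed.

Lemma Cmod_minus_self (z : C) : Cmod (z - z) = 0.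
Proof. replace (z - z)%C with (RtoC 0) by ring. apply Cmod_0. Qed.

Lemma Cmod_small (a : C) : (forall eps, 0 < eps -> Cmod a <= eps) -> a = 0%C.
Proof.
  intros H. apply NNPP. intros N. apply Cmod_pos in N.
  specialize (H (Cmod a / 2) ltac:(lra)). lra.
Qed.

Lemma RtoC_neq_0 (x : R) : x <> 0 -> RtoC x <> 0%C.
Proof. intros N E. now apply RtoC_inj in E. Qed.

Lemma Cmod_scal (x : R) (z : C) : 0 <= x -> Cmod (RtoC x * z) = x * Cmod z.
Proof. intros Hx. now rewrite Cmod_mult, Cmod_R, Rabs_pos_eq. Qed.

Lemma cderiv_eps (f : C -> C) (z l : C) :
  cderiv f z l <->
  forall eps, 0 < eps -> exists d, 0 < d /\
    forall w, Cmod (w - z) < d ->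
      Cmod (f w - f z - (w - z) * l) <= eps * Cmod (w - z).
Proof.
  split.
  - intros [_ H] eps Heps.
    assert (Hz : is_filter_lim (@locally (AbsRing_UniformSpace C_AbsRing) z) z)
      by (intros P HP; exact HP).
    destruct (H z Hz (mkposreal eps Heps)) as [d Hd].
    exists d. split; [apply cond_pos|exact Hd].
  - intros H. split; [apply is_linear_scal_l|].
    intros x Hx.
    apply (is_filter_lim_locally_unique (K := C_AbsRing)
       (V := AbsRing_NormedModule C_AbsRing)) in Hx.
    subst x.
    intros eps. destruct (H eps (cond_pos eps)) as [d [Hd H']].
    exists (mkposreal d Hd). exact H'.
Qed.

Lemma ccont_eps (f : C -> C) (z : C) :
  ccont f z <->
  forall eps, 0 < eps -> exists d, 0 < d /\
    forall w, Cmod (w - z) < d -> Cmod (f w - f z) < eps.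
Proof.
  split.
  - intros H eps Heps.
    assert (L : locally (f z) (fun y => Cmod (y - f z) < eps)).
    { apply (proj2 (locally_C _ _)).
      exists (mkposreal eps Heps). intros y Hy. exact Hy. }
    specialize (H _ L).
    apply (proj1 (locally_C _ _)) in H.
    destruct H as [d Hd]. exists d. split; [apply cond_pos|exact Hd].
  - intros H P HP.
    apply (proj1 (locally_C _ _)) in HP. destruct HP as [e He].
    destruct (H e (cond_pos e)) as [d [Hd Hw]].
    apply (proj2 (locally_C _ _)).
    exists (mkposreal d Hd). intros w Hw'. apply He. exact (Hw w Hw').
Qed.

(** The complex numbers carry two normed module structures over themselves
    and two uniform structures; the next two lemmas pass from one to the
    other, which gives access to the rules stated for a general valued ring. *)
Lemma cderiv_absring (f : C -> C) (z l : C) :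
  cderiv f z l <-> @is_derive C_AbsRing (AbsRing_NormedModule C_AbsRing) f z l.
Proof. split; (intros [_ H]; split; [apply is_linear_scal_l|exact H]). Qed.

Lemma ccont_absring (f : C -> C) (z : C) :
  ccont f z <-> @continuous C_UniformSpace (AbsRing_UniformSpace C_AbsRing) f z.
Proof. split; intros H P HP; apply H; apply (locally_C (f z)); exact HP. Qed.

Lemma cderiv_cont (f : C -> C) (z l : C) : cderiv f z l -> ccont f z.
Proof.
  intros H. assert (Q := ex_derive_continuous (K := C_AbsRing) f z (ex_intro _ l H)).
  intros P HP. apply (locally_C z). apply Q. exact HP.
Qed.

Lemma cderiv_ext_loc (f g : C -> C) (z l : C) (d : R) : 0 < d ->
  (forall w, Cmod (w - z) < d -> f w = g w) -> cderiv f z l -> cderiv g z l.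
Proof.
  intros Hd E H. apply (is_derive_ext_loc f g z l); [|exact H].
  exists (mkposreal d Hd). exact E.
Qed.

Lemma cderiv_eq (f : C -> C) (z l l' : C) : cderiv f z l -> l = l' -> cderiv f z l'.
Proof. now intros H <-. Qed.

Lemma cderiv_const (c z : C) : cderiv (fun _ => c) z (RtoC 0).
Proof. apply (@is_derive_const C_AbsRing C_NormedModule). Qed.

Lemma cderiv_id (z : C) : cderiv (fun w => w) z (RtoC 1).
Proof. apply cderiv_absring. exact (is_derive_id (K := C_AbsRing) z). Qed.

Lemma cderiv_plus (f g : C -> C) (z l m : C) :
  cderiv f z l -> cderiv g z m -> cderiv (fun w => f w + g w)%C z (l + m)%C.
Proof. exact (is_derive_plus f g z l m). Qed.

Lemma cderiv_minus (f g : C -> C) (z l m : C) :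
  cderiv f z l -> cderiv g z m -> cderiv (fun w => f w - g w)%C z (l - m)%C.
Proof. exact (is_derive_minus f g z l m). Qed.

Lemma cderiv_opp (f : C -> C) (z l : C) :
  cderiv f z l -> cderiv (fun w => - f w)%C z (- l)%C.
Proof. exact (is_derive_opp f z l). Qed.

Lemma cderiv_comp (f g : C -> C) (z l m : C) :
  cderiv g z m -> cderiv f (g z) l -> cderiv (fun w => f (g w)) z (m * l)%C.
Proof.
  intros Hg Hf.
  exact (is_derive_comp (K := C_AbsRing) f g z l m Hf (proj1 (cderiv_absring _ _ _) Hg)).
Qed.

Lemma cderiv_mult (f g : C -> C) (z l m : C) :
  cderiv f z l -> cderiv g z m ->
  cderiv (fun w => f w * g w)%C z (l * g z + f z * m)%C.
Proof.
  rewrite !cderiv_absring. intros Hf Hg.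
  exact (is_derive_mult (K := C_AbsRing) f g z l m Hf Hg Cmult_comm).
Qed.

Lemma cderiv_inv_base (z : C) : z <> 0%C -> cderiv (fun w => / w)%C z (- / (z * z))%C.
Proof.
  intros Hz. apply cderiv_eps. intros eps He.
  assert (P := Cmod_pos z Hz). set (r := Cmod z) in *.
  assert (P3 : 0 < r * r * r) by (repeat apply Rmult_lt_0_compat; lra).
  exists (Rmin (r / 2) (eps * (r * r * r) / 2)). split; [apply Rmin_pos; nra|].
  intros w Hw. destruct (Rmin_Rgt_l _ _ _ Hw) as [W1 W2].
  assert (R : r / 2 < Cmod w).
  { assert (Q := Cmod_plus_ge z (w - z)). replace (z + (w - z))%C with w in Q by ring.
    fold r in Q. lra. }
  assert (w <> 0%C) by (apply Cmod_gt_0; lra).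
  replace (/ w - / z - (w - z) * - / (z * z))%C with ((w - z) * ((w - z) * (/ (z * z * w))))%C
    by (field; auto).
  rewrite !Cmod_mult, Cmod_inv, !Cmod_mult by (repeat apply Cmult_neq_0; auto).
  fold r. set (D := Cmod (w - z)) in *. assert (0 <= D) by apply Cmod_ge_0.
  rewrite (Rmult_comm eps). apply Rmult_le_compat_l; auto.
  assert (0 < r * r * Cmod w) by (repeat apply Rmult_lt_0_compat; lra).
  apply Rmult_le_reg_r with (r * r * Cmod w); auto.
  rewrite Rmult_assoc, Rinv_l by lra.
  assert (eps * (r * r * (r / 2)) <= eps * (r * r * Cmod w)).
  { repeat apply Rmult_le_compat_l; nra. }
  lra.
Qed.

Lemma cderiv_inv (f : C -> C) (z l : C) : f z <> 0%C -> cderiv f z l ->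
  cderiv (fun w => / f w)%C z (- l / (f z * f z))%C.
Proof.
  intros Hz H. eapply cderiv_eq.
  - apply (cderiv_comp (fun w => / w)%C f z); [exact H|]. now apply cderiv_inv_base.
  - field; auto.
Qed.

Lemma cderiv_div (f g : C -> C) (z l m : C) : g z <> 0%C -> cderiv f z l -> cderiv g z m ->
  cderiv (fun w => f w / g w)%C z ((l * g z - f z * m) / (g z * g z))%C.
Proof.
  intros Hz Hf Hg. eapply cderiv_eq.
  - apply cderiv_mult; [exact Hf|]. exact (cderiv_inv g z m Hz Hg).
  - cbeta. field; auto.
Qed.

Lemma cderiv_scal (c : C) (f : C -> C) (z l : C) :
  cderiv f z l -> cderiv (fun w => c * f w)%C z (c * l)%C.
Proof.
  intros H. replace (c * l)%C with (0 * f z + c * l)%C by ring.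
  apply (cderiv_mult (fun _ => c)); [apply cderiv_const|exact H].
Qed.

Lemma cderiv_shift (w z : C) : cderiv (fun z => z - w)%C z (RtoC 1).
Proof.
  replace (RtoC 1) with (RtoC 1 - RtoC 0)%C by ring.
  apply (cderiv_minus (fun w => w) (fun _ => w)); [apply cderiv_id|apply cderiv_const].
Qed.

Lemma cderiv_affine (a b z : C) : cderiv (fun z => a * z + b)%C z a.
Proof.
  apply (cderiv_eq _ _ (a * 1 + 0)%C); [|ring].
  apply (cderiv_plus (fun z => a * z)%C (fun _ => b)); [|apply cderiv_const].
  apply cderiv_scal, cderiv_id.
Qed.

Lemma ccont_plus (f g : C -> C) (z : C) : ccont f z -> ccont g z -> ccont (fun w => f w + g w)%C z.
Proof. exact (continuous_plus (V := C_R_NormedModule) f g z). Qed.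

Lemma ccont_mult (f g : C -> C) (z : C) : ccont f z -> ccont g z -> ccont (fun w => f w * g w)%C z.
Proof. rewrite !ccont_absring. exact (continuous_mult (K := C_AbsRing) f g z). Qed.

Lemma ccont_inv (f : C -> C) (z : C) : f z <> 0%C -> ccont f z -> ccont (fun w => / f w)%C z.
Proof.
  intros Hz H. apply (continuous_comp f (fun w => / w)%C z H).
  eapply cderiv_cont. now apply cderiv_inv_base.
Qed.

Lemma ccont_const (c z : C) : ccont (fun _ => c) z.
Proof. apply continuous_const. Qed.

Lemma ccont_id (z : C) : ccont (fun w => w) z.
Proof. apply continuous_id. Qed.

Lemma cderiv_quotient_cont (f : C -> C) (z l : C) : cderiv f z l ->
  ccont (fun w => if Ceq_dec w z then l else (f w - f z) / (w - z))%C z.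
Proof.
  intros H. apply ccont_eps. intros eps He.
  destruct (proj1 (cderiv_eps _ _ _) H (eps / 2) ltac:(lra)) as [d [Hd Hw]].
  exists d. split; auto. intros w W. specialize (Hw w W).
  destruct (Ceq_dec z z) as [_|N]; [|easy].
  destruct (Ceq_dec w z) as [->|N]; [now rewrite Cmod_minus_self|].
  assert (P := Cmod_minus_pos w z N). assert (N' := Cminus_eq_contra _ _ N).
  replace ((f w - f z) / (w - z) - l)%C with ((f w - f z - (w - z) * l) / (w - z))%C
    by (field; auto).
  rewrite Cmod_div by auto.
  apply Rle_lt_trans with (eps / 2); [|lra].
  apply Rmult_le_reg_r with (Cmod (w - z)); auto.
  unfold Rdiv at 1. rewrite Rmult_assoc, Rinv_l by lra. lra.
Qed.

(** * Integrals along axis-parallel segments and Goursat's theorem *)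

Notation rcont f t := (@continuous R_UniformSpace C_UniformSpace f t).
Notation Cint f a b := (@RInt C_R_CompleteNormedModule f a b).
Notation Cintegrable f a b := (@ex_RInt C_R_CompleteNormedModule f a b).

Lemma Cint_ex (f : R -> C) a b :
  a <= b -> (forall t, a <= t <= b -> rcont f t) -> Cintegrable f a b.
Proof.
  intros Hab H. apply (@ex_RInt_continuous C_R_CompleteNormedModule).
  rewrite Rmin_left, Rmax_right by auto. exact H.
Qed.

Lemma Cint_plus (f g : R -> C) a b : Cintegrable f a b -> Cintegrable g a b ->
  Cint (fun t => f t + g t)%C a b = (Cint f a b + Cint g a b)%C.
Proof. intros Hf Hg. exact (@RInt_plus C_R_CompleteNormedModule f g a b Hf Hg). Qed.

Lemma is_Cint_mult (c : C) (f : R -> C) a b (l : C) :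
  @is_RInt C_R_NormedModule f a b l ->
  @is_RInt C_R_NormedModule (fun t => c * f t)%C a b (c * l)%C.
Proof.
  intros H.
  pose proof (is_RInt_fct_extend_fst (U := R_NormedModule) (V := R_NormedModule) f a b l H) as H1.
  pose proof (is_RInt_fct_extend_snd (U := R_NormedModule) (V := R_NormedModule) f a b l H) as H2.
  destruct c as [c1 c2]. destruct l as [l1 l2]. unfold Cmult; simpl in *.
  apply (is_RInt_fct_extend_pair (U := R_NormedModule) (V := R_NormedModule)); simpl.
  - exact (is_RInt_minus _ _ _ _ _ _ (is_RInt_scal _ _ _ c1 _ H1) (is_RInt_scal _ _ _ c2 _ H2)).
  - exact (is_RInt_plus _ _ _ _ _ _ (is_RInt_scal _ _ _ c1 _ H2) (is_RInt_scal _ _ _ c2 _ H1)).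
Qed.

Lemma Cint_mult (c : C) (f : R -> C) a b : Cintegrable f a b ->
  Cint (fun t => c * f t)%C a b = (c * Cint f a b)%C.
Proof.
  intros Hf. apply (@is_RInt_unique C_R_CompleteNormedModule).
  apply is_Cint_mult. exact (@RInt_correct C_R_CompleteNormedModule f a b Hf).
Qed.

Lemma Cint_plus_ex (f g : R -> C) a b : Cintegrable f a b -> Cintegrable g a b ->
  Cintegrable (fun t => f t + g t)%C a b.
Proof. intros Hf Hg. exact (@ex_RInt_plus C_R_CompleteNormedModule f g a b Hf Hg). Qed.

Lemma Cint_ext (f g : R -> C) a b : a <= b ->
  (forall t, a < t < b -> f t = g t) -> Cint f a b = Cint g a b.
Proof.
  intros Hab H. apply (@RInt_ext C_R_CompleteNormedModule).
  rewrite Rmin_left, Rmax_right by auto. exact H.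
Qed.

Lemma Cint_Chasles (f : R -> C) a b c : Cintegrable f a b -> Cintegrable f b c ->
  Cint f a c = (Cint f a b + Cint f b c)%C.
Proof. intros H1 H2. symmetry. exact (@RInt_Chasles C_R_CompleteNormedModule f a b c H1 H2). Qed.

Lemma Cint_const (c : C) a b : Cint (fun _ => c) a b = (RtoC (b - a) * c)%C.
Proof.
  rewrite (@RInt_const C_R_CompleteNormedModule). apply scal_R_Cmult.
Qed.

Lemma norm_C_R (z : C) : @norm R_AbsRing C_R_NormedModule z = Cmod z.
Proof.
  destruct z as [x y]. change (sqrt (Rabs x ^ 2 + Rabs y ^ 2) = sqrt (x ^ 2 + y ^ 2)).
  now rewrite !pow2_abs.
Qed.

Lemma Cint_bound (f : R -> C) a b M : a <= b -> Cintegrable f a b ->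
  (forall t, a <= t <= b -> Cmod (f t) <= M) -> Cmod (Cint f a b) <= (b - a) * M.
Proof.
  intros Hab Hf HM. rewrite <- norm_C_R.
  apply (@norm_RInt_le_const C_R_NormedModule f a b _ M Hab).
  - intros t Ht. rewrite norm_C_R. now apply HM.
  - exact (@RInt_correct C_R_CompleteNormedModule f a b Hf).
Qed.

Lemma ccont_path (F : C -> C) (g : R -> C) t :
  ccont F (g t) -> rcont g t -> rcont (fun s => F (g s)) t.
Proof. intros HF Hg. exact (continuous_comp g F t Hg HF). Qed.

Lemma horizontal_cont (y t : R) : rcont (fun s => (s, y)) t.
Proof.
  apply (continuous_comp_2 (fun s : R => s) (fun _ => y) (fun a b => (a, b))).
  - apply continuous_id.
  - apply continuous_const.
  - apply (continuous_ext (fun z : R * R => z)); [now intros []|apply continuous_id].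
Qed.

Lemma vertical_cont (x t : R) : rcont (fun s => (x, s)) t.
Proof.
  apply (continuous_comp_2 (fun _ : R => x) (fun s => s) (fun a b => (a, b))).
  - apply continuous_const.
  - apply continuous_id.
  - apply (continuous_ext (fun z : R * R => z)); [now intros []|apply continuous_id].
Qed.

(** The hypothesis on [g] says that [g] is affine with direction [d]: all the
    paths used below are segments, and this form needs no real derivative
    of a complex-valued path. *)
Lemma path_derive (P : C -> C) (g : R -> C) (t : R) (d l : C) :
  (forall s, g s = g t + RtoC (s - t) * d)%C -> cderiv P (g t) l ->
  @is_derive R_AbsRing C_R_NormedModule (fun s => P (g s)) t (d * l)%C.
Proof.
  intros Hg HP. split; [apply is_linear_scal_l|].
  intros x Hx.
  apply (is_filter_lim_locally_unique (K := R_AbsRing) (V := R_NormedModule)) in Hx.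
  subst x. intros eps.
  assert (Hd := Cmod_ge_0 d).
  destruct (proj1 (cderiv_eps _ _ _) HP (eps / (1 + Cmod d))) as [r [Hr H]].
  { apply Rdiv_lt_0_compat; [apply cond_pos|lra]. }
  assert (Hr' : 0 < r / (1 + Cmod d)) by (apply Rdiv_lt_0_compat; lra).
  exists (mkposreal _ Hr'). intros s Hs.
  change (Rabs (s - t) < r / (1 + Cmod d)) in Hs.
  change (@norm R_AbsRing C_R_NormedModule
    (minus (minus (P (g s)) (P (g t))) (scal (s - t) (d * l)%C)) <= eps * Rabs (s - t)).
  rewrite norm_C_R, scal_R_Cmult.
  assert (E : Cmod (g s - g t) = Rabs (s - t) * Cmod d).
  { rewrite (Hg s). replace (g t + (s - t)%R * d - g t)%C with (RtoC (s - t) * d)%C by ring.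
    now rewrite Cmod_mult, Cmod_R. }
  assert (Q : Rabs (s - t) * (1 + Cmod d) < r).
  { apply (Rmult_lt_compat_r (1 + Cmod d)) in Hs; [|lra].
    replace (r / (1 + Cmod d) * (1 + Cmod d)) with r in Hs by (field; lra). exact Hs. }
  assert (Hst := Rabs_pos (s - t)).
  specialize (H (g s) ltac:(rewrite E; lra)).
  replace (minus (minus (P (g s)) (P (g t))) (RtoC (s - t) * (d * l))%C)
    with (P (g s) - P (g t) - (g s - g t) * l)%C.
  2: { rewrite (Hg s).
       change (P (g t + (s - t)%R * d) - P (g t) - (g t + (s - t)%R * d - g t) * l
         = P (g t + (s - t)%R * d) - P (g t) - (s - t)%R * (d * l))%C. ring. }
  eapply Rle_trans; [exact H|]. rewrite E.
  apply Rle_trans with (eps / (1 + Cmod d) * (Rabs (s - t) * (1 + Cmod d))).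
  - apply Rmult_le_compat_l; [|lra]. left. apply Rdiv_lt_0_compat; [apply cond_pos|lra].
  - right. field. lra.
Qed.

Lemma path_primitive (P F : C -> C) (g : R -> C) (d : C) a b :
  a <= b -> (forall s t, g s = g t + RtoC (s - t) * d)%C ->
  (forall t, rcont g t) ->
  (forall t, a <= t <= b -> cderiv P (g t) (F (g t)) /\ ccont F (g t)) ->
  (d * Cint (fun t => F (g t)) a b)%C = (P (g b) - P (g a))%C.
Proof.
  intros Hab Hg Hc HP.
  rewrite <- Cint_mult.
  2: { apply Cint_ex; auto. intros t Ht. apply ccont_path; auto. now apply HP. }
  apply (@is_RInt_unique C_R_CompleteNormedModule).
  apply (@is_RInt_derive C_R_CompleteNormedModule (fun t => P (g t)) (fun t => d * F (g t))%C);
    rewrite Rmin_left, Rmax_right by auto.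
  - intros t Ht. apply path_derive; auto. now apply HP.
  - intros t Ht. apply (ccont_path (fun w => d * F w)%C g t); auto.
    apply ccont_mult; [apply ccont_const|now apply HP].
Qed.

Lemma horizontal_affine (y s t : R) : (s, y) = ((t, y) + RtoC (s - t) * 1)%C.
Proof. unfold Cplus, Cmult, RtoC; simpl. f_equal; ring. Qed.

Lemma vertical_affine (x s t : R) : (x, s) = ((x, t) + RtoC (s - t) * Ci)%C.
Proof. unfold Cplus, Cmult, RtoC, Ci; simpl. f_equal; ring. Qed.

Definition rectint (F : C -> C) (x1 x2 y1 y2 : R) : C :=
  (Cint (fun t => F (t, y1)) x1 x2 + Ci * Cint (fun t => F (x2, t)) y1 y2
   - Cint (fun t => F (t, y2)) x1 x2 - Ci * Cint (fun t => F (x1, t)) y1 y2)%C.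

Definition cont_rect (F : C -> C) (x1 x2 y1 y2 : R) : Prop :=
  forall x y, x1 <= x <= x2 -> y1 <= y <= y2 -> ccont F (x, y).

Lemma cont_rect_h F x1 x2 y1 y2 a b y : cont_rect F x1 x2 y1 y2 ->
  x1 <= a -> a <= b -> b <= x2 -> y1 <= y <= y2 -> Cintegrable (fun t => F (t, y)) a b.
Proof.
  intros H H1 H2 H3 Hy. apply Cint_ex; auto. intros t Ht.
  apply (ccont_path F (fun s => (s, y))); [|apply horizontal_cont]. apply H; lra.
Qed.

Lemma cont_rect_v F x1 x2 y1 y2 a b x : cont_rect F x1 x2 y1 y2 ->
  y1 <= a -> a <= b -> b <= y2 -> x1 <= x <= x2 -> Cintegrable (fun t => F (x, t)) a b.
Proof.
  intros H H1 H2 H3 Hy. apply Cint_ex; auto. intros t Ht.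
  apply (ccont_path F (fun s => (x, s))); [|apply vertical_cont]. apply H; lra.
Qed.

Lemma rectint_split F x1 x2 y1 y2 x y : cont_rect F x1 x2 y1 y2 ->
  x1 <= x <= x2 -> y1 <= y <= y2 ->
  rectint F x1 x2 y1 y2 =
   (rectint F x1 x y1 y + rectint F x x2 y1 y +
    rectint F x1 x y y2 + rectint F x x2 y y2)%C.
Proof.
  intros H Hx Hy. unfold rectint.
  rewrite (Cint_Chasles (fun t => F (t, y1)) x1 x x2) by (eapply cont_rect_h; eauto; lra).
  rewrite (Cint_Chasles (fun t => F (t, y2)) x1 x x2) by (eapply cont_rect_h; eauto; lra).
  rewrite (Cint_Chasles (fun t => F (x1, t)) y1 y y2) by (eapply cont_rect_v; eauto; lra).
  rewrite (Cint_Chasles (fun t => F (x2, t)) y1 y y2) by (eapply cont_rect_v; eauto; lra).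
  ring.
Qed.

Lemma rectint_plus F G x1 x2 y1 y2 : x1 <= x2 -> y1 <= y2 ->
  cont_rect F x1 x2 y1 y2 -> cont_rect G x1 x2 y1 y2 ->
  rectint (fun z => F z + G z)%C x1 x2 y1 y2 =
  (rectint F x1 x2 y1 y2 + rectint G x1 x2 y1 y2)%C.
Proof.
  intros Hx Hy HF HG. unfold rectint.
  rewrite (Cint_plus (fun t => F (t, y1)) (fun t => G (t, y1)))
    by (eapply cont_rect_h; eauto; lra).
  rewrite (Cint_plus (fun t => F (t, y2)) (fun t => G (t, y2)))
    by (eapply cont_rect_h; eauto; lra).
  rewrite (Cint_plus (fun t => F (x1, t)) (fun t => G (x1, t)))
    by (eapply cont_rect_v; eauto; lra).
  rewrite (Cint_plus (fun t => F (x2, t)) (fun t => G (x2, t)))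
    by (eapply cont_rect_v; eauto; lra).
  ring.
Qed.

Lemma rectint_bound F x1 x2 y1 y2 M : x1 <= x2 -> y1 <= y2 ->
  cont_rect F x1 x2 y1 y2 ->
  (forall x y, x1 <= x <= x2 -> y1 <= y <= y2 -> Cmod (F (x, y)) <= M) ->
  Cmod (rectint F x1 x2 y1 y2) <= 2 * ((x2 - x1) + (y2 - y1)) * M.
Proof.
  intros Hx Hy HF HM. unfold rectint.
  assert (A1 : Cmod (Cint (fun t => F (t, y1)) x1 x2) <= (x2 - x1) * M).
  { apply Cint_bound; auto. - eapply cont_rect_h; eauto; lra. - intros t Ht; apply HM; lra. }
  assert (A2 : Cmod (Cint (fun t => F (t, y2)) x1 x2) <= (x2 - x1) * M).
  { apply Cint_bound; auto. - eapply cont_rect_h; eauto; lra. - intros t Ht; apply HM; lra. }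
  assert (A3 : Cmod (Cint (fun t => F (x1, t)) y1 y2) <= (y2 - y1) * M).
  { apply Cint_bound; auto. - eapply cont_rect_v; eauto; lra. - intros t Ht; apply HM; lra. }
  assert (A4 : Cmod (Cint (fun t => F (x2, t)) y1 y2) <= (y2 - y1) * M).
  { apply Cint_bound; auto. - eapply cont_rect_v; eauto; lra. - intros t Ht; apply HM; lra. }
  eapply Rle_trans; [apply Cmod_minus_le|].
  eapply Rle_trans; [apply Rplus_le_compat_r, Cmod_minus_le|].
  eapply Rle_trans; [apply Rplus_le_compat_r, Rplus_le_compat_r, Cmod_triangle|].
  rewrite !Cmod_mult, Cmod_Ci. lra.
Qed.

Lemma rectint_primitive P F x1 x2 y1 y2 : x1 <= x2 -> y1 <= y2 ->
  cont_rect F x1 x2 y1 y2 ->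
  (forall x y, x1 <= x <= x2 -> y1 <= y <= y2 -> cderiv P (x, y) (F (x, y))) ->
  rectint F x1 x2 y1 y2 = RtoC 0.
Proof.
  intros Hx Hy HF HP. unfold rectint.
  assert (A1 : forall y, y1 <= y <= y2 ->
     Cint (fun t => F (t, y)) x1 x2 = (P (x2, y) - P (x1, y))%C).
  { intros y Hy'. rewrite <- (Cmult_1_l (Cint _ _ _)).
    apply (path_primitive P F (fun t => (t, y))); auto.
    - intros s t. apply horizontal_affine.
    - intros t. apply horizontal_cont. }
  assert (A2 : forall x, x1 <= x <= x2 ->
     (Ci * Cint (fun t => F (x, t)) y1 y2)%C = (P (x, y2) - P (x, y1))%C).
  { intros x Hx'.
    apply (path_primitive P F (fun t => (x, t))); auto.
    - intros s t. apply vertical_affine.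
    - intros t. apply vertical_cont. }
  rewrite !A1, !A2 by lra. ring.
Qed.

Lemma nested_intervals (a b : nat -> R) :
  (forall n, a n <= a (S n)) -> (forall n, b (S n) <= b n) -> (forall n, a n <= b n) ->
  exists p, forall n, a n <= p <= b n.
Proof.
  intros Ha Hb Hab.
  assert (Ma : forall n m, (n <= m)%nat -> a n <= a m).
  { intros n m H. induction H; [lra|]. eapply Rle_trans; eauto. }
  assert (Mb : forall n m, (n <= m)%nat -> b m <= b n).
  { intros n m H. induction H; [lra|]. eapply Rle_trans; eauto. }
  assert (Mab : forall n m, a n <= b m).
  { intros n m. apply Rle_trans with (a (Nat.max n m)); [apply Ma; lia|].
    apply Rle_trans with (b (Nat.max n m)); [auto|apply Mb; lia]. }
  destruct (completeness (fun x => exists n, x = a n)) as [p [Hp1 Hp2]].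
  - exists (b O). intros x [n ->]. apply Mab.
  - exists (a O). now exists O.
  - exists p. intros n. split.
    + apply Hp1. now exists n.
    + apply Hp2. intros x [m ->]. apply Mab.
Qed.

Lemma Cmod_pair_le (x y : R) : Cmod (x, y) <= Rabs x + Rabs y.
Proof.
  replace (x, y) with (RtoC x + RtoC y * Ci)%C
    by (unfold Cplus, Cmult, RtoC, Ci; simpl; f_equal; ring).
  eapply Rle_trans; [apply Cmod_triangle|]. rewrite Cmod_mult, Cmod_Ci, !Cmod_R. lra.
Qed.

(** Bisection: if the boundary integral is not zero, one of the four quarters
    of the rectangle carries at least a quarter of it, and so on.  The nested
    rectangles shrink to a point p.  Near p the function is affine up to a
    small multiple of the distance to p; the affine part has a primitive, and
    the rest is too small to account for the integral. *)
Lemma goursat F x1 x2 y1 y2 : x1 <= x2 -> y1 <= y2 ->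
  (forall x y, x1 <= x <= x2 -> y1 <= y <= y2 -> exists l, cderiv F (x, y) l) ->
  rectint F x1 x2 y1 y2 = RtoC 0.
Proof.
  intros Hx Hy HF.
  assert (HC : cont_rect F x1 x2 y1 y2).
  { intros x y H1 H2. destruct (HF x y H1 H2) as [l Hl]. eapply cderiv_cont; eauto. }
  apply NNPP. intros Hne. apply Cmod_pos in Hne.
  set (I0 := Cmod (rectint F x1 x2 y1 y2)) in *.
  set (L := x2 - x1). set (M := y2 - y1).
  assert (HL : 0 <= L) by (unfold L; lra). assert (HM : 0 <= M) by (unfold M; lra).
  set (h := fun n : nat => / 2 ^ n).
  assert (hpos : forall n, 0 < h n) by (intros n; apply Rinv_0_lt_compat, pow_lt; lra).
  assert (hS : forall n, h (S n) = h n / 2).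
  { intros n. unfold h. simpl. rewrite Rinv_mult. field. apply pow_nonzero; lra. }
  pose (good := fun (n : nat) (p : R * R) =>
    x1 <= fst p /\ fst p + L * h n <= x2 /\ y1 <= snd p /\ snd p + M * h n <= y2 /\
    I0 * (h n * h n) <= Cmod (rectint F (fst p) (fst p + L * h n) (snd p) (snd p + M * h n))).
  assert (step : forall n (p : {p | good n p}), {q : {q | good (S n) q} |
    fst (proj1_sig p) <= fst (proj1_sig q) <= fst (proj1_sig p) + L * h (S n) /\
    snd (proj1_sig p) <= snd (proj1_sig q) <= snd (proj1_sig p) + M * h (S n)}).
  { intros n [[x y] Hp]. apply constructive_indefinite_description. simpl.
    destruct Hp as (G1 & G2 & G3 & G4 & G5). simpl in *.
    assert (K1 := hpos n). assert (K2 := hS n).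
    assert (K3 : 0 <= L * h (S n)) by (rewrite K2; nra).
    assert (K4 : 0 <= M * h (S n)) by (rewrite K2; nra).
    assert (K5 : x + L * h n = x + L * h (S n) + L * h (S n)) by (rewrite K2; field).
    assert (K6 : y + M * h n = y + M * h (S n) + M * h (S n)) by (rewrite K2; field).
    rewrite (rectint_split F x (x + L * h n) y (y + M * h n) (x + L * h (S n)) (y + M * h (S n))) in G5;
      [| intros u v Hu Hv; apply HC; lra | lra | lra].
    rewrite K5, K6 in G5.
    assert (Q : exists q, good (S n) q /\ (x <= fst q <= x + L * h (S n)) /\ (y <= snd q <= y + M * h (S n))).
    { apply NNPP. intros N.
      assert (Z : forall u v, (u = x \/ u = x + L * h (S n)) -> (v = y \/ v = y + M * h (S n)) ->
        Cmod (rectint F u (u + L * h (S n)) v (v + M * h (S n))) < I0 * (h (S n) * h (S n))).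
      { intros u v Hu Hv. apply Rnot_le_lt. intros Hle. apply N. exists (u, v). unfold good; simpl.
        repeat split; auto; destruct Hu, Hv; lra. }
      pose proof (Z _ _ (or_introl eq_refl) (or_introl eq_refl)).
      pose proof (Z _ _ (or_intror eq_refl) (or_introl eq_refl)).
      pose proof (Z _ _ (or_introl eq_refl) (or_intror eq_refl)).
      pose proof (Z _ _ (or_intror eq_refl) (or_intror eq_refl)).
      revert G5. apply Rlt_not_le.
      eapply Rle_lt_trans; [apply Cmod_triangle|].
      eapply Rle_lt_trans; [apply Rplus_le_compat_r, Cmod_triangle|].
      eapply Rle_lt_trans; [apply Rplus_le_compat_r, Rplus_le_compat_r, Cmod_triangle|].
      replace (I0 * (h n * h n)) with (4 * (I0 * (h (S n) * h (S n)))) by (rewrite K2; field).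
      lra. }
    destruct Q as [q [Hq R]]. exists (exist _ q Hq). exact R. }
  assert (g0 : good O (x1, y1)).
  { unfold good, h; simpl. replace (x1 + L * / 1) with x2 by (unfold L; field).
    replace (y1 + M * / 1) with y2 by (unfold M; field). unfold I0. repeat split; lra. }
  pose (sq := fix sq n : {p | good n p} :=
    match n with O => exist _ _ g0 | S m => proj1_sig (step m (sq m)) end).
  assert (sqS : forall n, _) by exact (fun n => proj2_sig (step n (sq n))).
  change (forall n, fst (proj1_sig (sq n)) <= fst (proj1_sig (sq (S n))) <= fst (proj1_sig (sq n)) + L * h (S n) /\
    snd (proj1_sig (sq n)) <= snd (proj1_sig (sq (S n))) <= snd (proj1_sig (sq n)) + M * h (S n)) in sqS.
  set (X := fun n => fst (proj1_sig (sq n))) in *.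
  set (Y := fun n => snd (proj1_sig (sq n))) in *.
  assert (good_n : forall n, good n (X n, Y n)).
  { intros n. unfold X, Y. rewrite <- surjective_pairing. apply proj2_sig. }
  change (forall n, X n <= X (S n) <= X n + L * h (S n) /\ Y n <= Y (S n) <= Y n + M * h (S n)) in sqS.
  assert (hh : forall n, h n = h (S n) + h (S n)) by (intros n; rewrite hS; field).
  destruct (nested_intervals X (fun n => X n + L * h n)) as [px Hpx].
  { intros n; apply sqS. }
  { intros n. destruct (sqS n). rewrite (hh n). lra. }
  { intros n. pose proof (hpos n). nra. }
  destruct (nested_intervals Y (fun n => Y n + M * h n)) as [py Hpy].
  { intros n; apply sqS. }
  { intros n. destruct (sqS n). rewrite (hh n). lra. }
  { intros n. pose proof (hpos n). nra. }
  destruct (HF px py) as [l Hl].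
  { destruct (good_n O) as (G1 & G2 & _). specialize (Hpx O). simpl in *. lra. }
  { destruct (good_n O) as (_ & _ & G1 & G2 & _). specialize (Hpy O). simpl in *. lra. }
  set (T := 1 + L + M). assert (HT : 0 < T) by (unfold T; lra).
  set (eps := I0 / (4 * (T * T))).
  assert (Heps : 0 < eps) by (apply Rdiv_lt_0_compat; nra).
  destruct (proj1 (cderiv_eps _ _ _) Hl eps Heps) as [d [Hd H]].
  assert (Hn : exists n, T * h n < d).
  { assert (E : 0 < d / T) by (apply Rdiv_lt_0_compat; lra).
    destruct (pow_lt_1_zero (/ 2)) with (y := d / T) as [n Hn]; [rewrite Rabs_pos_eq; lra|exact E|].
    exists n. specialize (Hn n (le_n _)). rewrite Rabs_pos_eq in Hn by (apply pow_le; lra).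
    unfold h. rewrite <- pow_inv. apply (Rmult_lt_compat_l T) in Hn; [|lra].
    replace (T * (d / T)) with d in Hn by (field; lra). exact Hn. }
  destruct Hn as [n Hn]. destruct (good_n n) as (G1 & G2 & G3 & G4 & G5). simpl in *.
  specialize (Hpx n). specialize (Hpy n). assert (K := hpos n).
  set (p := (px, py) : C) in *.
  assert (Near : forall x y, X n <= x <= X n + L * h n -> Y n <= y <= Y n + M * h n ->
     Cmod ((x, y) - p) <= T * h n).
  { intros x y H1 H2.
    replace ((x, y) - p)%C with ((x - px, y - py) : C) by reflexivity.
    eapply Rle_trans; [apply Cmod_pair_le|].
    assert (Rabs (x - px) <= L * h n) by (apply Rabs_le; lra).
    assert (Rabs (y - py) <= M * h n) by (apply Rabs_le; lra).
    unfold T. lra. }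
  pose (A := fun z : C => (F p + (z - p) * l)%C).
  pose (Er := fun z : C => (F z + (- (1)) * A z)%C).
  assert (CA : forall z, ccont A z).
  { intros z. unfold A. apply (ccont_plus (fun _ => F p)); [apply ccont_const|].
    apply (ccont_mult (fun w => w - p)%C); [|apply ccont_const].
    apply (ccont_plus (fun w => w) (fun _ => - p)%C); [apply ccont_id|apply ccont_const]. }
  assert (HCn : cont_rect F (X n) (X n + L * h n) (Y n) (Y n + M * h n)).
  { intros x y H1 H2; apply HC; lra. }
  assert (CE : cont_rect Er (X n) (X n + L * h n) (Y n) (Y n + M * h n)).
  { intros x y H1 H2. apply ccont_plus; [now apply HCn|].
    apply ccont_mult; [apply ccont_const|apply CA]. }
  assert (E1 : rectint F (X n) (X n + L * h n) (Y n) (Y n + M * h n) =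
    (rectint A (X n) (X n + L * h n) (Y n) (Y n + M * h n) +
    rectint Er (X n) (X n + L * h n) (Y n) (Y n + M * h n))%C).
  { rewrite <- rectint_plus; [| nra | nra | intros x y _ _; apply CA | exact CE].
    f_equal. apply functional_extensionality. intros z. unfold Er. ring. }
  rewrite (rectint_primitive (fun z => F p * (z - p) + (z - p) * (z - p) * (l / 2))%C A) in E1.
  2, 3: nra. 2: { intros x y _ _; apply CA. }
  2: { intros x y _ _. unfold A. set (z := (x, y) : C).
    assert (D1 : cderiv (fun w => w - p)%C z (RtoC 1)).
    { eapply cderiv_eq; [apply (cderiv_minus (fun w => w) (fun _ => p)); [apply cderiv_id|apply cderiv_const]|]. ring. }
    eapply cderiv_eq.
    - apply cderiv_plus; [apply cderiv_scal; exact D1|].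
      apply (cderiv_mult (fun w => (w - p) * (w - p))%C (fun _ => l / 2)%C); [|apply cderiv_const].
      apply cderiv_mult; exact D1.
    - cbeta. field. }
  rewrite E1, Cplus_0_l in G5.
  assert (B := rectint_bound Er (X n) (X n + L * h n) (Y n) (Y n + M * h n) (eps * (T * h n))).
  assert (B' : Cmod (rectint Er (X n) (X n + L * h n) (Y n) (Y n + M * h n)) <=
     2 * (X n + L * h n - X n + (Y n + M * h n - Y n)) * (eps * (T * h n))).
  { apply B; auto; try nra. intros x y H1 H2. specialize (Near x y H1 H2).
    replace (Er (x, y)) with (F (x, y) - F p - ((x, y) - p) * l)%C by (unfold Er, A; ring).
    eapply Rle_trans; [apply H; lra|]. apply Rmult_le_compat_l; lra. }
  assert (B2 : 2 * (X n + L * h n - X n + (Y n + M * h n - Y n)) * (eps * (T * h n)) <=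
     2 * (T * h n) * (eps * (T * h n))).
  { assert (Th : 0 < T * h n) by now apply Rmult_lt_0_compat.
    apply Rmult_le_compat_r; [apply Rmult_le_pos; lra|]. unfold T. nra. }
  assert (B3 : 2 * (T * h n) * (eps * (T * h n)) = I0 / 2 * (h n * h n)).
  { unfold eps. field. lra. }
  assert (0 < I0 * (h n * h n)) by (repeat apply Rmult_lt_0_compat; auto).
  lra.
Qed.

(** Nothing changes if differentiability fails at one point w where the function is
    continuous: cut out a small rectangle around w. *)
Lemma goursat_except F w x1 x2 y1 y2 : x1 <= x2 -> y1 <= y2 -> cont_rect F x1 x2 y1 y2 ->
  (forall x y, x1 <= x <= x2 -> y1 <= y <= y2 -> (x, y) <> w -> exists l, cderiv F (x, y) l) ->
  rectint F x1 x2 y1 y2 = RtoC 0.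
Proof.
  intros Hx Hy HC HF. destruct w as [p s].
  destruct (classic (x1 <= p <= x2 /\ y1 <= s <= y2)) as [[Hp Hs]|N].
  2: { apply goursat; auto. intros x y H1 H2. apply HF; auto. intros E. injection E as -> ->. tauto. }
  assert (Z : forall u1 u2 v1 v2, x1 <= u1 <= u2 /\ u2 <= x2 -> y1 <= v1 <= v2 /\ v2 <= y2 ->
    u1 = u2 \/ v1 = v2 \/ p < u1 \/ u2 < p \/ s < v1 \/ v2 < s -> rectint F u1 u2 v1 v2 = RtoC 0).
  { intros u1 u2 v1 v2 H1 H2 [->|[->|H]].
    1, 2: unfold rectint; rewrite !(@RInt_point C_R_CompleteNormedModule);
      change (@zero C_R_CompleteNormedModule) with (RtoC 0); ring.
    apply goursat; try lra. intros x y G1 G2. apply HF; try lra. intros E. injection E as -> ->. lra. }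
  apply Cmod_small. intros eps He.
  destruct (proj1 (ccont_eps _ _) (HC p s Hp Hs) 1 Rlt_0_1) as [d [Hd Hw]].
  set (M := Cmod (F (p, s)) + 1). assert (HM : 1 <= M) by (pose proof (Cmod_ge_0 (F (p, s))); unfold M; lra).
  set (e := Rmin (d / 4) (eps / (8 * M))).
  assert (E1 : 0 < e) by (apply Rmin_pos; [|apply Rdiv_lt_0_compat]; lra).
  assert (E2 : e <= d / 4) by apply Rmin_l. assert (E3 : e <= eps / (8 * M)) by apply Rmin_r.
  apply Rle_div_r in E3; [|lra].
  set (a1 := Rmax x1 (p - e)). set (a2 := Rmin x2 (p + e)).
  set (b1 := Rmax y1 (s - e)). set (b2 := Rmin y2 (s + e)).
  assert (A1 : x1 <= a1 <= p /\ p - e <= a1 /\ (x1 = a1 \/ a1 < p))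
    by (unfold a1, Rmax; destruct Rle_dec; lra).
  assert (A2 : p <= a2 <= x2 /\ a2 <= p + e /\ (a2 = x2 \/ p < a2))
    by (unfold a2, Rmin; destruct Rle_dec; lra).
  assert (B1 : y1 <= b1 <= s /\ s - e <= b1 /\ (y1 = b1 \/ b1 < s))
    by (unfold b1, Rmax; destruct Rle_dec; lra).
  assert (B2 : s <= b2 <= y2 /\ b2 <= s + e /\ (b2 = y2 \/ s < b2))
    by (unfold b2, Rmin; destruct Rle_dec; lra).
  rewrite (rectint_split F x1 x2 y1 y2 a1 b1) by (auto; lra).
  rewrite (rectint_split F a1 x2 b1 y2 a2 b2) by (try lra; intros x y H1 H2; apply HC; lra).
  rewrite (Z x1 a1 y1 b1), (Z a1 x2 y1 b1), (Z x1 a1 b1 y2), (Z a2 x2 b1 b2), (Z a1 a2 b2 y2), (Z a2 x2 b2 y2)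
    by lra.
  rewrite !Cplus_0_l, !Cplus_0_r.
  eapply Rle_trans; [apply (rectint_bound F a1 a2 b1 b2 M); try lra|].
  - intros x y H1 H2. apply HC; lra.
  - intros x y H1 H2. assert (K : Cmod ((x, y) - (p, s)) < d).
    { replace ((x, y) - (p, s))%C with ((x - p, y - s) : C) by reflexivity.
      eapply Rle_lt_trans; [apply Cmod_pair_le|].
      assert (Rabs (x - p) <= e) by (apply Rabs_le; lra). assert (Rabs (y - s) <= e) by (apply Rabs_le; lra). lra. }
    apply Hw, Cmod_near in K. unfold M. lra.
  - apply Rle_trans with (2 * ((2 * e) + (2 * e)) * M); [apply Rmult_le_compat_r; lra|lra].
Qed.

(** * Primitives on the disc *)

Definition between (a b t : R) : Prop := Rmin a b <= t <= Rmax a b.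

Lemma Cint_ex_between (f : R -> C) a b : (forall t, between a b t -> rcont f t) -> Cintegrable f a b.
Proof. exact (@ex_RInt_continuous C_R_CompleteNormedModule f a b). Qed.

Lemma Cint_swap (f : R -> C) a b : Cintegrable f b a -> Cint f a b = (- Cint f b a)%C.
Proof. intros H. symmetry. exact (@opp_RInt_swap C_R_CompleteNormedModule f b a H). Qed.

Lemma Cint_bound_between (f : R -> C) a b M : Cintegrable f a b ->
  (forall t, between a b t -> Cmod (f t) <= M) -> Cmod (Cint f a b) <= Rabs (b - a) * M.
Proof.
  intros Hf HM. unfold between in HM. destruct (Rle_dec a b) as [Hab|Hab].
  - rewrite Rmin_left, Rmax_right in HM by auto. rewrite Rabs_pos_eq by lra.
    now apply Cint_bound.
  - rewrite Rmin_right, Rmax_left in HM by lra.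
    assert (Hf' : Cintegrable f b a) by now apply ex_RInt_swap.
    rewrite (Cint_swap f a b Hf'), Cmod_opp, Rabs_left1 by lra.
    replace (- (b - a)) with (a - b) by ring. apply Cint_bound; auto. lra.
Qed.

Lemma between_l a b : between a b a.
Proof. split; [apply Rmin_l|apply Rmax_l]. Qed.

Lemma between_abs a b t : between a b t -> Rabs (t - a) <= Rabs (b - a).
Proof.
  unfold between, Rmin, Rmax. destruct (Rle_dec a b); intros H.
  - rewrite !Rabs_pos_eq; lra.
  - rewrite !Rabs_left1; lra.
Qed.

Lemma between_end a b t : between a b t -> Rabs t <= Rabs a \/ Rabs t <= Rabs b.
Proof.
  unfold between, Rmin, Rmax, Rabs. destruct (Rle_dec a b); intros H; repeat destruct Rcase_abs; lra.
Qed.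

Lemma disc_components (x y x' y' : R) : Rabs x <= Rabs x' -> Rabs y <= Rabs y' ->
  disc (x', y') -> disc (x, y).
Proof.
  intros Hx Hy. apply Rle_lt_trans. unfold Cmod; simpl fst; simpl snd. apply sqrt_le_1_alt.
  apply Rsqr_le_abs_1 in Hx, Hy. unfold Rsqr in *. simpl. lra.
Qed.

Lemma disc_box x1 x2 y1 y2 x y : disc (x1, y1) -> disc (x1, y2) -> disc (x2, y1) -> disc (x2, y2) ->
  between x1 x2 x -> between y1 y2 y -> disc (x, y).
Proof.
  intros D11 D12 D21 D22 Hx Hy.
  destruct (between_end _ _ _ Hx) as [Hx'|Hx'], (between_end _ _ _ Hy) as [Hy'|Hy'];
    eapply disc_components; eauto.
Qed.

Lemma components_le_Cmod (z : C) : Rabs (fst z) <= Cmod z /\ Rabs (snd z) <= Cmod z.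
Proof.
  assert (H := Rmax_Cmod z). split; eapply Rle_trans; try exact H; [apply Rmax_l|apply Rmax_r].
Qed.

Lemma disc_0 : disc 0.
Proof. unfold disc. rewrite Cmod_0. lra. Qed.

Section DiscPrimitive.
Variables (q : C -> C) (p : C).
Hypothesis q_cont : forall z, disc z -> ccont q z.
Hypothesis q_diff : forall z, disc z -> z <> p -> exists l, cderiv q z l.

Lemma horizontal_ex x1 x2 y : disc (x1, y) -> disc (x2, y) -> Cintegrable (fun t => q (t, y)) x1 x2.
Proof.
  intros D1 D2. apply Cint_ex_between. intros t Ht.
  apply (ccont_path q (fun s => (s, y))); [|apply horizontal_cont].
  apply q_cont. apply (disc_box x1 x2 y y); auto using between_l.
Qed.

Lemma vertical_ex x y1 y2 : disc (x, y1) -> disc (x, y2) -> Cintegrable (fun t => q (x, t)) y1 y2.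
Proof.
  intros D1 D2. apply Cint_ex_between. intros t Ht.
  apply (ccont_path q (fun s => (x, s))); [|apply vertical_cont].
  apply q_cont. apply (disc_box x x y1 y2); auto using between_l.
Qed.

(** A side that runs backwards changes the sign of the integral, so that all four
    orientations reduce to the standard one. *)
Lemma goursat_disc x1 x2 y1 y2 : disc (x1, y1) -> disc (x1, y2) -> disc (x2, y1) -> disc (x2, y2) ->
  rectint q x1 x2 y1 y2 = RtoC 0.
Proof.
  intros D11 D12 D21 D22.
  assert (HC : forall x y, between x1 x2 x -> between y1 y2 y -> ccont q (x, y)).
  { intros x y Hx Hy. apply q_cont. now apply (disc_box x1 x2 y1 y2). }
  assert (HF : forall x y, between x1 x2 x -> between y1 y2 y -> (x, y) <> p ->
    exists l, cderiv q (x, y) l).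
  { intros x y Hx Hy. apply q_diff. now apply (disc_box x1 x2 y1 y2). }
  unfold between in HC, HF.
  destruct (Rle_dec x1 x2) as [Hx|Hx]; destruct (Rle_dec y1 y2) as [Hy|Hy];
   repeat (rewrite (Rmin_left x1 x2), (Rmax_right x1 x2) in HC, HF by lra);
   repeat (rewrite (Rmin_right x1 x2), (Rmax_left x1 x2) in HC, HF by lra);
   repeat (rewrite (Rmin_left y1 y2), (Rmax_right y1 y2) in HC, HF by lra);
   repeat (rewrite (Rmin_right y1 y2), (Rmax_left y1 y2) in HC, HF by lra);
   apply (goursat_except q p) in HF; auto; try lra; unfold rectint in *;
   try match type of HF with context [RInt _ x2 x1] =>
     rewrite (Cint_swap (fun t => q (t, y1)) x1 x2), (Cint_swap (fun t => q (t, y2)) x1 x2)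
       by now apply horizontal_ex end;
   try match type of HF with context [RInt _ y2 y1] =>
     rewrite (Cint_swap (fun t => q (x1, t)) y1 y2), (Cint_swap (fun t => q (x2, t)) y1 y2)
       by now apply vertical_ex end;
   try exact HF; try (rewrite <- HF; ring); rewrite <- Copp_0, <- HF; ring.
Qed.
(** The primitive is the integral along the bent path from 0 that runs first
    horizontally, then vertically.  By Goursat's theorem its increment from z to w is
    the integral along a bent path from z to w. *)
Lemma disc_primitive : exists F : C -> C, F 0 = 0%C /\ forall z, disc z -> cderiv F z (q z).
Proof.
  set (F := fun z : C => (Cint (fun t => q (t, 0)) 0 (fst z)
     + Ci * Cint (fun t => q (fst z, t)) 0 (snd z))%C).
  assert (D : forall z, disc z -> cderiv F z (q z)).
  2: { exists F. split; auto.
       unfold F; simpl. rewrite !(@RInt_point C_R_CompleteNormedModule).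
       change (@zero C_R_CompleteNormedModule) with (RtoC 0). ring. }
  intros z Hz. apply cderiv_eps. intros eps He. unfold disc in Hz.
  destruct (proj1 (ccont_eps q z) (q_cont z Hz) (eps / 2) ltac:(lra)) as [d [Hd Hqd]].
  exists (Rmin (d / 2) ((1 - Cmod z) / 2)). split; [apply Rmin_pos; lra|].
  intros w Hw. destruct (Rmin_Rgt_l _ _ _ Hw) as [W1 W2].
  destruct z as [x y], w as [x' y'].
  assert (Ed : ((x', y') - (x, y))%C = ((x' - x, y' - y) : C)) by reflexivity.
  destruct (components_le_Cmod (x' - x, y' - y)) as [Dx Dy]. simpl fst in Dx; simpl snd in Dy.
  rewrite <- Ed in Dx, Dy. set (k := Cmod ((x', y') - (x, y))) in *.
  (* all points of the bent path from z to w are within 2k of z *)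
  assert (Near : forall t s, Rabs (t - x) <= k -> Rabs (s - y) <= k ->
     Cmod ((t, s) - (x, y)) < d /\ disc (t, s)).
  { intros t s Ht Hs. replace ((t, s) - (x, y))%C with ((t - x, s - y) : C) by reflexivity.
    assert (B : Cmod (t - x, s - y) <= 2 * k) by (eapply Rle_trans; [apply Cmod_pair_le|lra]).
    split; [lra|]. unfold disc. replace (t, s) with (Cplus (x, y) (t - x, s - y)).
    - eapply Rle_lt_trans; [apply Cmod_triangle|]. lra.
    - unfold Cplus; simpl. f_equal; ring. }
  assert (Hk : 0 <= k) by apply Cmod_ge_0.
  assert (Z0 : Rabs (x - x) <= k /\ Rabs (y - y) <= k).
  { replace (x - x) with 0 by ring. replace (y - y) with 0 by ring. rewrite Rabs_R0. lra. }
  assert (Dxy : disc (x', y)) by (apply Near; [apply Dx|apply Z0]).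
  assert (Dw : disc (x', y')) by now apply Near.
  assert (axis : forall t s, disc (t, s) -> disc (t, 0)).
  { intros t s. apply disc_components; [lra|rewrite Rabs_R0; apply Rabs_pos]. }
  assert (Dx0 := axis _ _ Hz). assert (Dx0' := axis _ _ Dxy).
  assert (D0 : disc (0, 0)) by exact disc_0.
  assert (G := goursat_disc x x' 0 y Dx0 Hz Dx0' Dxy).
  assert (Hxy := horizontal_ex x x' y Hz Dxy). assert (Chy := vertical_ex x' y y' Dxy Dw).
  set (c := (- q (x, y))%C).
  assert (E : (F (x', y') - F (x, y) - ((x', y') - (x, y)) * q (x, y))%C =
    (Cint (fun t => q (t, y) + c) x x' + Ci * Cint (fun t => q (x', t) + c) y y')%C).
  { rewrite !Cint_plus, !Cint_const; auto; try (apply (@ex_RInt_const C_R_CompleteNormedModule)).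
    unfold F; simpl fst; simpl snd. unfold rectint in G.
    rewrite (Cint_Chasles (fun t => q (t, 0)) 0 x x') by now apply horizontal_ex.
    rewrite (Cint_Chasles (fun t => q (x', t)) 0 y y') by (auto; now apply vertical_ex).
    apply Cminus_0. rewrite <- G. unfold c.
    replace ((x', y') - (x, y))%C with (RtoC (x' - x) + Ci * RtoC (y' - y))%C.
    2: { unfold Cplus, Cmult, Cminus, Copp, RtoC, Ci; simpl. apply injective_projections; simpl; ring. }
    ring. }
  rewrite E. eapply Rle_trans; [apply Cmod_triangle|]. rewrite Cmod_mult, Cmod_Ci, Rmult_1_l.
  assert (B1 : Cmod (Cint (fun t => q (t, y) + c)%C x x') <= Rabs (x' - x) * (eps / 2)).
  { apply Cint_bound_between.
    - apply Cint_plus_ex; auto. apply (@ex_RInt_const C_R_CompleteNormedModule).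
    - intros t Ht. apply between_abs in Ht. left. unfold c. apply Hqd, Near; lra. }
  assert (B2 : Cmod (Cint (fun t => q (x', t) + c)%C y y') <= Rabs (y' - y) * (eps / 2)).
  { apply Cint_bound_between.
    - apply Cint_plus_ex; auto. apply (@ex_RInt_const C_R_CompleteNormedModule).
    - intros t Ht. apply between_abs in Ht. left. unfold c. apply Hqd, Near; lra. }
  assert (Rabs (x' - x) * (eps / 2) <= k * (eps / 2)) by (apply Rmult_le_compat_r; lra).
  assert (Rabs (y' - y) * (eps / 2) <= k * (eps / 2)) by (apply Rmult_le_compat_r; lra).
  lra.
Qed.
End DiscPrimitive.

Lemma segment_cont (z d : C) t : rcont (fun t => z + RtoC t * d)%C t.
Proof.
  intros P HP. apply (proj1 (locally_C _ _)) in HP. destruct HP as [e He].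
  pose proof (Cmod_ge_0 d) as Hd.
  assert (He' : 0 < e / (1 + Cmod d)) by (apply Rdiv_lt_0_compat; [apply cond_pos|lra]).
  exists (mkposreal _ He'). intros s Hs. change (Rabs (s - t) < e / (1 + Cmod d)) in Hs.
  apply He. change (Cmod ((z + s * d) - (z + t * d)) < e).
  replace ((z + s * d) - (z + t * d))%C with (RtoC (s - t) * d)%C by (rewrite RtoC_minus; ring).
  rewrite Cmod_mult, Cmod_R. apply (Rmult_lt_compat_r (1 + Cmod d)) in Hs; [|lra].
  replace (e / (1 + Cmod d) * (1 + Cmod d)) with (pos e) in Hs by (field; lra).
  pose proof (Rabs_pos (s - t)). nra.
Qed.

Lemma mean_value_inequality (f df : C -> C) (z w : C) M :
  (forall t, 0 <= t <= 1 -> cderiv f (z + RtoC t * (w - z))%C (df (z + RtoC t * (w - z))%C) /\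
     ccont df (z + RtoC t * (w - z))%C /\ Cmod (df (z + RtoC t * (w - z))%C) <= M) ->
  Cmod (f w - f z) <= M * Cmod (w - z).
Proof.
  intros H. set (g := fun t : R => (z + RtoC t * (w - z))%C).
  assert (P := path_primitive f df g (w - z)%C 0 1 ltac:(lra)).
  replace (f w - f z)%C with (f (g 1) - f (g 0))%C by (unfold g; do 2 f_equal; ring).
  rewrite <- P.
  - rewrite Cmod_mult, Rmult_comm. apply Rmult_le_compat_r; [apply Cmod_ge_0|].
    replace M with ((1 - 0) * M) by ring. apply Cint_bound; [lra| |].
    + apply Cint_ex; [lra|]. intros t Ht. apply ccont_path; [now apply H|apply segment_cont].
    + intros t Ht. now apply H.
  - intros s t. unfold g. rewrite RtoC_minus. ring.
  - intros t. apply segment_cont.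
  - intros t Ht. split; now apply H.
Qed.

Lemma disc_segment (z w : C) r t : Cmod z < r -> Cmod w < r -> 0 <= t <= 1 ->
  Cmod (z + RtoC t * (w - z)) < r.
Proof.
  intros Hz Hw Ht. replace (z + t * (w - z))%C with (RtoC (1 - t) * z + RtoC t * w)%C
    by (rewrite RtoC_minus; ring).
  eapply Rle_lt_trans; [apply Cmod_triangle|]. rewrite !Cmod_mult, !Cmod_R, !Rabs_pos_eq by lra.
  pose proof (Cmod_ge_0 z). pose proof (Cmod_ge_0 w).
  destruct (Req_dec t 0) as [->|N]; nra.
Qed.

Lemma zero_derivative_const (f : C -> C) r : (forall z, Cmod z < r -> cderiv f z (RtoC 0)) ->
  forall z, Cmod z < r -> f z = f 0.
Proof.
  intros H z Hz. pose proof (Cmod_ge_0 z). apply Cminus_0, Cmod_small. intros eps He.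
  apply Rle_trans with (0 * Cmod (z - 0)); [|lra].
  apply (mean_value_inequality f (fun _ => RtoC 0)). intros t Ht. split; [|split].
  - apply H, disc_segment; auto. rewrite Cmod_0. lra.
  - apply ccont_const.
  - rewrite Cmod_0. lra.
Qed.

(** * The complex exponential *)

Definition cexp (z : C) : C := (exp (fst z) * cos (snd z), exp (fst z) * sin (snd z)).

Lemma cexp_plus z w : cexp (z + w) = (cexp z * cexp w)%C.
Proof.
  unfold cexp, Cplus, Cmult; simpl. rewrite exp_plus, cos_plus, sin_plus.
  f_equal; ring.
Qed.

Lemma cexp_0 : cexp 0 = 1%C.
Proof. unfold cexp, RtoC; simpl. rewrite exp_0, cos_0, sin_0. f_equal; ring. Qed.

Lemma Cmod_cexp z : Cmod (cexp z) = exp (fst z).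
Proof.
  unfold Cmod, cexp; simpl fst; simpl snd.
  replace ((exp (fst z) * cos (snd z)) ^ 2 + (exp (fst z) * sin (snd z)) ^ 2)
    with ((exp (fst z))²).
  - apply sqrt_Rsqr. left. apply exp_pos.
  - assert (H := sin2_cos2 (snd z)). unfold Rsqr in *. simpl. nra.
Qed.

Lemma cexp_neq_0 z : cexp z <> 0%C.
Proof. apply Cmod_gt_0. rewrite Cmod_cexp. apply exp_pos. Qed.

Lemma exp_le_mono a b : a <= b -> exp a <= exp b.
Proof. intros [H| ->]; [left; now apply exp_increasing|lra]. Qed.

Lemma derive_eps_0 (f : R -> R) l eps : is_derive f 0 l -> 0 < eps ->
  exists d, 0 < d /\ forall x, Rabs x < d -> Rabs (f x - f 0 - x * l) <= eps * Rabs x.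
Proof.
  intros H He. apply is_derive_Reals in H. destruct (H eps He) as [d Hd].
  exists d. split; [apply cond_pos|]. intros x Hx.
  destruct (Req_dec x 0) as [->|N].
  - replace (f 0 - f 0 - 0 * l) with 0 by ring. rewrite Rabs_R0. lra.
  - specialize (Hd x N Hx). rewrite Rplus_0_l in Hd.
    replace (f x - f 0 - x * l) with (((f x - f 0) / x - l) * x) by (field; auto).
    rewrite Rabs_mult. apply Rmult_le_compat_r; [apply Rabs_pos|lra].
Qed.

Lemma cderiv_cexp_0 : cderiv cexp (RtoC 0) (RtoC 1).
Proof.
  apply cderiv_eps. intros eps0 He0. set (eps := Rmin 1 (eps0 / 10)).
  assert (He : 0 < eps) by (apply Rmin_pos; lra).
  assert (Hle : 10 * eps <= eps0) by (assert (eps <= eps0 / 10) by apply Rmin_r; lra).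
  assert (Hle1 : eps <= 1) by apply Rmin_l.
  destruct (derive_eps_0 exp 1 eps) as [d1 [Hd1 H1]]; auto.
  { replace 1 with (exp 0) by apply exp_0. apply is_derive_exp. }
  destruct (derive_eps_0 sin 1 eps) as [d2 [Hd2 H2]]; auto.
  { replace 1 with (cos 0) by apply cos_0. apply is_derive_sin. }
  destruct (derive_eps_0 cos 0 eps) as [d3 [Hd3 H3]]; auto.
  { replace 0 with (- sin 0) at 2 by (rewrite sin_0; ring). apply is_derive_cos. }
  exists (Rmin eps (Rmin d1 (Rmin d2 d3))). split; [apply Rmin_pos; [exact He|repeat apply Rmin_pos; auto]|].
  intros w Hw. replace (w - 0)%C with w in * by ring. destruct w as [x y].
  set (D := Cmod (x, y)) in *.
  assert (Hm := Rmax_Cmod (x, y)). simpl in Hm. fold D in Hm.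
  assert (Hx : Rabs x <= D) by (eapply Rle_trans; [apply Rmax_l|exact Hm]).
  assert (Hy : Rabs y <= D) by (eapply Rle_trans; [apply Rmax_r|exact Hm]).
  destruct (Rmin_Rgt_l _ _ _ Hw) as [W0 W]. destruct (Rmin_Rgt_l _ _ _ W) as [W1 W'].
  destruct (Rmin_Rgt_l _ _ _ W') as [W2 W3].
  specialize (H1 x ltac:(lra)). specialize (H2 y ltac:(lra)). specialize (H3 y ltac:(lra)).
  rewrite exp_0 in H1. rewrite sin_0 in H2. rewrite cos_0 in H3.
  replace (cexp (x, y) - cexp 0 - (x, y) * 1)%C
    with ((exp x - 1 - x * 1) + exp x * (cos y - 1 - y * 0),
          exp x * (sin y - 0 - y * 1) + (exp x - 1) * y : R).
  2: { rewrite cexp_0. unfold cexp, Cminus, Cplus, Copp, Cmult, RtoC; simpl. f_equal; ring. }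
  assert (HD : 0 <= D) by apply Cmod_ge_0.
  pose proof (Rabs_pos x). pose proof (Rabs_pos y).
  assert (E : Rabs (exp x - 1) <= 2 * Rabs x).
  { replace (exp x - 1) with ((exp x - 1 - x * 1) + x) by ring.
    eapply Rle_trans; [apply Rabs_triang|]. nra. }
  assert (E3 : Rabs (exp x) <= 3).
  { replace (exp x) with ((exp x - 1) + 1) by ring.
    eapply Rle_trans; [apply Rabs_triang|]. rewrite Rabs_R1. lra. }
  eapply Rle_trans; [apply Cmod_pair_le|].
  eapply Rle_trans; [apply Rplus_le_compat; apply Rabs_triang|].
  rewrite !Rabs_mult.
  assert (Rabs (exp x) * Rabs (cos y - 1 - y * 0) <= 3 * (eps * Rabs y))
    by (apply Rmult_le_compat; auto using Rabs_pos).
  assert (Rabs (exp x) * Rabs (sin y - 0 - y * 1) <= 3 * (eps * Rabs y))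
    by (apply Rmult_le_compat; auto using Rabs_pos).
  assert (Rabs (exp x - 1) * Rabs y <= 2 * eps * D) by (apply Rmult_le_compat; auto using Rabs_pos; lra).
  assert (eps * Rabs x <= eps * D) by (apply Rmult_le_compat_l; lra).
  assert (eps * Rabs y <= eps * D) by (apply Rmult_le_compat_l; lra).
  assert (10 * eps * D <= eps0 * D) by (apply Rmult_le_compat_r; lra).
  assert (0 <= eps * D) by (apply Rmult_le_pos; lra). lra.
Qed.

Lemma cderiv_cexp z : cderiv cexp z (cexp z).
Proof.
  apply (cderiv_ext_loc (fun w => cexp z * cexp (w - z))%C cexp z (cexp z) 1); [lra| |].
  - intros w _. rewrite <- cexp_plus. f_equal. ring.
  - eapply cderiv_eq.
    + apply cderiv_scal. apply (cderiv_comp cexp (fun w => w - z)%C).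
      * apply (cderiv_minus (fun w => w) (fun _ => z)); [apply cderiv_id|apply cderiv_const].
      * replace (z - z)%C with (RtoC 0) by ring. apply cderiv_cexp_0.
    + cbeta. ring.
Qed.

(** * Integrals over circles and Cauchy's formula *)

Definition circ (r t : R) : C := (r * cos t, r * sin t).

Lemma Cmod_circ r t : 0 <= r -> Cmod (circ r t) = r.
Proof.
  intros Hr. unfold circ, Cmod; simpl fst; simpl snd.
  replace ((r * cos t) ^ 2 + (r * sin t) ^ 2) with (r²).
  - now apply sqrt_Rsqr.
  - assert (H := sin2_cos2 t). unfold Rsqr in *. simpl. nra.
Qed.

Lemma circ_lip r r0 s t : 0 <= r0 ->
  Cmod (circ r s - circ r0 t) <= 2 * Rabs (r - r0) + 2 * r0 * Rabs (s - t).
Proof.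
  intros Hr.
  assert (Hc : Rabs (cos s - cos t) <= Rabs (s - t)).
  { rewrite <- (Rmult_1_l (Rabs (s - t))).
    apply (bounded_variation cos (fun x => - sin x)). intros x _. split.
    - apply is_derive_cos.
    - rewrite Rabs_Ropp. apply Rabs_le. apply SIN_bound. }
  assert (Hs : Rabs (sin s - sin t) <= Rabs (s - t)).
  { rewrite <- (Rmult_1_l (Rabs (s - t))).
    apply (bounded_variation sin (fun x => cos x)). intros x _. split.
    - apply is_derive_sin.
    - apply Rabs_le. apply COS_bound. }
  replace (circ r s - circ r0 t)%C with
    (((r - r0) * cos s + r0 * (cos s - cos t), (r - r0) * sin s + r0 * (sin s - sin t)) : C).
  2: { unfold circ, Cminus, Cplus, Copp; simpl. f_equal; ring. }
  eapply Rle_trans; [apply Cmod_pair_le|].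
  eapply Rle_trans; [apply Rplus_le_compat; apply Rabs_triang|].
  rewrite !Rabs_mult, (Rabs_pos_eq r0) by auto.
  assert (Rabs (cos s) <= 1) by (apply Rabs_le, COS_bound).
  assert (Rabs (sin s) <= 1) by (apply Rabs_le, SIN_bound).
  pose proof (Rabs_pos (r - r0)). pose proof (Rabs_pos (s - t)). nra.
Qed.

Lemma circ_cont r t : 0 <= r -> rcont (circ r) t.
Proof.
  intros Hr P HP. apply (proj1 (locally_C _ _)) in HP. destruct HP as [e He].
  assert (Hd : 0 < e / (2 * r + 1)) by (apply Rdiv_lt_0_compat; [apply cond_pos|lra]).
  exists (mkposreal _ Hd). intros s Hs. change (Rabs (s - t) < e / (2 * r + 1)) in Hs.
  apply He. change (Cmod (circ r s - circ r t) < e).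
  eapply Rle_lt_trans; [apply circ_lip; auto|].
  replace (r - r) with 0 by ring. rewrite Rabs_R0.
  apply (Rmult_lt_compat_r (2 * r + 1)) in Hs; [|lra].
  replace (e / (2 * r + 1) * (2 * r + 1)) with (pos e) in Hs by (field; lra).
  pose proof (Rabs_pos (s - t)). nra.
Qed.

Definition circle_int (G : C -> C) (r : R) : C := Cint (fun t => G (circ r t)) 0 (2 * PI).

Lemma two_PI_pos : 0 < 2 * PI.
Proof. pose proof PI_RGT_0. lra. Qed.

Lemma circle_ex (G : C -> C) r : 0 <= r -> (forall z, Cmod z = r -> ccont G z) ->
  Cintegrable (fun t => G (circ r t)) 0 (2 * PI).
Proof.
  intros Hr H. apply Cint_ex; [left; apply two_PI_pos|]. intros t _.
  apply ccont_path; [apply H, Cmod_circ; auto|now apply circ_cont].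
Qed.

Lemma circle_bound_param (G : C -> C) r M : 0 <= r -> (forall z, Cmod z = r -> ccont G z) ->
  (forall t, 0 <= t <= 2 * PI -> Cmod (G (circ r t)) <= M) ->
  Cmod (circle_int G r) <= 2 * PI * M.
Proof.
  intros Hr H HM. replace (2 * PI * M) with ((2 * PI - 0) * M) by ring.
  apply Cint_bound; [left; apply two_PI_pos|now apply circle_ex|exact HM].
Qed.

Lemma circle_bound (G : C -> C) r M : 0 <= r -> (forall z, Cmod z = r -> ccont G z) ->
  (forall z, Cmod z = r -> Cmod (G z) <= M) -> Cmod (circle_int G r) <= 2 * PI * M.
Proof.
  intros Hr H HM. apply circle_bound_param; auto.
  intros t _. apply HM, Cmod_circ; auto.
Qed.

Lemma circle_bounded (c : C -> C) r : 0 <= r -> (forall z, Cmod z = r -> ccont c z) ->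
  exists M, 0 <= M /\ forall t, 0 <= t <= 2 * PI -> Cmod (c (circ r t)) <= M.
Proof.
  intros Hr H.
  destruct (continuity_ab_maj (fun t => Cmod (c (circ r t))) 0 (2 * PI)) as [m [Hm _]].
  - left. apply two_PI_pos.
  - intros t _. apply continuity_pt_filterlim.
    apply (continuous_comp (fun s => c (circ r s)) Cmod).
    + apply ccont_path; [apply H, Cmod_circ; auto|now apply circ_cont].
    + intros P [e He]. apply (proj2 (locally_C _ _)). exists e. intros w Hw.
      apply He. change (Rabs (Cmod w - Cmod (c (circ r t))) < e).
      change (Cmod (w - c (circ r t)) < e) in Hw.
      apply Rabs_lt_between. assert (A1 := Cmod_minus_ge w (c (circ r t))).
      assert (A2 := Cmod_minus_ge (c (circ r t)) w). rewrite Cmod_minus_sym in A2. lra.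
  - exists (Cmod (c (circ r m))). split; [apply Cmod_ge_0|exact Hm].
Qed.

Lemma circle_ext (G H : C -> C) r : 0 <= r -> (forall z, Cmod z = r -> G z = H z) ->
  circle_int G r = circle_int H r.
Proof.
  intros Hr E. apply Cint_ext; [left; apply two_PI_pos|].
  intros t _. apply E, Cmod_circ; auto.
Qed.

Lemma circle_plus (G H : C -> C) r : 0 <= r ->
  (forall z, Cmod z = r -> ccont G z) -> (forall z, Cmod z = r -> ccont H z) ->
  circle_int (fun z => G z + H z)%C r = (circle_int G r + circle_int H r)%C.
Proof.
  intros Hr HG HH. apply (Cint_plus (fun t => G (circ r t)) (fun t => H (circ r t)));
  now apply circle_ex.
Qed.

Lemma circle_mult (c : C) (G : C -> C) r : 0 <= r ->
  (forall z, Cmod z = r -> ccont G z) ->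
  circle_int (fun z => c * G z)%C r = (c * circle_int G r)%C.
Proof.
  intros Hr HG. apply (Cint_mult c (fun t => G (circ r t))); now apply circle_ex.
Qed.

Lemma circle_const (c : C) r : circle_int (fun _ => c) r = (RtoC (2 * PI) * c)%C.
Proof. unfold circle_int. rewrite Cint_const. do 2 f_equal. ring. Qed.

(** In the coordinate [cexp] the circle becomes a vertical segment of height
    2 PI, at whose ends a function on the plane takes the same value. *)
Lemma circle_primitive (P G : C -> C) r : 0 < r ->
  (forall z, Cmod z = r -> cderiv P z (G z) /\ ccont G z) -> circle_int (fun z => z * G z)%C r = 0%C.
Proof.
  intros Hr H.
  assert (E : forall t, circ r t = cexp (ln r, t)).
  { intros t. unfold circ, cexp; simpl. now rewrite exp_ln. }
  assert (M : forall t, Cmod (cexp (ln r, t)) = r) by (intros t; rewrite <- E; apply Cmod_circ; lra).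
  assert (K := path_primitive (fun z => P (cexp z)) (fun z => cexp z * G (cexp z))%C
    (fun t => (ln r, t)) Ci 0 (2 * PI) (Rlt_le _ _ two_PI_pos)).
  replace (circle_int (fun z => z * G z)%C r)
    with (Cint (fun t => cexp (ln r, t) * G (cexp (ln r, t)))%C 0 (2 * PI))
    by (apply Cint_ext; [left; apply two_PI_pos|]; intros t _; now rewrite E).
  replace (Cint _ _ _) with (/ Ci * (Ci * Cint (fun t => cexp (ln r, t) * G (cexp (ln r, t)))%C 0 (2 * PI)))%C
    by (field; apply Ci_nz).
  rewrite K.
  - replace (cexp (ln r, 2 * PI)) with (cexp (ln r, 0)); [ring|].
    unfold cexp; simpl. now rewrite sin_2PI, cos_2PI, sin_0, cos_0.
  - intros s t. apply vertical_affine.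
  - intros t. apply vertical_cont.
  - intros t _. destruct (H _ (M t)) as [H1 H2].
    assert (Ce : ccont cexp (ln r, t)) by (eapply cderiv_cont; apply cderiv_cexp).
    split.
    + apply cderiv_comp; [apply cderiv_cexp|exact H1].
    + apply ccont_mult; [exact Ce|]. exact (continuous_comp cexp G _ Ce H2).
Qed.

Lemma Cmod_lt_neq (z w : C) : Cmod w < Cmod z -> (z - w)%C <> 0%C.
Proof. intros H E. apply Cminus_0 in E. subst. lra. Qed.

(** Differentiation under the integral sign, in the form that uses a second
    order remainder bounded uniformly over the circle. *)
Lemma circle_int_derive (k : C -> C -> C) (k1 : C -> C) (z : C) r d M : 0 <= r -> 0 < d ->
  (forall w x, Cmod (w - z) < d -> Cmod x = r -> ccont (k w) x) ->
  (forall x, Cmod x = r -> ccont k1 x) ->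
  (forall w t, Cmod (w - z) < d -> 0 <= t <= 2 * PI -> let x := circ r t in
     Cmod (k w x - k z x - (w - z) * k1 x) <= M * (Cmod (w - z) * Cmod (w - z))) ->
  cderiv (fun w => circle_int (k w) r) z (circle_int k1 r).
Proof.
  intros Hr Hd Hk Hk1 HM. pose proof PI_RGT_0 as HPI.
  apply cderiv_eps. intros eps He.
  assert (HP : 0 < 1 + 2 * PI * Rabs M) by (pose proof (Rabs_pos M); nra).
  exists (Rmin d (eps / (1 + 2 * PI * Rabs M))). split.
  { apply Rmin_pos; auto. now apply Rdiv_lt_0_compat. }
  intros w Hw.
  destruct (Rmin_Rgt_l _ _ _ Hw) as [W1 W2].
  assert (Z : Cmod (z - z) < d) by now rewrite Cmod_minus_self.
  assert (Kc : forall (c : C) (G : C -> C), (forall x, Cmod x = r -> ccont G x) ->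
     forall x, Cmod x = r -> ccont (fun x => c * G x)%C x).
  { intros c G HG x Hx. apply ccont_mult; [apply ccont_const|auto]. }
  assert (HB : Cmod (circle_int (fun x => k w x + (- (1)) * k z x + (- (w - z)) * k1 x)%C r)
     <= 2 * PI * (M * (Cmod (w - z) * Cmod (w - z)))).
  { apply circle_bound_param; auto.
    - intros x Hx. apply ccont_plus; [apply ccont_plus|]; auto.
    - intros t Ht. eapply Rle_trans; [|exact (HM w t W1 Ht)]. right. f_equal. ring. }
  rewrite circle_plus, circle_plus, !circle_mult in HB; auto.
  2: { intros x Hx. apply ccont_plus; auto. }
  replace (circle_int (k w) r - circle_int (k z) r - (w - z) * circle_int k1 r)%C with
    (circle_int (k w) r + - (1) * circle_int (k z) r + - (w - z) * circle_int k1 r)%C by ring.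
  eapply Rle_trans; [exact HB|].
  set (D := Cmod (w - z)) in *. assert (0 <= D) by apply Cmod_ge_0.
  apply (Rmult_lt_compat_l (1 + 2 * PI * Rabs M)) in W2; auto.
  replace ((1 + 2 * PI * Rabs M) * (eps / (1 + 2 * PI * Rabs M))) with eps in W2 by (field; lra).
  assert (M <= Rabs M) by apply Rle_abs.
  replace (2 * PI * (M * (D * D))) with ((2 * PI * M * D) * D) by ring.
  apply Rmult_le_compat_r; auto.
  assert (M * D <= Rabs M * D) by now apply Rmult_le_compat_r.
  assert (PI * (M * D) <= PI * (Rabs M * D)) by (apply Rmult_le_compat_l; lra).
  lra.
Qed.

(** * Derivatives and quotients of holomorphic maps *)

Lemma Cmod_inv_le (a : C) m : 0 < m -> m <= Cmod a -> a <> 0%C /\ Cmod (/ a) <= / m.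
Proof.
  intros Hm Ha. assert (N : a <> 0%C) by (apply Cmod_gt_0; lra).
  split; auto. rewrite Cmod_inv by auto. now apply Rinv_le_contravar.
Qed.

Section CauchyIntegrals.
Variables (c : C -> C) (r : R).
Hypothesis c_cont : forall x, Cmod x = r -> ccont c x.

Lemma kernel_cont (k : C -> C) (w : C) (m : nat) : Cmod w < r ->
  (forall x, Cmod x = r -> ccont (fun x => c x * (/ (x - w)) ^ m)%C x).
Proof.
  intros Hw x Hx. apply ccont_mult; [now apply c_cont|].
  assert (I : ccont (fun x => / (x - w))%C x).
  { apply (ccont_inv (fun x => x - w)%C); [apply Cmod_lt_neq; lra|].
    eapply cderiv_cont, cderiv_shift. }
  induction m as [|m IH]; [apply ccont_const|].
  now apply (ccont_mult (fun x => / (x - w))%C).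
Qed.

(** [E] is the second order remainder of the m-th power of the kernel, as a
    function of 1 / (x - w) and 1 / (x - z). *)
Lemma kernel_derivative (m : nat) (k : C -> C) (E : C -> C -> C) (z : C) B : Cmod z < r ->
  (forall x, Cmod x = r -> ccont k x) ->
  (forall w x, (x - w)%C <> 0%C -> (x - z)%C <> 0%C ->
    (c x * (/ (x - w)) ^ m - c x * (/ (x - z)) ^ m - (w - z) * k x =
     c x * E (/ (x - w)) (/ (x - z)) * ((w - z) * (w - z)))%C) ->
  (forall p q, Cmod p <= 2 / (r - Cmod z) -> Cmod q <= 2 / (r - Cmod z) -> Cmod (E p q) <= B) ->
  cderiv (fun w => circle_int (fun x => c x * (/ (x - w)) ^ m)%C r) z (circle_int k r).
Proof.
  intros Hz Hk HE HB. pose proof (Cmod_ge_0 z) as Z.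
  destruct (circle_bounded c r) as [K [HK HKc]]; [lra|auto|].
  apply (circle_int_derive _ _ _ _ ((r - Cmod z) / 2) (K * B)); try lra; auto.
  - intros w x Hw Hx. apply Cmod_near in Hw. apply kernel_cont; auto. lra.
  - intros w t Hw Ht x. assert (Hx : Cmod x = r) by (apply Cmod_circ; lra).
    apply Cmod_near in Hw.
    assert (Inv : forall v, Cmod v < Cmod z + (r - Cmod z) / 2 ->
      (x - v)%C <> 0%C /\ Cmod (/ (x - v)) <= 2 / (r - Cmod z)).
    { intros v Hv. replace (2 / (r - Cmod z)) with (/ ((r - Cmod z) / 2)) by (field; lra).
      assert (Q := Cmod_minus_ge x v). apply Cmod_inv_le; lra. }
    destruct (Inv w Hw) as [Nw Bw]. destruct (Inv z) as [Nz Bz]; [lra|].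
    rewrite HE by auto. rewrite 2!Cmod_mult, (Cmod_mult (w - z)). apply Rmult_le_compat_r.
    { apply Rmult_le_pos; apply Cmod_ge_0. }
    apply Rmult_le_compat; auto using Cmod_ge_0. now apply HKc.
Qed.

Lemma cauchy_integral_derive_1 (z : C) : Cmod z < r ->
  cderiv (fun w => circle_int (fun x => c x * (/ (x - w)) ^ 1)%C r) z
    (circle_int (fun x => c x * (/ (x - z)) ^ 2)%C r).
Proof.
  intros Hz. set (m := 2 / (r - Cmod z)).
  apply (kernel_derivative 1 _ (fun p q => p * q * q)%C z (m * m * m)); auto.
  - intros x Hx. now apply kernel_cont.
  - intros w x Nw Nz. simpl. field. auto.
  - intros p q Hp Hq. rewrite !Cmod_mult.
    repeat apply Rmult_le_compat; auto using Cmod_ge_0, Rmult_le_pos.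
Qed.

Lemma cauchy_integral_derive_2 (z : C) : Cmod z < r ->
  exists l, cderiv (fun w => circle_int (fun x => c x * (/ (x - w)) ^ 2)%C r) z l.
Proof.
  intros Hz. set (m := 2 / (r - Cmod z)). eexists.
  apply (kernel_derivative 2 (fun x => 2 * (c x * (/ (x - z)) ^ 3))%C
    (fun p q => p * q * q * (p + 2 * q))%C z (m * m * m * (m + 2 * m))); auto.
  - intros x Hx. apply (ccont_mult (fun _ => RtoC 2)); [apply ccont_const|]. now apply kernel_cont.
  - intros w x Nw Nz. simpl. field. auto.
  - intros p q Hp Hq. rewrite !Cmod_mult.
    repeat apply Rmult_le_compat; auto using Cmod_ge_0, Rmult_le_pos.
    eapply Rle_trans; [apply Cmod_triangle|]. rewrite Cmod_scal by lra. fold m in Hp, Hq. lra.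
Qed.

End CauchyIntegrals.

(** The derivative in w is the integral of z / (z - w)^2, which vanishes because
    1 / (z - w)^2 has the primitive - 1 / (z - w) on the circle.  So the integral
    does not depend on w, and for w = 0 the integrand is 1. *)
Lemma circle_kernel (w : C) r : Cmod w < r ->
  circle_int (fun z => z / (z - w))%C r = RtoC (2 * PI).
Proof.
  intros Hw. pose proof (Cmod_ge_0 w).
  set (K := fun w => circle_int (fun x => x * (/ (x - w)) ^ 1)%C r).
  assert (DK : forall v, Cmod v < r -> cderiv K v (RtoC 0)).
  { intros v Hv. pose proof (Cmod_ge_0 v).
    rewrite <- (circle_primitive (fun z => - / (z - v))%C (fun z => (/ (z - v)) ^ 2)%C r).
    - apply (cauchy_integral_derive_1 (fun x => x)); auto. intros; apply ccont_id.
    - lra.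
    - intros z Hz. assert (N : (z - v)%C <> 0%C) by (apply Cmod_lt_neq; lra). split.
      + eapply cderiv_eq.
        * apply cderiv_opp. apply (cderiv_inv (fun z => z - v)%C); [exact N|apply cderiv_shift].
        * cbeta. simpl. field. exact N.
      + assert (I := kernel_cont (fun _ => RtoC 1) r (fun _ _ => ccont_const 1 _) (fun x => x) v 2 Hv z Hz).
        revert I. apply continuous_ext. intros x. apply Cmult_1_l. }
  assert (E : K w = K 0) by now apply (zero_derivative_const K r).
  rewrite (circle_ext _ (fun x => x * (/ (x - w)) ^ 1)%C).
  - change (K w = RtoC (2 * PI)). rewrite E. unfold K.
    rewrite (circle_ext _ (fun _ => RtoC 1)); [rewrite circle_const; ring|lra|].
    intros x Hx. simpl. field. intros E0. rewrite E0, Cmod_0 in Hx. lra.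
  - lra.
  - intros x Hx. simpl. field. apply Cmod_lt_neq. lra.
Qed.

Lemma holo_cderiv (f : C -> C) z : holomorphic f -> disc z -> cderiv f z (C_derive f z).
Proof. intros H Hz. destruct (H z Hz) as [l Hl]. now rewrite (is_C_derive_unique _ _ _ Hl). Qed.

Lemma holo_cont (f : C -> C) z : holomorphic f -> disc z -> ccont f z.
Proof. intros H Hz. eapply cderiv_cont. now apply holo_cderiv. Qed.

(** The quotient is continuous on the disc and differentiable away from w, which is
    enough for Goursat's theorem. *)
Lemma quotient_primitive (f : C -> C) w : holomorphic f -> disc w ->
  exists Q F : C -> C, (forall z, disc z -> f z = (f w + (z - w) * Q z)%C /\ ccont Q z) /\
    forall z, disc z -> cderiv F z (Q z).
Proof.
  intros Hf Hw.
  set (Q := fun z => if Ceq_dec z w then C_derive f w else ((f z - f w) / (z - w))%C).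
  assert (HQ : forall z, disc z -> z <> w -> exists l, cderiv Q z l).
  { intros z Hz N. eexists.
    apply (cderiv_ext_loc (fun z => (f z - f w) / (z - w))%C Q z _ (Cmod (z - w))).
    - now apply Cmod_minus_pos.
    - intros v Hv. unfold Q. destruct (Ceq_dec v w) as [->|]; [|easy].
      rewrite Cmod_minus_sym in Hv. lra.
    - apply (cderiv_div (fun z => f z - f w)%C (fun z => z - w)%C).
      + now apply Cminus_eq_contra.
      + apply (cderiv_minus f (fun _ => f w)); [now apply holo_cderiv|apply cderiv_const].
      + apply cderiv_shift. }
  assert (CQ : forall z, disc z -> ccont Q z).
  { intros z Hz. destruct (Ceq_dec z w) as [->|N].
    - apply cderiv_quotient_cont. now apply holo_cderiv.
    - destruct (HQ z Hz N) as [m Hm]. eapply cderiv_cont; eauto. }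
  destruct (disc_primitive Q w CQ HQ) as [F [_ DF]]. exists Q, F. split; auto.
  intros z Hz. split; auto. unfold Q. destruct (Ceq_dec z w) as [->|N]; [ring|].
  field. now apply Cminus_eq_contra.
Qed.

Lemma cauchy_formula (f : C -> C) w r : holomorphic f -> Cmod w < r -> r < 1 ->
  circle_int (fun z => f z * (z / (z - w)))%C r = (RtoC (2 * PI) * f w)%C.
Proof.
  intros Hf Hw Hr. pose proof (Cmod_ge_0 w).
  destruct (quotient_primitive f w Hf) as [Q [F [HQ DF]]]; [unfold disc; lra|].
  assert (Dr : forall z, Cmod z = r -> disc z) by (intros z Hz; unfold disc; lra).
  rewrite (circle_ext _ (fun z => z * Q z + f w * (z / (z - w)))%C) by
    (try lra; intros z Hz; rewrite (proj1 (HQ z (Dr z Hz))); field; apply Cmod_lt_neq; lra).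
  assert (CK : forall z, Cmod z = r -> ccont (fun z => z / (z - w))%C z).
  { intros z Hz. eapply cderiv_cont. apply (cderiv_div (fun z => z) (fun z => z - w)%C);
      [apply Cmod_lt_neq; lra|apply cderiv_id|apply cderiv_shift]. }
  rewrite circle_plus, circle_mult, circle_kernel, (circle_primitive F Q); try lra; auto.
  - ring.
  - intros z Hz. split; [apply DF|apply HQ]; auto.
  - intros z Hz. apply ccont_mult; [apply ccont_id|apply HQ; auto].
  - intros z Hz. apply ccont_mult; [apply ccont_const|auto].
Qed.

Lemma two_PI_neq_0 : RtoC (2 * PI) <> 0%C.
Proof. apply RtoC_neq_0. pose proof two_PI_pos. lra. Qed.

Lemma circle_cont_holo f r : holomorphic f -> r < 1 -> forall x, Cmod x = r -> ccont f x.
Proof. intros H Hr x Hx. apply holo_cont; auto. unfold disc. lra. Qed.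

Lemma holo_cauchy_rep (f : C -> C) (w : C) r : holomorphic f -> Cmod w < r -> r < 1 ->
  f w = (/ RtoC (2 * PI) * circle_int (fun x => (x * f x) * (/ (x - w)) ^ 1)%C r)%C.
Proof.
  intros Hf Hw Hr. pose proof (Cmod_ge_0 w).
  rewrite (circle_ext _ (fun z => f z * (z / (z - w)))%C r) by
    (try lra; intros; simpl; field; apply Cmod_lt_neq; lra).
  rewrite cauchy_formula by auto. field. apply two_PI_neq_0.
Qed.

Lemma holomorphic_derive (f : C -> C) : holomorphic f -> holomorphic (C_derive f).
Proof.
  intros Hf z Hz. unfold disc in Hz. set (r := (1 + Cmod z) / 2).
  assert (Hr : Cmod z < r < 1) by (unfold r; lra).
  assert (Cc : forall x, Cmod x = r -> ccont (fun x => x * f x)%C x).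
  { intros x Hx. apply ccont_mult; [apply ccont_id|]. apply (circle_cont_holo f r); auto; lra. }
  destruct (cauchy_integral_derive_2 _ r Cc z) as [l Hl]; [lra|].
  exists (/ RtoC (2 * PI) * l)%C.
  apply (cderiv_ext_loc (fun w => / RtoC (2 * PI) *
     circle_int (fun x => (x * f x) * (/ (x - w)) ^ 2)%C r)%C _ _ _ (r - Cmod z)); [lra| |now apply cderiv_scal].
  intros w Hw. apply Cmod_near in Hw. symmetry. apply is_C_derive_unique.
  apply (cderiv_ext_loc (fun w => / RtoC (2 * PI) *
     circle_int (fun x => (x * f x) * (/ (x - w)) ^ 1)%C r)%C _ _ _ (r - Cmod w)); [lra| |].
  - intros v Hv. apply Cmod_near in Hv. symmetry. apply holo_cauchy_rep; auto; lra.
  - apply cderiv_scal. apply cauchy_integral_derive_1; auto; lra.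
Qed.

Lemma holomorphic_quotient (f : C -> C) : holomorphic f ->
  exists q, holomorphic q /\ forall z, disc z -> f z = (f 0 + z * q z)%C.
Proof.
  intros Hf. destruct (quotient_primitive f 0 Hf disc_0) as [Q [F [HQ DF]]].
  exists (C_derive F). split.
  - apply holomorphic_derive. intros z Hz. exists (Q z). now apply DF.
  - intros z Hz. rewrite (is_C_derive_unique _ _ _ (DF z Hz)), (proj1 (HQ z Hz)) at 1. ring.
Qed.

(** * Schwarz's lemma *)

Lemma holo_const (c : C) : holomorphic (fun _ => c).
Proof. intros z _. eexists. apply cderiv_const. Qed.

Lemma holo_id : holomorphic (fun z => z).
Proof. intros z _. eexists. apply cderiv_id. Qed.

Lemma holo_minus (f g : C -> C) : holomorphic f -> holomorphic g -> holomorphic (fun z => f z - g z)%C.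
Proof. intros Hf Hg z Hz. destruct (Hf z Hz), (Hg z Hz). eexists. apply cderiv_minus; eauto. Qed.

Lemma holo_mult (f g : C -> C) : holomorphic f -> holomorphic g -> holomorphic (fun z => f z * g z)%C.
Proof. intros Hf Hg z Hz. destruct (Hf z Hz), (Hg z Hz). eexists. apply cderiv_mult; eauto. Qed.

Lemma holo_div (f g : C -> C) : holomorphic f -> holomorphic g ->
  (forall z, disc z -> g z <> 0%C) -> holomorphic (fun z => f z / g z)%C.
Proof. intros Hf Hg N z Hz. destruct (Hf z Hz), (Hg z Hz). eexists. apply cderiv_div; eauto. Qed.

Lemma holo_comp (f g : C -> C) : holomorphic f -> holomorphic g -> self_map g ->
  holomorphic (fun z => f (g z)).
Proof.
  intros Hf Hg S z Hz. destruct (Hg z Hz) as [m Hm], (Hf (g z) (S z Hz)) as [l Hl].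
  eexists. apply cderiv_comp; eauto.
Qed.

Lemma holo_pow (f : C -> C) n : holomorphic f -> holomorphic (fun z => f z ^ n)%C.
Proof.
  intros Hf. induction n as [|n IH]; [exact (holo_const 1)|]. exact (holo_mult f _ Hf IH).
Qed.

Lemma le_of_powers (a b K : R) : 0 <= a -> 0 <= b ->
  (forall n, a ^ n <= K * b ^ n) -> a <= b.
Proof.
  intros Ha Hb H. apply Rnot_lt_le. intros Hlt.
  destruct (Req_dec b 0) as [->|Nb].
  - specialize (H 1%nat). simpl in H. lra.
  - assert (Q : Rabs (a / b) > 1).
    { rewrite Rabs_pos_eq by (apply Rmult_le_pos; [lra|left; apply Rinv_0_lt_compat; lra]).
      apply Rlt_gt, Rmult_lt_reg_r with b; [lra|]. unfold Rdiv. rewrite Rmult_assoc, Rinv_l; lra. }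
    destruct (Pow_x_infinity (a / b) Q (Rabs K + 1)) as [N HN].
    specialize (HN N (le_n _)). specialize (H N).
    assert (P : 0 < b ^ N) by (apply pow_lt; lra).
    rewrite Rabs_pos_eq in HN.
    2: { apply pow_le, Rmult_le_pos; [lra|left; apply Rinv_0_lt_compat; lra]. }
    assert (E : (a / b) ^ N * b ^ N = a ^ N).
    { rewrite <- Rpow_mult_distr. f_equal. field. auto. }
    pose proof (Rle_abs K). nra.
Qed.

(** Cauchy's formula for the powers of [g] bounds |g w|^n by a constant times
    M^n; the constant disappears as n grows. *)
Lemma modulus_le_of_circle (g : C -> C) r M w : holomorphic g -> Cmod w < r -> r < 1 ->
  (forall x, Cmod x = r -> Cmod (g x) <= M) -> Cmod (g w) <= M.
Proof.
  intros Hg Hw Hr HM. pose proof (Cmod_ge_0 w) as W. pose proof PI_RGT_0 as HPI.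
  assert (HM0 : 0 <= M).
  { eapply Rle_trans; [apply Cmod_ge_0|]. apply (HM (circ r 0)). apply Cmod_circ. lra. }
  apply (le_of_powers _ _ (r / (r - Cmod w))); auto using Cmod_ge_0.
  intros n. rewrite <- Cmod_pow.
  assert (E := cauchy_formula (fun z => g z ^ n)%C w r (holo_pow g n Hg) Hw Hr).
  apply (f_equal Cmod) in E. rewrite Cmod_mult, Cmod_R, (Rabs_pos_eq (2 * PI)) in E by lra.
  assert (B : Cmod (circle_int (fun z => g z ^ n * (z / (z - w)))%C r) <= 2 * PI * (M ^ n * (r / (r - Cmod w)))).
  { apply circle_bound; [lra| |].
    - intros x Hx. apply ccont_mult; [now apply (circle_cont_holo _ r); [apply holo_pow|..]|].
      eapply cderiv_cont. apply (cderiv_div (fun z => z) (fun z => z - w)%C);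
        [apply Cmod_lt_neq; lra|apply cderiv_id|apply cderiv_shift].
    - intros x Hx. assert (N : (x - w)%C <> 0%C) by (apply Cmod_lt_neq; lra).
      rewrite Cmod_mult, Cmod_pow, Cmod_div by auto. rewrite Hx.
      apply Rmult_le_compat.
      + apply pow_le, Cmod_ge_0.
      + apply Rmult_le_pos; [lra|]. left. now apply Rinv_0_lt_compat, Cmod_pos.
      + apply pow_incr. split; [apply Cmod_ge_0|now apply HM].
      + apply Rmult_le_compat_l; [lra|]. apply Rinv_le_contravar; [lra|].
        assert (Q := Cmod_minus_ge x w). lra. }
  rewrite E in B. apply Rmult_le_reg_l in B; lra.
Qed.

(** Schwarz's lemma, with the quotient f z / z in the conclusion: Harnack's
    inequality and Hurwitz's theorem are applied to this quotient. *)
Lemma schwarz_quotient (f : C -> C) M : holomorphic f -> f 0 = 0%C ->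
  (forall z, disc z -> Cmod (f z) <= M) ->
  exists q, holomorphic q /\ (forall z, disc z -> f z = (z * q z)%C) /\
    (forall z, disc z -> Cmod (q z) <= M).
Proof.
  intros Hf H0 HM. destruct (holomorphic_quotient f Hf) as [q [Hq E]].
  exists q. split; auto. split.
  { intros z Hz. rewrite E, H0 by auto. ring. }
  intros w Hw. unfold disc in Hw. pose proof (Cmod_ge_0 w) as W.
  assert (HM0 : 0 <= M) by (eapply Rle_trans; [apply Cmod_ge_0|apply (HM 0), disc_0]).
  assert (B : forall r, Cmod w < r < 1 -> r * Cmod (q w) <= M).
  { intros r Hr. apply Rmult_le_reg_l with (/ r); [apply Rinv_0_lt_compat; lra|].
    rewrite <- Rmult_assoc, Rinv_l, Rmult_1_l by lra.
    apply (modulus_le_of_circle q r); auto; try lra.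
    intros x Hx. apply Rmult_le_reg_l with r; [lra|].
    rewrite <- Rmult_assoc, Rinv_r, Rmult_1_l by lra.
    rewrite <- Hx at 1. rewrite <- Cmod_mult.
    replace (x * q x)%C with (f x); [apply HM; unfold disc; lra|].
    rewrite E, H0; [ring|unfold disc; lra]. }
  apply Rnot_lt_le. intros Hlt.
  set (a := Cmod (q w)) in *.
  set (r := Rmax ((1 + Cmod w) / 2) ((1 + M / a) / 2)).
  assert (A : M / a < 1).
  { apply Rmult_lt_reg_r with a; [lra|]. unfold Rdiv. rewrite Rmult_assoc, Rinv_l; lra. }
  assert (R1 : (1 + Cmod w) / 2 <= r) by apply Rmax_l.
  assert (R2 : (1 + M / a) / 2 <= r) by apply Rmax_r.
  assert (R3 : r < 1) by (apply Rmax_lub_lt; lra).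
  specialize (B r ltac:(lra)).
  assert (M = M / a * a) by (field; lra). nra.
Qed.

(** * Moebius transformations and the Schwarz-Pick lemma *)

(** The automorphism of the disc that sends [a] to 0.  The modulus of [mob a z]
    is the pseudo-hyperbolic distance between [a] and [z]. *)
Definition mob (a z : C) : C := ((z - a) / (1 - Cconj a * z))%C.

Lemma mob_den (a z : C) : disc a -> disc z -> (1 - Cconj a * z)%C <> 0%C.
Proof.
  unfold disc. intros Ha Hz. apply Cmod_gt_0.
  assert (Q := Cmod_minus_ge 1 (Cconj a * z)). rewrite Cmod_1, Cmod_mult, Cmod_conj in Q.
  pose proof (Cmod_ge_0 a). pose proof (Cmod_ge_0 z). nra.
Qed.

Lemma mob_den_le (a z : C) : disc a -> disc z -> Cmod (1 - Cconj a * z) <= 2.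
Proof.
  unfold disc. intros Ha Hz.
  assert (Q := Cmod_minus_le 1 (Cconj a * z)). rewrite Cmod_1, Cmod_mult, Cmod_conj in Q.
  pose proof (Cmod_ge_0 a). pose proof (Cmod_ge_0 z). nra.
Qed.

Lemma Cmod_sqr (z : C) : Cmod z * Cmod z = fst z * fst z + snd z * snd z.
Proof.
  assert (H := Cmod2_alt z). unfold Re, Im in H. simpl in H. lra.
Qed.

Lemma mob_identity (a z : C) : disc a -> disc z ->
  (1 - Cmod (mob a z) * Cmod (mob a z)) * (Cmod (1 - Cconj a * z) * Cmod (1 - Cconj a * z)) =
  (1 - Cmod a * Cmod a) * (1 - Cmod z * Cmod z).
Proof.
  intros Ha Hz. assert (N := mob_den a z Ha Hz).
  unfold mob. rewrite Cmod_div by auto. assert (P := Cmod_pos _ N).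
  replace ((1 - Cmod (z - a) / Cmod (1 - Cconj a * z) * (Cmod (z - a) / Cmod (1 - Cconj a * z))) *
    (Cmod (1 - Cconj a * z) * Cmod (1 - Cconj a * z))) with
    (Cmod (1 - Cconj a * z) * Cmod (1 - Cconj a * z) - Cmod (z - a) * Cmod (z - a)) by (field; lra).
  rewrite !Cmod_sqr. destruct a as [a1 a2], z as [z1 z2]. simpl. ring.
Qed.

Lemma disc_sqr (z : C) : disc z <-> 0 < 1 - Cmod z * Cmod z.
Proof. unfold disc. pose proof (Cmod_ge_0 z). split; nra. Qed.

Lemma mob_disc (a z : C) : disc a -> disc z -> disc (mob a z).
Proof.
  intros Ha Hz. assert (E := mob_identity a z Ha Hz).
  assert (P := Cmod_pos _ (mob_den a z Ha Hz)).
  apply disc_sqr. apply disc_sqr in Ha, Hz.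
  apply Rmult_lt_reg_r with (Cmod (1 - Cconj a * z) * Cmod (1 - Cconj a * z)); [nra|].
  rewrite E. nra.
Qed.

Lemma disc_opp a : disc a -> disc (- a).
Proof. unfold disc. now rewrite Cmod_opp. Qed.

Lemma RtoC_1mod_neq (a : C) : disc a -> (1 - a * Cconj a)%C <> 0%C.
Proof.
  intros Ha. rewrite <- Cmod2_conj, <- RtoC_minus. intros E. apply RtoC_inj in E.
  apply disc_sqr in Ha. simpl in E. lra.
Qed.

Lemma mob_inv (a z : C) : disc a -> disc z -> mob (- a) (mob a z) = z.
Proof.
  intros Ha Hz. assert (N := mob_den a z Ha Hz).
  assert (N' := RtoC_1mod_neq a Ha).
  unfold mob. rewrite Copp_conj. field. split; auto.
  now replace (1 - Cconj a * z - - Cconj a * (z - a))%C with (1 - a * Cconj a)%C by ring.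
Qed.

Lemma mob_inv' (a z : C) : disc a -> disc z -> mob a (mob (- a) z) = z.
Proof.
  intros Ha Hz. replace a with (- - a)%C at 1 by ring. apply mob_inv; auto using disc_opp.
Qed.

Lemma mob_self (a : C) : mob a a = 0%C.
Proof. unfold mob. replace (a - a)%C with (RtoC 0) by ring. unfold Cdiv. ring. Qed.

Lemma mob_at_0 (a : C) : mob a 0 = (- a)%C.
Proof. unfold mob. replace (1 - Cconj a * 0)%C with (RtoC 1) by ring. field. Qed.

Lemma mob_0 (z : C) : mob 0 z = z.
Proof.
  unfold mob. replace (Cconj 0) with (RtoC 0) by (unfold Cconj, RtoC; simpl; f_equal; ring). field.
Qed.

Lemma mob_inj (a z w : C) : disc a -> disc z -> disc w -> mob a z = mob a w -> z = w.
Proof. intros Ha Hz Hw E. rewrite <- (mob_inv a z), E, mob_inv; auto. Qed.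

Lemma mob_opp_0 (a : C) : mob (- a) 0 = a.
Proof. rewrite mob_at_0. ring. Qed.

Lemma mob_cderiv (a z : C) : disc a -> disc z ->
  cderiv (mob a) z ((1 - a * Cconj a) / ((1 - Cconj a * z) * (1 - Cconj a * z)))%C.
Proof.
  intros Ha Hz. assert (N := mob_den a z Ha Hz). eapply cderiv_eq.
  - apply (cderiv_div (fun z => z - a)%C (fun z => 1 - Cconj a * z)%C); auto.
    + apply cderiv_shift.
    + apply (cderiv_minus (fun _ => RtoC 1) (fun z => Cconj a * z)%C); [apply cderiv_const|].
      apply cderiv_scal, cderiv_id.
  - cbeta. field. auto.
Qed.

Lemma holo_mob a : disc a -> holomorphic (mob a).
Proof. intros Ha z Hz. eexists. now apply mob_cderiv. Qed.

Lemma self_map_mob a : disc a -> self_map (mob a).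
Proof. intros Ha z Hz. now apply mob_disc. Qed.

(** Schwarz's lemma in the coordinate [mob w]: a Taylor formula of order one at
    w whose coefficient is again holomorphic, with an explicit bound. *)
Lemma bounded_increment (f : C -> C) M : holomorphic f ->
  (forall z, disc z -> Cmod (f z) <= M) ->
  forall w, disc w -> exists q, holomorphic q /\ (forall z, disc z -> Cmod (q z) <= 2 * M) /\
   forall z, disc z -> f z = (f w + mob w z * q (mob w z))%C.
Proof.
  intros Hf HM w Hw. assert (Hw' := disc_opp w Hw).
  destruct (schwarz_quotient (fun z => f (mob (- w) z) - f w)%C (2 * M)) as [q (Hq & E & B)].
  - apply holo_minus; [|apply holo_const]. apply holo_comp; auto using holo_mob, self_map_mob.
  - rewrite mob_opp_0. ring.
  - intros z Hz. eapply Rle_trans; [apply Cmod_minus_le|].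
    pose proof (HM w Hw). pose proof (HM _ (mob_disc _ z Hw' Hz)). lra.
  - exists q. repeat split; auto. intros z Hz. rewrite <- E by now apply mob_disc.
    rewrite mob_inv by auto. ring.
Qed.

Lemma increment_derivative (f q : C -> C) w : holomorphic q -> disc w ->
  (forall z, disc z -> f z = (f w + mob w z * q (mob w z))%C) ->
  C_derive f w = (q 0 / (1 - Cconj w * w))%C.
Proof.
  intros Hq Hw Eq. assert (N := mob_den w w Hw Hw). apply is_C_derive_unique.
  apply (cderiv_ext_loc (fun z => f w + mob w z * q (mob w z))%C _ _ _ (1 - Cmod w)).
  - unfold disc in Hw. lra.
  - intros z Hz. apply Cmod_near in Hz. symmetry. apply Eq. unfold disc. lra.
  - eapply cderiv_eq.
    + apply cderiv_plus; [apply cderiv_const|]. apply cderiv_mult; [now apply mob_cderiv|].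
      apply (cderiv_comp q (mob w)); [now apply mob_cderiv|].
      apply holo_cderiv; auto. now apply mob_disc.
    + cbeta. rewrite mob_self. field. auto.
Qed.

Lemma derivative_bound (f : C -> C) M w : holomorphic f -> (forall z, disc z -> Cmod (f z) <= M) ->
  disc w -> Cmod (C_derive f w) <= 2 * M / (1 - Cmod w).
Proof.
  intros Hf HM Hw. destruct (bounded_increment f M Hf HM w Hw) as [q (Hq & Bq & Eq)].
  assert (N := mob_den w w Hw Hw).
  rewrite (increment_derivative f q w Hq Hw Eq), Cmod_div by auto. apply Rmult_le_compat.
  - apply Cmod_ge_0.
  - left. now apply Rinv_0_lt_compat, Cmod_pos.
  - apply Bq, disc_0.
  - unfold disc in Hw. apply Rinv_le_contravar; [lra|].
    assert (Q := Cmod_minus_ge 1 (Cconj w * w)). rewrite Cmod_1, Cmod_mult, Cmod_conj in Q.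
    pose proof (Cmod_ge_0 w). nra.
Qed.

Lemma bounded_lipschitz (f : C -> C) M z w : holomorphic f ->
  (forall z, disc z -> Cmod (f z) <= M) -> disc z -> disc w ->
  Cmod (f z - f w) <= 2 * M * Cmod (mob w z).
Proof.
  intros Hf HM Hz Hw. destruct (bounded_increment f M Hf HM w Hw) as [q (Hq & B & E)].
  rewrite (E z Hz). replace (f w + mob w z * q (mob w z) - f w)%C with (mob w z * q (mob w z))%C by ring.
  rewrite Cmod_mult. rewrite Rmult_comm. apply Rmult_le_compat_r; [apply Cmod_ge_0|].
  apply B. now apply mob_disc.
Qed.

Lemma schwarz_pick (f : C -> C) z w : holomorphic f -> self_map f -> disc z -> disc w ->
  Cmod (mob (f w) (f z)) <= Cmod (mob w z).
Proof.
  intros Hf Sf Hz Hw. assert (Hw' := disc_opp w Hw).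
  destruct (schwarz_quotient (fun z => mob (f w) (f (mob (- w) z))) 1) as [q (Hq & E & B)].
  - apply (holo_comp (mob (f w)) (fun z => f (mob (- w) z))).
    + now apply holo_mob, Sf.
    + apply holo_comp; auto using holo_mob, self_map_mob.
    + intros x Hx. now apply Sf, mob_disc.
  - rewrite mob_opp_0. apply mob_self.
  - intros x Hx. left. apply mob_disc; [now apply Sf|]. now apply Sf, mob_disc.
  - specialize (E (mob w z) (mob_disc _ _ Hw Hz)). cbv beta in E. rewrite mob_inv in E by auto.
    rewrite E, Cmod_mult. pose proof (B (mob w z) (mob_disc _ _ Hw Hz)).
    pose proof (Cmod_ge_0 (mob w z)). nra.
Qed.

(** The Schwarz-Pick lemma for s q, with s < 1, bounds the pseudo-hyperbolic
    distance between s q z and s (q z1) by a constant rho < 1.  As s tends to 1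
    this becomes |q z - q z1| <= rho |1 - conj (q z1) q z|, and the right-hand
    side is rho |q z - q z1| because |q z1| = 1. *)
Lemma maximum_modulus_const (q : C -> C) z1 : holomorphic q ->
  (forall z, disc z -> Cmod (q z) <= 1) -> disc z1 -> Cmod (q z1) = 1 ->
  forall z, disc z -> q z = q z1.
Proof.
  intros Hq B H1 E z Hz. set (rho := Cmod (mob z1 z)).
  assert (Hrho : rho < 1) by now apply mob_disc.
  assert (Hrho0 : 0 <= rho) by apply Cmod_ge_0.
  assert (S : forall s, 0 < s < 1 -> s * Cmod (q z - q z1) <= rho * (Cmod (q z - q z1) + 2 * (1 - s))).
  { intros s Hs.
    assert (SD : forall x, disc x -> disc (RtoC s * q x)).
    { intros x Hx. unfold disc. rewrite Cmod_scal by lra. pose proof (B x Hx). nra. }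
    assert (P := schwarz_pick (fun x => RtoC s * q x)%C z z1).
    assert (P' : Cmod (mob (s * q z1) (s * q z)) <= rho).
    { apply P; auto. apply holo_mult; auto. apply holo_const. }
    unfold mob in P'. rewrite Cmod_div in P' by (apply mob_den; auto).
    assert (D := Cmod_pos _ (mob_den (s * q z1) (s * q z) (SD _ H1) (SD _ Hz))).
    apply (Rmult_le_compat_r _ _ _ (Rlt_le _ _ D)) in P'.
    unfold Rdiv in P'. rewrite Rmult_assoc, Rinv_l, Rmult_1_r in P' by lra.
    replace (s * q z - s * q z1)%C with (RtoC s * (q z - q z1))%C in P' by ring.
    rewrite Cmod_mult, Cmod_R, Rabs_pos_eq in P' by lra.
    eapply Rle_trans; [exact P'|]. apply Rmult_le_compat_l; auto.
    assert (U : (q z1 * Cconj (q z1) = 1)%C).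
    { rewrite <- Cmod2_conj, E. f_equal. ring. }
    rewrite Cmult_conj. replace (Cconj s) with (RtoC s) by (unfold Cconj, RtoC; simpl; f_equal; ring).
    replace (1 - s * Cconj (q z1) * (s * q z))%C with
      (Cconj (q z1) * (q z1 - q z) + RtoC (1 - s * s) * (Cconj (q z1) * q z))%C.
    2: { rewrite <- U, RtoC_minus, RtoC_mult.
         replace (Cconj (q z1) * (q z1 - q z) + (1 - s * s) * (Cconj (q z1) * q z))%C with
          (q z1 * Cconj (q z1) - s * Cconj (q z1) * (s * q z))%C by ring. reflexivity. }
    eapply Rle_trans; [apply Cmod_triangle|]. rewrite !Cmod_mult, Cmod_conj, E, Cmod_R.
    rewrite (Cmod_minus_sym (q z1)). rewrite Rabs_pos_eq by nra.
    assert (0 <= 1 - s * s <= 2 * (1 - s)) by nra.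
    assert ((1 - s * s) * Cmod (q z) <= (1 - s * s) * 1)
      by (apply Rmult_le_compat_l; [lra|now apply B]).
    lra. }
  apply Cminus_0, NNPP. intros N. apply Cmod_pos in N.
  assert (T := Cmod_minus_le (q z) (q z1)). pose proof (B z Hz). rewrite E in T.
  set (x := Cmod (q z - q z1)) in *. set (e := (1 - rho) * x / 8).
  assert (He : 0 < e <= / 4) by (unfold e; nra).
  specialize (S (1 - e) ltac:(lra)). unfold e in *. nra.
Qed.

(** The case of equality in the Schwarz-Pick lemma: the Schwarz quotient of
    z -> mob (f 0) (f z) has modulus 1 at z1, so that it is constant. *)
Lemma schwarz_equality (f : C -> C) z1 : holomorphic f -> self_map f -> disc z1 -> z1 <> 0%C ->
  Cmod (mob (f 0) (f z1)) = Cmod z1 ->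
  exists u, Cmod u = 1 /\ forall z, disc z -> f z = mob (- f 0) (u * z).
Proof.
  intros Hf Sf H1 N E. assert (Hb := Sf 0%C disc_0).
  destruct (schwarz_quotient (fun z => mob (f 0) (f z)) 1) as [q (Hq & Eq & B)].
  - apply holo_comp; auto using holo_mob.
  - apply mob_self.
  - intros x Hx. left. apply mob_disc; auto.
  - assert (Q : Cmod (q z1) = 1).
    { rewrite (Eq z1 H1), Cmod_mult in E. apply Cmod_pos in N.
      apply Rmult_eq_reg_l with (Cmod z1); lra. }
    exists (q z1). split; auto. intros z Hz.
    rewrite <- (maximum_modulus_const q z1 Hq B H1 Q z Hz), Cmult_comm, <- Eq by auto.
    now rewrite mob_inv by auto.
Qed.

(** * Logarithms *)

Lemma holomorphic_primitive (q : C -> C) : holomorphic q ->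
  exists F, holomorphic F /\ F 0 = 0%C /\ forall z, disc z -> cderiv F z (q z).
Proof.
  intros Hq. destruct (disc_primitive q 0) as [F [F0 DF]].
  - intros z Hz. now apply holo_cont.
  - intros z Hz _. exact (Hq z Hz).
  - exists F. split; auto. intros z Hz. exists (q z). now apply DF.
Qed.

(** No branch of the logarithm of [u 0] is chosen: the logarithm is normalized
    to vanish at 0, and the value [u 0] stays as a factor. *)
Lemma holomorphic_log (u : C -> C) : holomorphic u -> (forall z, disc z -> u z <> 0%C) ->
  exists F, holomorphic F /\ F 0 = 0%C /\ forall z, disc z -> u z = (u 0 * cexp (F z))%C.
Proof.
  intros Hu N.
  destruct (holomorphic_primitive (fun z => C_derive u z / u z)%C) as [F (HF & F0 & DF)].
  { apply holo_div; auto. now apply holomorphic_derive. }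
  exists F. split; auto. split; auto. intros z Hz.
  assert (E : (u z * cexp (- F z))%C = (u 0 * cexp (- F 0))%C).
  { apply (zero_derivative_const (fun z => u z * cexp (- F z))%C 1); auto.
    intros w Hw. eapply cderiv_eq.
    - apply cderiv_mult; [now apply holo_cderiv|].
      apply (cderiv_comp cexp (fun z => - F z)%C); [apply cderiv_opp; now apply DF|apply cderiv_cexp].
    - cbeta. field. now apply N. }
  rewrite F0 in E. replace (- 0)%C with (RtoC 0) in E by ring. rewrite cexp_0, Cmult_1_r in E.
  rewrite <- E, <- Cmult_assoc, <- cexp_plus. replace (- F z + F z)%C with (RtoC 0) by ring.
  rewrite cexp_0. ring.
Qed.

(** * Harnack's inequality *)

Definition zero_free (u : C -> C) (M : R) : Prop :=
  holomorphic u /\ (forall z, disc z -> u z <> 0%C) /\ forall z, disc z -> Cmod (u z) <= M.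

Lemma zero_free_bound_pos u M : zero_free u M -> 0 < M.
Proof. intros (_ & N & B). eapply Rlt_le_trans; [apply Cmod_pos, (N 0%C disc_0)|apply B, disc_0]. Qed.

(** Write u = u 0 exp F and L = ln (M / |u 0|).  Since |u| <= M, the map L - F has
    nonnegative real part, so that F / (2 L - F) is bounded by 1 and vanishes
    at 0.  Schwarz's lemma for it is |F z| <= |z| |2 L - F z|, from which both
    estimates follow.  The first one says that u is nearly constant near 0 in
    ratio, the second one that |u z| is at most a fixed power of |u 0|. *)
Lemma harnack (u : C -> C) M z : zero_free u M -> disc z ->
  (exists d, u z = (u 0 * cexp d)%C /\
     Cmod d <= 2 * Cmod z / (1 - Cmod z) * ln (M / Cmod (u 0))) /\
  (1 - Cmod z) / (1 + Cmod z) * ln (M / Cmod (u 0)) <= ln (M / Cmod (u z)).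
Proof.
  intros HuM Hz. assert (HM := zero_free_bound_pos u M HuM). destruct HuM as (Hu & N & B).
  assert (Hz' := Hz). unfold disc in Hz'. pose proof (Cmod_ge_0 z) as Z0.
  assert (P : forall w, disc w -> 0 < Cmod (u w)) by (intros; now apply Cmod_pos, N).
  assert (ln_ge_0 : forall w, disc w -> 0 <= ln (M / Cmod (u w))).
  { intros w Hw. rewrite ln_div by auto. pose proof (ln_le _ _ (P w Hw) (B w Hw)). lra. }
  set (L := ln (M / Cmod (u 0))).
  destruct (ln_ge_0 0%C disc_0) as [HL|HL]; fold L in HL.
  (* if |u 0| = M, then u is constant by the maximum principle *)
  2: { assert (E1 : Cmod (u 0) = M).
       { apply ln_inv; auto using disc_0. unfold L in HL. rewrite ln_div in HL by auto using disc_0. lra. }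
       assert (NM : RtoC M <> 0%C) by (apply RtoC_neq_0; lra).
       assert (E : (u z / M)%C = (u 0 / M)%C).
       { assert (Cd : forall w, Cmod (u w / M) = Cmod (u w) / M).
         { intros w. rewrite Cmod_div, Cmod_R, Rabs_pos_eq by (auto; lra). reflexivity. }
         apply (maximum_modulus_const (fun w => u w / M)%C); auto using disc_0.
         - apply holo_div; auto. apply holo_const.
         - intros w Hw. rewrite Cd. apply Rle_div_l; [lra|]. rewrite Rmult_1_l. auto.
         - rewrite Cd, E1. field. lra. }
       assert (Ez : u z = u 0).
       { replace (u z) with (u z / M * M)%C by (field; auto). rewrite E. field. auto. }
       rewrite Ez. fold L. rewrite <- HL. split; [|lra].
       exists 0%C. rewrite cexp_0, Cmod_0. split; [ring|lra]. }
  destruct (holomorphic_log u Hu N) as [F (HF & F0 & EF)].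
  assert (ReF : forall w, disc w -> L - fst (F w) = ln (M / Cmod (u w)) /\ 0 <= L - fst (F w)).
  { intros w Hw. assert (E : L - fst (F w) = ln (M / Cmod (u w))); [|rewrite E; auto].
    unfold L. rewrite (EF w Hw), Cmod_mult, Cmod_cexp, !ln_div, ln_mult, ln_exp
      by auto using exp_pos, disc_0, Rmult_lt_0_compat. ring. }
  assert (Den : forall w, disc w -> (RtoC (2 * L) - F w)%C <> 0%C).
  { intros w Hw E. apply (f_equal fst) in E. unfold Cminus, Cplus, Copp, RtoC in E; simpl in E.
    destruct (ReF w Hw). lra. }
  assert (Q : Cmod (F z) <= Cmod z * Cmod (RtoC (2 * L) - F z)).
  { destruct (schwarz_quotient (fun w => F w / (RtoC (2 * L) - F w))%C 1) as [q (Hq & Eq & Bq)].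
    - apply holo_div; auto. apply holo_minus; auto. apply holo_const.
    - rewrite F0. unfold Cdiv. ring.
    - intros w Hw. rewrite Cmod_div by now apply Den. assert (P' := Cmod_pos _ (Den w Hw)).
      apply Rle_div_l; [exact P'|]. rewrite Rmult_1_l.
      apply Rsqr_incr_0_var; [|lra]. unfold Rsqr. rewrite !Cmod_sqr.
      unfold Cminus, Cplus, Copp, RtoC; simpl. destruct (ReF w Hw). nra.
    - specialize (Eq z Hz). specialize (Bq z Hz). cbv beta in Eq.
      assert (E : F z = (z * q z * (RtoC (2 * L) - F z))%C).
      { rewrite <- Eq. field. now apply Den. }
      rewrite E at 1. rewrite !Cmod_mult. apply Rmult_le_compat_r; [apply Cmod_ge_0|]. nra. }
  split.
  - exists (F z). split; [now apply EF|].
    assert (T := Cmod_minus_le (RtoC (2 * L)) (F z)). rewrite Cmod_R, Rabs_pos_eq in T by lra.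
    apply Rmult_le_reg_r with (1 - Cmod z); [lra|].
    replace (2 * Cmod z / (1 - Cmod z) * L * (1 - Cmod z)) with (Cmod z * (2 * L)) by (field; lra).
    assert (Cmod z * Cmod (RtoC (2 * L) - F z) <= Cmod z * (2 * L + Cmod (F z))) by (apply Rmult_le_compat_l; lra).
    lra.
  - destruct (ReF z Hz) as [E X]. rewrite <- E. set (x := L - fst (F z)) in *.
    assert (I : L - x <= Cmod z * (L + x)).
    { apply Rnot_lt_le. intros Hlt.
      assert (0 <= Cmod z * (L + x)) by (apply Rmult_le_pos; lra).
      assert (Q2 : Cmod (F z) * Cmod (F z) <=
        (Cmod z * Cmod (RtoC (2 * L) - F z)) * (Cmod z * Cmod (RtoC (2 * L) - F z))).
      { apply Rmult_le_compat; auto; apply Cmod_ge_0. }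
      replace ((Cmod z * Cmod (RtoC (2 * L) - F z)) * (Cmod z * Cmod (RtoC (2 * L) - F z))) with
        ((Cmod z * Cmod z) * (Cmod (RtoC (2 * L) - F z) * Cmod (RtoC (2 * L) - F z))) in Q2 by ring.
      rewrite (Cmod_sqr (F z)), (Cmod_sqr (RtoC (2 * L) - F z)) in Q2.
      unfold Cminus, Cplus, Copp, RtoC in Q2; simpl in Q2.
      replace (fst (F z)) with (L - x) in Q2 by (unfold x; ring).
      assert (Cmod z * Cmod z <= 1) by nra.
      assert (0 <= snd (F z) * snd (F z)) by nra.
      assert ((Cmod z * (L + x)) * (Cmod z * (L + x)) < (L - x) * (L - x)) by nra.
      nra. }
    apply Rmult_le_reg_r with (1 + Cmod z); [lra|].
    replace ((1 - Cmod z) / (1 + Cmod z) * L * (1 + Cmod z)) with ((1 - Cmod z) * L) by (field; lra).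
    lra.
Qed.

Lemma ratio_decreasing r s : 0 <= r <= s -> s < 1 -> (1 - s) / (1 + s) <= (1 - r) / (1 + r).
Proof.
  intros H1 H2. apply Rmult_le_reg_r with ((1 + s) * (1 + r)); [nra|].
  replace ((1 - s) / (1 + s) * ((1 + s) * (1 + r))) with ((1 - s) * (1 + r)) by (field; lra).
  replace ((1 - r) / (1 + r) * ((1 + s) * (1 + r))) with ((1 - r) * (1 + s)) by (field; lra). nra.
Qed.

Lemma harnack_power (u : C -> C) M z w r : zero_free u M -> disc z -> disc w ->
  Cmod (mob w z) <= r -> r < 1 ->
  Cmod (u z) <= M * Rpower (Cmod (u w) / M) ((1 - r) / (1 + r)).
Proof.
  intros HuM Hz Hw Hr Hr1. assert (HM := zero_free_bound_pos u M HuM). destruct HuM as (Hu & N & B).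
  assert (Hw' := disc_opp w Hw).
  destruct (harnack (fun x => u (mob (- w) x)) M (mob w z)) as [_ K].
  { split; [|split].
    - apply holo_comp; auto using holo_mob, self_map_mob.
    - intros x Hx. now apply N, mob_disc.
    - intros x Hx. now apply B, mob_disc. }
  { now apply mob_disc. }
  cbv beta in K. rewrite mob_inv, mob_opp_0 in K by auto.
  assert (Pz := Cmod_pos _ (N z Hz)). assert (Pw := Cmod_pos _ (N w Hw)).
  assert (Lw : 0 <= ln (M / Cmod (u w))).
  { rewrite ln_div by auto. pose proof (ln_le _ _ Pw (B w Hw)). lra. }
  assert (K2 := Rmult_le_compat_r _ _ _ Lw (ratio_decreasing _ r (conj (Cmod_ge_0 _) Hr) Hr1)).
  assert (K3 := Rle_trans _ _ _ K2 K). rewrite !ln_div in K3 by auto.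
  rewrite (Rmult_comm M). apply Rle_div_l; [exact HM|].
  rewrite <- (exp_ln (Cmod (u z) / M)) by now apply Rdiv_lt_0_compat.
  apply exp_le_mono. rewrite !ln_div by auto. lra.
Qed.

Lemma harnack_small M r eps : 0 < M -> 0 <= r < 1 -> 0 < eps ->
  exists d, 0 < d /\ forall u z w, zero_free u M -> disc z -> disc w -> Cmod (mob w z) <= r ->
    Cmod (u w) < d -> Cmod (u z) < eps.
Proof.
  intros HM Hr He. set (k := (1 - r) / (1 + r)). assert (Hk : 0 < k) by (apply Rdiv_lt_0_compat; lra).
  exists (M * Rpower (eps / M) (/ k)). split; [apply Rmult_lt_0_compat; [lra|apply exp_pos]|].
  intros u z w HuM Hz Hw Hm Hd.
  eapply Rle_lt_trans; [apply (harnack_power u M z w r); auto; lra|]. fold k.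
  rewrite Rmult_comm. apply Rlt_div_r; [exact HM|].
  rewrite <- (Rpower_1 (eps / M)), <- (Rinv_l k), <- Rpower_mult by (try apply Rdiv_lt_0_compat; lra).
  apply Rlt_Rpower_l; [exact Hk|]. split.
  - apply Rdiv_lt_0_compat; auto. apply Cmod_pos. now apply HuM.
  - apply Rlt_div_l; [exact HM|]. now rewrite Rmult_comm.
Qed.

(** * Ultrafilters *)

(** Every bounded sequence converges along an ultrafilter.  One ultrafilter thus
    gives limits at all points of the disc and for all members of a possibly
    uncountable family of maps at once, where compactness arguments would
    extract subsequences. *)
Definition ultrafilter (U : (nat -> Prop) -> Prop) : Prop :=
  ProperFilter U /\ filter_le U eventually /\ forall P, U P \/ U (fun n => ~ P n).

Lemma ultrafilter_exists : exists U, ultrafilter U.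
Proof.
  assert (PF : filter.ProperFilter (T := nat) eventually).
  { constructor.
    - intros [N HN]. exact (HN N (le_n N)).
    - constructor.
      + now exists O.
      + intros A B [N HN] [M HM]. exists (N + M)%nat. intros n Hn. split; [apply HN|apply HM]; lia.
      + intros A B AB [N HN]. exists N. intros n Hn. exact (AB n (HN n Hn)). }
  destruct (filter.ultraFilterLemma (T := nat) PF) as [U [HU HF]].
  pose proof (filter.ultra_proper (T := nat) (F := U)) as PU.
  assert (FU := @filter.filter_filter nat U PU).
  exists U. split; [|split].
  - constructor.
    + intros P HP. apply Classical_Prop.NNPP. intros N.
      apply (@filter.filter_not_empty nat U PU).
      refine (filter.filterS (T := nat) (F := U) _ HP). intros n Hn. apply N. now exists n.
    + constructor.
      * exact (filter.filterT (T := nat) (F := U)).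
      * intros P Q HP HQ. exact (filter.filterI (T := nat) (F := U) HP HQ).
      * intros P Q PQ HP. exact (filter.filterS (T := nat) (F := U) PQ HP).
  - intros P HP. exact (HF P HP).
  - intros P. exact (filter.in_ultra_setVsetC (T := nat) (F := U) P HU).
Qed.

(** * Limits along a filter *)

Definition ulim (U : (nat -> Prop) -> Prop) (f : nat -> C) (l : C) : Prop :=
  forall eps, 0 < eps -> U (fun n => Cmod (f n - l) < eps).

Section Limits.
Variable U : (nat -> Prop) -> Prop.
Context {PU : ProperFilter U}.
Implicit Types (l m c : C) (f g : nat -> C).

Lemma ulim_filterlim f l :
  ulim U f l <-> filterlim f U (@locally (AbsRing_UniformSpace C_AbsRing) l).
Proof.
  split.
  - intros H P [e He]. change (U (fun n => P (f n))). apply (filter_imp (fun n => Cmod (f n - l) < e)).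
    + intros n Hn. exact (He (f n) Hn).
    + exact (H e (cond_pos e)).
  - intros H eps He. apply (H (fun y => Cmod (y - l) < eps)).
    exists (mkposreal eps He). intros y Hy. exact Hy.
Qed.

Lemma ulim_unique f l m : ulim U f l -> ulim U f m -> l = m.
Proof.
  rewrite !ulim_filterlim.
  exact (filterlim_locally_unique (V := AbsRing_NormedModule C_AbsRing) f l m).
Qed.

Lemma ulim_const c : ulim U (fun _ => c) c.
Proof. intros eps He. apply filter_forall. intros _. now rewrite Cmod_minus_self. Qed.

Lemma ulim_ext_ae f g l : U (fun n => f n = g n) -> ulim U f l -> ulim U g l.
Proof.
  intros E H eps He. refine (filter_imp _ _ _ (filter_and _ _ E (H eps He))). now intros n [-> Hn].
Qed.

Lemma ulim_ext f g l : (forall n, f n = g n) -> ulim U f l -> ulim U g l.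
Proof. intros E. apply ulim_ext_ae. now apply filter_forall. Qed.

Lemma ulim_of_const f l c : (forall n, f n = c) -> ulim U f l -> l = c.
Proof. intros E H. apply (ulim_unique (fun _ => c)); [now apply (ulim_ext f)|apply ulim_const]. Qed.

Lemma ulim_cont (g : C -> C) f l : ccont g l -> ulim U f l -> ulim U (fun n => g (f n)) (g l).
Proof.
  intros Hg Hf eps He. destruct (proj1 (ccont_eps _ _) Hg eps He) as [d [Hd H]].
  refine (filter_imp _ _ _ (Hf d Hd)). intros n Hn. now apply H.
Qed.

Lemma ulim_plus f g l m : ulim U f l -> ulim U g m -> ulim U (fun n => f n + g n)%C (l + m)%C.
Proof.
  rewrite !ulim_filterlim. intros Hf Hg.
  eapply filterlim_comp_2; [exact Hf|exact Hg|].
  exact (filterlim_plus (V := AbsRing_NormedModule C_AbsRing) l m).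
Qed.

Lemma ulim_mult f g l m : ulim U f l -> ulim U g m -> ulim U (fun n => f n * g n)%C (l * m)%C.
Proof.
  rewrite !ulim_filterlim. intros Hf Hg.
  eapply filterlim_comp_2; [exact Hf|exact Hg|].
  exact (filterlim_mult (K := C_AbsRing) l m).
Qed.

Lemma ulim_scal c f l : ulim U f l -> ulim U (fun n => c * f n)%C (c * l)%C.
Proof. apply ulim_mult, ulim_const. Qed.

Lemma ulim_minus f g l m : ulim U f l -> ulim U g m -> ulim U (fun n => f n - g n)%C (l - m)%C.
Proof.
  intros Hf Hg. replace (l - m)%C with (l + (- (1)) * m)%C by ring.
  apply (ulim_ext (fun n => f n + (- (1)) * g n)%C); [intros n; ring|].
  apply ulim_plus; auto. now apply ulim_scal.
Qed.

Lemma ulim_div f g l m : m <> 0%C -> ulim U f l -> ulim U g m -> ulim U (fun n => f n / g n)%C (l / m)%C.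
Proof.
  intros N Hf Hg. apply ulim_mult; auto. apply (ulim_cont (fun z => / z)%C g m); auto.
  eapply cderiv_cont. now apply cderiv_inv_base.
Qed.

Lemma ulim_conj f l : ulim U f l -> ulim U (fun n => Cconj (f n)) (Cconj l).
Proof.
  intros H eps He. refine (filter_imp _ _ _ (H eps He)). intros n Hn.
  now rewrite <- Cminus_conj, Cmod_conj.
Qed.

Lemma ulim_Cmod f l : ulim U f l -> ulim U (fun n => RtoC (Cmod (f n))) (RtoC (Cmod l)).
Proof.
  intros H eps He. refine (filter_imp _ _ _ (H eps He)). intros n Hn.
  rewrite <- RtoC_minus, Cmod_R. apply Rabs_lt_between.
  assert (A1 := Cmod_minus_ge (f n) l). assert (A2 := Cmod_minus_ge l (f n)).
  rewrite Cmod_minus_sym in A2. lra.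
Qed.

Lemma ulim_Cmod_le f l M : ulim U f l -> U (fun n => Cmod (f n) <= M) -> Cmod l <= M.
Proof.
  intros H HM. apply Rnot_lt_le. intros Hlt.
  apply (filter_const (F := U)). refine (filter_imp _ _ _ (filter_and _ _ HM (H (Cmod l - M) _))); [|lra].
  intros n [H1 H2]. rewrite Cmod_minus_sym in H2. assert (A1 := Cmod_minus_ge l (f n)). lra.
Qed.

Lemma ulim_0_le f (r : nat -> R) : U (fun n => Cmod (f n) <= r n) -> ulim U (fun n => RtoC (r n)) 0 ->
  ulim U f 0.
Proof.
  intros Hr H eps He. refine (filter_imp _ _ _ (filter_and _ _ Hr (H eps He))). intros n [H1 H2].
  replace (f n - 0)%C with (f n) by ring. replace (r n - 0)%C with (RtoC (r n)) in H2 by ring.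
  rewrite Cmod_R in H2. pose proof (Rle_abs (r n)). lra.
Qed.

Lemma ulim_mob a z b w : disc b -> disc w -> ulim U a b -> ulim U z w ->
  ulim U (fun n => mob (a n) (z n)) (mob b w).
Proof.
  intros Hb Hw Ha Hz. apply ulim_div.
  - now apply mob_den.
  - now apply ulim_minus.
  - apply ulim_minus; [apply ulim_const|]. apply ulim_mult; auto. now apply ulim_conj.
Qed.

Hypothesis U_ultra : forall P, U P \/ U (fun n => ~ P n).

Lemma real_ulim_exists (x : nat -> R) M : U (fun n => Rabs (x n) <= M) ->
  exists l : R, forall eps, 0 < eps -> U (fun n => Rabs (x n - l) < eps).
Proof.
  intros HM.
  destruct (completeness (fun y => U (fun n => y <= x n))) as [l [Hl1 Hl2]].
  - exists M. intros y Hy. apply (filter_const (F := U)).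
    refine (filter_imp _ _ _ (filter_and _ _ HM Hy)). intros n [H1 H2]. pose proof (Rle_abs (x n)). lra.
  - exists (- M). refine (filter_imp _ _ _ HM). intros n Hn. apply Rabs_le_between in Hn. lra.
  - exists l. intros eps He.
    assert (A1 : U (fun n => l - eps < x n)).
    { apply NNPP. intros N. assert (l <= l - eps); [|lra].
      apply Hl2. intros y Hy. apply Rnot_lt_le. intros Hlt. apply N.
      refine (filter_imp _ _ _ Hy). intros n Hn. lra. }
    assert (A2 : U (fun n => x n < l + eps)).
    { destruct (U_ultra (fun n => l + eps / 2 <= x n)) as [H|H].
      - specialize (Hl1 _ H). lra.
      - refine (filter_imp _ _ _ H). intros n Hn. lra. }
    refine (filter_imp _ _ _ (filter_and _ _ A1 A2)). intros n [H1 H2]. apply Rabs_lt_between. lra.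
Qed.

Lemma ulim_exists (f : nat -> C) M : U (fun n => Cmod (f n) <= M) -> exists l, ulim U f l.
Proof.
  intros HM.
  destruct (real_ulim_exists (fun n => fst (f n)) M) as [x Hx].
  { refine (filter_imp _ _ _ HM). intros n Hn. eapply Rle_trans; [apply components_le_Cmod|exact Hn]. }
  destruct (real_ulim_exists (fun n => snd (f n)) M) as [y Hy].
  { refine (filter_imp _ _ _ HM). intros n Hn. eapply Rle_trans; [apply components_le_Cmod|exact Hn]. }
  exists (x, y). intros eps He.
  refine (filter_imp _ _ _ (filter_and _ _ (Hx (eps / 2) _) (Hy (eps / 2) _))); try lra.
  intros n [H1 H2].
  replace (f n - (x, y))%C with ((fst (f n) - x, snd (f n) - y) : C) by (now destruct (f n)).
  eapply Rle_lt_trans; [apply Cmod_pair_le|]. lra.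
Qed.

Lemma ulim_fun_exists (F : nat -> C -> C) :
  (forall z, disc z -> exists M, U (fun n => Cmod (F n z) <= M)) ->
  exists H : C -> C, forall z, disc z -> ulim U (fun n => F n z) (H z).
Proof.
  intros HM. exists (fun z => epsilon (inhabits (RtoC 0)) (ulim U (fun n => F n z))).
  intros z Hz. apply epsilon_spec. destruct (HM z Hz) as [M HMz]. now apply (ulim_exists _ M).
Qed.

End Limits.

(** * Limits of holomorphic and of univalent maps *)

Lemma second_order (f : C -> C) M w : holomorphic f -> (forall z, disc z -> Cmod (f z) <= M) ->
  disc w -> exists c, Cmod c <= 2 * M /\ forall z, disc z ->
    Cmod (f z - f w - mob w z * c) <= 4 * M * (Cmod (mob w z) * Cmod (mob w z)).
Proof.
  intros Hf HM Hw.
  destruct (bounded_increment f M Hf HM w Hw) as [q (Hq & Bq & Eq)].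
  destruct (bounded_increment q (2 * M) Hq Bq 0 disc_0) as [p (Hp & Bp & Ep)].
  exists (q 0). split; [apply Bq, disc_0|]. intros z Hz.
  assert (Hm := mob_disc w z Hw Hz). specialize (Ep _ Hm). specialize (Bp _ Hm). rewrite mob_0 in Ep.
  rewrite (Eq z Hz), Ep. set (m := mob w z) in *.
  replace (f w + m * (q 0 + m * p m) - f w - m * q 0)%C with (p m * (m * m))%C by ring.
  rewrite !Cmod_mult. apply Rmult_le_compat_r; [|lra].
  apply Rmult_le_pos; apply Cmod_ge_0.
Qed.

Section FunctionLimits.
Variable U : (nat -> Prop) -> Prop.
Context {PU : ProperFilter U}.

(** The Taylor remainders of order two are bounded uniformly, so that the
    bound passes to the pointwise limit. *)
Lemma ulim_holomorphic (U_ultra : forall P, U P \/ U (fun n => ~ P n))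
  (F : nat -> C -> C) (H : C -> C) M :
  U (fun n => holomorphic (F n) /\ forall z, disc z -> Cmod (F n z) <= M) ->
  (forall z, disc z -> ulim U (fun n => F n z) (H z)) -> holomorphic H.
Proof.
  intros HF HH w Hw.
  assert (Ch : forall n, exists c, (holomorphic (F n) /\ forall z, disc z -> Cmod (F n z) <= M) ->
     Cmod c <= 2 * M /\ forall z, disc z ->
    Cmod (F n z - F n w - mob w z * c) <= 4 * M * (Cmod (mob w z) * Cmod (mob w z))).
  { intros n. destruct (classic (holomorphic (F n) /\ forall z, disc z -> Cmod (F n z) <= M)) as [[H1 H2]|N].
    - destruct (second_order (F n) M w H1 H2 Hw) as [c Hc]. now exists c.
    - exists 0%C. now intros. }
  apply (boolp.choice (P := fun n c => _)) in Ch. destruct Ch as [c Hc].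
  destruct (ulim_exists U U_ultra c (2 * M)) as [l Hl].
  { refine (filter_imp _ _ _ HF). intros n Hn. now apply Hc. }
  assert (B : forall z, disc z ->
    Cmod (H z - H w - mob w z * l) <= 4 * M * (Cmod (mob w z) * Cmod (mob w z))).
  { intros z Hz. apply (ulim_Cmod_le U (fun n => F n z - F n w - mob w z * c n)%C).
    - apply ulim_minus; auto. + apply ulim_minus; auto. + now apply ulim_scal.
    - refine (filter_imp _ _ _ HF). intros n Hn. now apply Hc. }
  set (G := fun m => H (mob (- w) m)).
  assert (DG : cderiv G (mob w w) l).
  { rewrite mob_self. apply cderiv_eps. intros eps He. pose proof (Rabs_pos M).
    exists (Rmin 1 (eps / (1 + 4 * Rabs M))). split.
    { apply Rmin_pos; [lra|]. apply Rdiv_lt_0_compat; lra. }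
    intros m Hm. replace (m - 0)%C with m in * by ring.
    destruct (Rmin_Rgt_l _ _ _ Hm) as [W1 W2].
    assert (B' := B (mob (- w) m) (mob_disc _ _ (disc_opp _ Hw) W1)).
    rewrite mob_inv' in B' by auto. unfold G. rewrite mob_opp_0.
    eapply Rle_trans; [exact B'|]. rewrite <- Rmult_assoc.
    apply Rmult_le_compat_r; [apply Cmod_ge_0|].
    apply (Rmult_lt_compat_r (1 + 4 * Rabs M)) in W2; [|lra].
    replace (eps / (1 + 4 * Rabs M) * (1 + 4 * Rabs M)) with eps in W2 by (field; lra).
    pose proof (Rle_abs M). pose proof (Cmod_ge_0 m).
    assert (M * Cmod m <= Rabs M * Cmod m) by (apply Rmult_le_compat_r; auto). nra. }
  eexists. apply (cderiv_ext_loc (fun z => G (mob w z)) H w _ (1 - Cmod w)).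
  - unfold disc in Hw. lra.
  - intros z Hz. apply Cmod_near in Hz. unfold G. rewrite mob_inv; auto. unfold disc; lra.
  - apply cderiv_comp; [now apply mob_cderiv|exact DG].
Qed.

(** Hurwitz's theorem for bounded sequences, with a limit that is zero
    everywhere as soon as it is zero somewhere: |u_n z| is at most a fixed power of
    |u_n w|. *)
Lemma hurwitz (u : nat -> C -> C) M w : disc w -> U (fun n => zero_free (u n) M) ->
  ulim U (fun n => u n w) 0 -> forall z, disc z -> ulim U (fun n => u n z) 0.
Proof.
  intros Hw Hu H0 z Hz eps He.
  assert (HM : 0 < M).
  { apply (filter_const (F := U)). refine (filter_imp _ _ _ Hu). intros n. apply zero_free_bound_pos. }
  destruct (harnack_small M (Cmod (mob w z)) eps HM) as [d [Hd H]]; auto.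
  { split; [apply Cmod_ge_0|now apply mob_disc]. }
  refine (filter_imp _ _ _ (filter_and _ _ Hu (H0 d Hd))). intros n [Hn Hnd].
  replace (u n w - 0)%C with (u n w) in Hnd by ring. replace (u n z - 0)%C with (u n z) by ring.
  apply (H (u n) z w); auto. lra.
Qed.

End FunctionLimits.

Lemma eventually_inv_lt d : 0 < d -> eventually (fun n => 0 < / (INR n + 1) < d).
Proof.
  intros Hd. destruct (archimed_cor1 d Hd) as [N [HN HN']].
  exists N. intros n Hn. apply le_INR in Hn.
  assert (0 < INR N) by (apply lt_0_INR; lia).
  split; [apply Rinv_0_lt_compat; lra|].
  eapply Rlt_trans; [|exact HN]. apply Rinv_lt_contravar; nra.
Qed.

Lemma regular_point_quotient (f : C -> C) M w : univalent f ->
  (forall z, disc z -> Cmod (f z) <= M) -> disc w -> C_derive f w <> 0%C ->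
  exists q, zero_free q (2 * M) /\
    forall z, disc z -> f z = (f w + mob w z * q (mob w z))%C.
Proof.
  intros [Hf If] HM Hw Nw. assert (Hw' := disc_opp w Hw).
  destruct (bounded_increment f M Hf HM w Hw) as [q (Hq & Bq & Eq)].
  exists q. split; auto. split; auto. split; auto.
  intros m Hm E. destruct (Ceq_dec m 0) as [->|N].
  - apply Nw. rewrite (increment_derivative f q w Hq Hw Eq), E. unfold Cdiv. ring.
  - apply N. rewrite <- (mob_inv' w m), <- (mob_self w) by auto. f_equal.
    assert (Dx := mob_disc _ _ Hw' Hm). apply If; auto. rewrite (Eq _ Dx), mob_inv', E by auto. ring.
Qed.

(** If the derivative vanished at w, it would not vanish at points v arbitrarily
    close to w, since f is not locally constant.  The quotients q_v of f at such v
    have no zeros, and q_v 0 tends to 0.  So the q_v tend to 0 everywhere,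
    and f takes the value f w at a second point. *)
Lemma univalent_derivative_neq_0 (f : C -> C) M w : univalent f ->
  (forall z, disc z -> Cmod (f z) <= M) -> disc w -> C_derive f w <> 0%C.
Proof.
  intros Uf HM Hw E0. destruct (Uf) as [Hf If]. assert (Hw1 := Hw). unfold disc in Hw1.
  assert (HM0 : 0 <= M) by (eapply Rle_trans; [apply Cmod_ge_0|apply (HM 0%C), disc_0]).
  assert (Ex : forall n : nat, exists v q, Cmod (v - w) < / (INR n + 1) /\ disc v /\
     zero_free q (2 * M) /\ forall z, disc z -> f z = (f v + mob v z * q (mob v z))%C).
  { intros n. pose proof (pos_INR n).
    assert (P : 0 < / (INR n + 1)) by (apply Rinv_0_lt_compat; lra).
    set (d := Rmin (/ (INR n + 1)) (1 - Cmod w)).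
    assert (Hd : 0 < d) by (apply Rmin_pos; lra).
    assert (near : forall v, Cmod (v - w) < d -> Cmod (v - w) < / (INR n + 1) /\ disc v).
    { intros v Hv. destruct (Rmin_Rgt_l _ _ _ Hv) as [H1 H2]. split; auto.
      apply Cmod_near in H2. unfold disc. lra. }
    destruct (classic (exists v, Cmod (v - w) < d /\ C_derive f v <> 0%C)) as [[v [Hv Nv]]|N].
    - destruct (near v Hv) as [Hv1 Dv].
      destruct (regular_point_quotient f M v Uf HM Dv Nv) as [q Hq]. now exists v, q.
    - exfalso. set (x := (w + RtoC (d / 2))%C).
      assert (Ex : (x - w)%C = RtoC (d / 2)) by (unfold x; ring).
      assert (E : f x = f w).
      { apply Cminus_0, Cmod_small. intros eps He.
        apply Rle_trans with (0 * Cmod (x - w)); [|lra].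
        apply (mean_value_inequality f (C_derive f)). intros t Ht. rewrite Ex.
        assert (Hv : Cmod (w + RtoC t * RtoC (d / 2) - w) < d).
        { replace (w + RtoC t * RtoC (d / 2) - w)%C with (RtoC t * RtoC (d / 2))%C by ring.
          rewrite Cmod_mult, !Cmod_R, !Rabs_pos_eq by lra. nra. }
        destruct (near _ Hv) as [_ Dv]. split; [now apply holo_cderiv|].
        split; [apply holo_cont; auto; now apply holomorphic_derive|].
        replace (C_derive f (w + RtoC t * RtoC (d / 2))) with (RtoC 0); [rewrite Cmod_0; lra|].
        apply NNPP. intros Nv. apply N. eexists. split; [exact Hv|]. auto. }
      apply If in E; auto.
      + rewrite E in Ex. symmetry in Ex. revert Ex. replace (w - w)%C with (RtoC 0) by ring.
        intros Ex. apply RtoC_inj in Ex. lra.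
      + apply near. rewrite Ex, Cmod_R, Rabs_pos_eq; lra. }
  apply (boolp.choice (P := fun n v => exists q, _)) in Ex. destruct Ex as [v Ex].
  apply (boolp.choice (P := fun n q => _)) in Ex. destruct Ex as [q Hq].
  assert (Lv : ulim eventually v w).
  { intros eps He. refine (filter_imp _ _ _ (eventually_inv_lt eps He)). intros n Hn.
    destruct (Hq n) as [H _]. lra. }
  assert (L0 : ulim eventually (fun n => q n 0) 0).
  { apply (ulim_ext eventually (fun n => C_derive f (v n) * (1 - Cconj (v n) * v n))%C).
    - intros n. destruct (Hq n) as (_ & Dv & [HQ _] & EQ).
      rewrite (increment_derivative f (q n) (v n) HQ Dv EQ). field. now apply mob_den.
    - replace (RtoC 0) with (C_derive f w * (1 - Cconj w * w))%C by (rewrite E0; ring).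
      apply (ulim_mult eventually).
      + apply (ulim_cont eventually); auto. apply holo_cont; auto. now apply holomorphic_derive.
      + apply (ulim_minus eventually); [apply (ulim_const eventually)|].
        apply (ulim_mult eventually); auto. now apply (ulim_conj eventually). }
  assert (Dm : disc (RtoC (/ 2))) by (unfold disc; rewrite Cmod_R, Rabs_pos_eq; lra).
  assert (Lm : ulim eventually (fun n => q n (RtoC (/ 2))) 0).
  { apply (hurwitz eventually q (2 * M) 0); auto using disc_0.
    apply filter_forall. intros n. apply Hq. }
  assert (Dx := mob_disc _ _ (disc_opp _ Hw) Dm).
  assert (E : f (mob (- w) (RtoC (/ 2))) = f w).
  { apply (ulim_unique eventually (fun n => f (mob (- v n) (RtoC (/ 2))))).
    - apply (ulim_cont eventually); [apply holo_cont; auto|].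
      apply (ulim_mob eventually); auto using disc_opp; [|now apply (ulim_const eventually)].
      apply (ulim_cont eventually (fun z => - z)%C); auto.
      eapply cderiv_cont, cderiv_opp, cderiv_id.
    - apply (ulim_ext eventually (fun n => f (v n) + RtoC (/ 2) * q n (RtoC (/ 2)))%C).
      + intros n. destruct (Hq n) as (_ & Dv & _ & EQ).
        rewrite (EQ (mob (- v n) (RtoC (/ 2)))), mob_inv'; auto using mob_disc, disc_opp.
      + replace (f w) with (f w + RtoC (/ 2) * 0)%C by ring.
        apply (ulim_plus eventually); auto; [|now apply (ulim_scal eventually)]. apply (ulim_cont eventually); auto. now apply holo_cont. }
  apply If in E; auto. apply (f_equal (mob w)) in E. rewrite mob_inv', mob_self in E by auto.
  apply RtoC_inj in E. lra.
Qed.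

Lemma univalent_quotient (f : C -> C) M w : univalent f ->
  (forall z, disc z -> Cmod (f z) <= M) -> disc w ->
  exists q, zero_free q (2 * M) /\
    forall z, disc z -> f z = (f w + mob w z * q (mob w z))%C.
Proof.
  intros Uf HM Hw. apply regular_point_quotient; auto. now apply (univalent_derivative_neq_0 f M).
Qed.

(** If H z = H w, then the difference quotients at w, which have no zeros, tend
    to zero at one point, hence everywhere, and H is constant. *)
Lemma ulim_univalent U {PU : ProperFilter U} (U_ultra : forall P, U P \/ U (fun n => ~ P n))
  (F : nat -> C -> C) (H : C -> C) M :
  U (fun n => univalent (F n) /\ forall z, disc z -> Cmod (F n z) <= M) ->
  (forall z, disc z -> ulim U (fun n => F n z) (H z)) ->
  (exists a b, disc a /\ disc b /\ H a <> H b) -> univalent H.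
Proof.
  intros HF HH [a [b (Ha & Hb & Nab)]].
  assert (HM : 0 <= M).
  { apply (filter_const (F := U)). refine (filter_imp _ _ _ HF). intros n [_ Bn].
    eapply Rle_trans; [apply Cmod_ge_0|apply (Bn 0), disc_0]. }
  split.
  { apply (ulim_holomorphic U U_ultra F H M); auto.
    refine (filter_imp _ _ _ HF). intros n [[Hn _] Bn]. now split. }
  intros z w Hz Hw E. apply NNPP. intros N. apply Nab.
  assert (Ch : forall n, exists q, (univalent (F n) /\ forall z, disc z -> Cmod (F n z) <= M) ->
     zero_free q (2 * M) /\
    forall z, disc z -> F n z = (F n w + mob w z * q (mob w z))%C).
  { intros n. destruct (classic (univalent (F n) /\ forall z, disc z -> Cmod (F n z) <= M)) as [[H1 H2]|Nn].
    - destruct (univalent_quotient (F n) M w H1 H2 Hw) as [q Hq]. now exists q.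
    - exists (fun _ => RtoC 0). now intros. }
  apply (boolp.choice (P := fun n q => _)) in Ch. destruct Ch as [q Hq].
  assert (Nm : mob w z <> 0%C).
  { intros Em. apply N. rewrite <- (mob_self w) in Em. now apply mob_inj in Em. }
  assert (Lz : ulim U (fun n => q n (mob w z)) 0).
  { apply (ulim_ext_ae U (fun n => (F n z - F n w) / mob w z)%C).
    - refine (filter_imp _ _ _ HF). intros n Hn. destruct (Hq n Hn) as [_ En]. rewrite (En z Hz). field. auto.
    - replace (RtoC 0) with ((H z - H w) / mob w z)%C by (rewrite E; field; auto).
      apply ulim_div; auto; [|now apply ulim_const]. apply ulim_minus; auto. }
  assert (L : forall x, disc x -> H x = H w).
  { intros x Hx. apply Cminus_0. apply (ulim_unique U (fun n => F n x - F n w)%C).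
    - apply ulim_minus; auto.
    - apply (ulim_ext_ae U (fun n => q n (mob w x) * mob w x)%C).
      + refine (filter_imp _ _ _ HF). intros n Hn. destruct (Hq n Hn) as [_ En]. rewrite (En x Hx). ring.
      + replace (RtoC 0) with (0 * mob w x)%C by ring. apply ulim_mult; auto; [|now apply ulim_const].
        apply (hurwitz U q (2 * M) (mob w z)); auto using mob_disc.
        refine (filter_imp _ _ _ HF). intros n Hn. now apply Hq. }
  now rewrite (L a Ha), (L b Hb).
Qed.

(** * Renormalized self-maps *)

(** The modulus of [renorm g z] is the pseudo-hyperbolic distance between [g 0]
    and [g z]. *)
Definition renorm (g : C -> C) (z : C) : C := mob (g 0) (g z).
Definition conj_at (p : C) (chi : C -> C) (z : C) : C := mob p (chi (mob (- p) z)).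

Lemma univalent_self_map_comp f g : univalent_self_map f -> univalent_self_map g ->
  univalent_self_map (fun z => f (g z)).
Proof.
  intros [[Hf If] Sf] [[Hg Ig] Sg]. split; [split|].
  - now apply holo_comp.
  - intros z w Hz Hw E. apply Ig; auto.
  - intros z Hz. auto.
Qed.

Lemma univalent_self_map_mob a : disc a -> univalent_self_map (mob a).
Proof.
  intros Ha. split; [split|]; auto using holo_mob, self_map_mob.
  intros z w Hz Hw E. now apply (mob_inj a).
Qed.

Lemma renorm_univalent g : univalent_self_map g -> univalent_self_map (renorm g).
Proof.
  intros Hg. apply (univalent_self_map_comp (mob (g 0)) g); auto.
  apply univalent_self_map_mob. apply Hg, disc_0.
Qed.

Lemma renorm_0 g : renorm g 0 = 0%C.
Proof. apply mob_self. Qed.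

Lemma conj_at_univalent p chi : disc p -> univalent_self_map chi -> univalent_self_map (conj_at p chi).
Proof.
  intros Hp Hc. apply (univalent_self_map_comp (mob p) (fun z => chi (mob (- p) z))).
  - now apply univalent_self_map_mob.
  - apply (univalent_self_map_comp chi (mob (- p))); auto.
    now apply univalent_self_map_mob, disc_opp.
Qed.

Lemma conj_at_renorm g chi z : univalent_self_map g -> commute g chi -> disc z ->
  conj_at (g 0) chi (renorm g z) = renorm g (chi z).
Proof.
  intros [_ Sg] Hc Hz. unfold conj_at, renorm. rewrite mob_inv by (auto; apply Sg, disc_0).
  now rewrite <- (Hc z Hz).
Qed.

Lemma conj_at_non_elliptic p chi : disc p -> self_map chi -> non_elliptic chi ->
  non_elliptic (conj_at p chi).
Proof.
  intros Hp Sc Hc [z [Hz E]]. apply Hc. assert (Hz' := mob_disc _ _ (disc_opp p Hp) Hz).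
  exists (mob (- p) z). split; auto.
  rewrite <- E at 2. unfold conj_at. now rewrite mob_inv by auto.
Qed.

Lemma schwarz f z : holomorphic f -> self_map f -> f 0 = 0%C -> disc z -> Cmod (f z) <= Cmod z.
Proof.
  intros Hf Sf E Hz. assert (P := schwarz_pick f z 0 Hf Sf Hz disc_0). now rewrite E, !mob_0 in P.
Qed.

Lemma two_fixed_points psi z0 z1 : holomorphic psi -> self_map psi -> disc z0 -> disc z1 -> z0 <> z1 ->
  psi z0 = z0 -> psi z1 = z1 -> eq_on_disc psi (fun z => z).
Proof.
  intros Hp Sp H0 H1 N E0 E1. assert (H0' := disc_opp z0 H0).
  set (F := conj_at z0 psi).
  assert (F0 : F 0 = 0%C). { unfold F, conj_at. rewrite mob_opp_0, E0. apply mob_self. }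
  set (b := mob z0 z1). assert (Hb : disc b) by now apply mob_disc.
  assert (Fb : F b = b). { unfold F, conj_at, b. now rewrite mob_inv, E1. }
  assert (Nb : b <> 0%C).
  { intros E. apply N. symmetry. apply (mob_inj z0); auto. unfold b in E. now rewrite E, mob_self. }
  destruct (schwarz_equality F b) as [u [Hu Eu]]; auto.
  - apply (holo_comp (mob z0) (fun z => psi (mob (- z0) z))); [now apply holo_mob| |].
    + apply holo_comp; auto using holo_mob, self_map_mob.
    + intros z Hz. now apply Sp, mob_disc.
  - intros z Hz. apply mob_disc; auto. now apply Sp, mob_disc.
  - rewrite F0, mob_0. now rewrite Fb.
  - rewrite F0 in Eu. replace (- 0)%C with (RtoC 0) in Eu by ring.
    assert (U1 : u = 1%C).
    { assert (Q := Eu b Hb). rewrite mob_0, Fb in Q.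
      replace u with (u * b / b)%C by (field; auto). rewrite <- Q. field; auto. }
    intros z Hz. assert (Q := Eu (mob z0 z) (mob_disc _ _ H0 Hz)).
    rewrite mob_0, U1, Cmult_1_l in Q. unfold F, conj_at in Q. rewrite mob_inv in Q by auto.
    apply mob_inj in Q; auto.
Qed.

Lemma commuting_fixed_point phi psi : self_map phi -> non_elliptic phi ->
  holomorphic psi -> self_map psi -> commute phi psi ->
  non_elliptic psi \/ eq_on_disc psi (fun z => z).
Proof.
  intros Sphi Nphi Hp Sp Hc. destruct (classic (non_elliptic psi)) as [H|H]; [now left|right].
  apply NNPP in H. destruct H as [z0 [H0 E0]].
  apply (two_fixed_points psi z0 (phi z0)); auto.
  - intros E. apply Nphi. now exists z0.
  - assert (Q := Hc z0 H0). cbv beta in Q. now rewrite E0 in Q.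
Qed.

(** * Displacement near a recentred orbit *)

Lemma exp_decay k b d : 0 < k -> 0 < d ->
  exists L0, 1 <= L0 /\ forall L, L0 <= L -> 8 * exp (- (k * (L - b))) * L <= d.
Proof.
  intros Hk Hd. pose proof (Rabs_pos b) as Hb. pose proof (Rle_abs b) as Hb'.
  assert (Hik : 0 < / k) by now apply Rinv_0_lt_compat.
  set (c := 8 * (Rabs b + / k)). assert (Hc : 0 < c) by (unfold c; lra).
  destruct (proj2 (is_lim_spec _ _ _) is_lim_mul_exp_m (mkposreal _ (Rdiv_lt_0_compat _ _ Hd Hc))) as [N HN].
  pose proof (Rabs_pos N). pose proof (Rle_abs (- N)) as HN'. rewrite Rabs_Ropp in HN'.
  assert (0 < (2 + Rabs N) / k) by (apply Rdiv_lt_0_compat; lra).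
  exists (1 + Rabs b + (2 + Rabs N) / k). split; [lra|]. intros L HL.
  set (y := - (k * (L - b))). set (E := - (y * exp y)).
  assert (Hy : y <= - (2 + Rabs N)).
  { assert ((2 + Rabs N) / k <= L - b) as HD by lra. apply Rle_div_l in HD; [|lra]. unfold y. lra. }
  specialize (HN y ltac:(lra)). simpl in HN. rewrite Rminus_0_r in HN.
  pose proof (exp_pos y). assert (HE : exp y <= E) by (unfold E; nra).
  rewrite <- Rabs_Ropp in HN. fold E in HN. rewrite Rabs_pos_eq in HN by lra.
  apply Rlt_div_r in HN; [|exact Hc].
  assert (b * exp y <= Rabs b * E) by nra.
  replace (8 * exp y * L) with (8 * (b * exp y + / k * E)) by (unfold E, y; field; lra).
  unfold c in HN. lra.
Qed.

Lemma cexp_near_1 eta : 0 < eta -> exists d, 0 < d /\ forall w, Cmod w <= d -> Cmod (cexp w - 1) <= eta.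
Proof.
  intros He. assert (H := cderiv_cont _ _ _ (cderiv_cexp (RtoC 0))).
  destruct (proj1 (ccont_eps cexp 0%C) H eta He) as [d [Hd Hw]].
  exists (d / 2). split; [lra|]. intros w W. rewrite cexp_0 in Hw. left. apply Hw.
  replace (w - 0)%C with w by ring. lra.
Qed.

Lemma zero_free_displacement X : holomorphic X -> self_map X -> non_elliptic X ->
  zero_free (fun v => X v - v)%C 2.
Proof.
  intros HX SX NX. split; [|split].
  - apply holo_minus; auto using holo_id.
  - intros v Hv. apply Cminus_eq_contra. intros E. apply NX. now exists v.
  - intros v Hv. eapply Rle_trans; [apply Cmod_minus_le|].
    specialize (SX v Hv). unfold disc in SX, Hv. lra.
Qed.

(** The displacement X v - v has no zeros and modulus at most 2, so that, by
    Harnack's inequality, between 0 and a point v near 0 it changes by a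
    factor exp d with |d| at most a constant times |v| L, where L is about the
    logarithm of 1 / |X 0|.  Here X 0 = f x, and v = f z is itself at most a fixed power
    of f x, because f z / z has no zeros.  So |v| L tends to 0 with f x. *)
Lemma displacement (x : C) r eta : disc x -> x <> 0%C -> 0 <= r < 1 -> 0 < eta ->
  exists d, 0 < d /\ forall f X, univalent_self_map f -> f 0 = 0%C ->
    holomorphic X -> self_map X -> non_elliptic X -> X 0 = f x -> Cmod (f x) < d ->
    forall z, disc z -> Cmod (mob x z) <= r ->
      Cmod (X (f z) - f z - f x) <= eta * Cmod (f x).
Proof.
  intros Hx Nx Hr He.
  destruct (cexp_near_1 eta He) as [d1 [Hd1 Hexp]].
  set (k := (1 - r) / (1 + r)). assert (Hk : 0 < k) by (apply Rdiv_lt_0_compat; lra).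
  set (b := - ln (Cmod x)).
  destruct (exp_decay k b (Rmin 1 d1) Hk) as [L0 [HL0 HL]]; [apply Rmin_pos; lra|].
  exists (2 * exp (- L0)). split; [pose proof (exp_pos (- L0)); lra|].
  intros f X Hf f0 HX SX NX X0 Hfx z Hz Hmz.
  assert (Px := Cmod_pos x Nx).
  assert (Nfx : f x <> 0%C).
  { intros E. apply Nx. apply (proj1 Hf); auto using disc_0. now rewrite E, f0. }
  assert (Pfx := Cmod_pos _ Nfx).
  set (L := ln (2 / Cmod (f x))).
  assert (HLL : L0 <= L).
  { unfold L. rewrite ln_div by lra. apply ln_increasing in Hfx; auto.
    rewrite ln_mult, ln_exp in Hfx by (auto using exp_pos; lra). lra. }
  specialize (HL L HLL).
  (* |f z| is at most a fixed power of |f x| *)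
  destruct (univalent_quotient f 1 0 (proj1 Hf)) as [q [Zq Eq]]; auto using disc_0.
  { intros v Hv. left. now apply (proj2 Hf). }
  rewrite Rmult_1_r in Zq.
  assert (Eq' : forall v, disc v -> f v = (v * q v)%C).
  { intros v Hv. rewrite (Eq v Hv), f0, mob_0. ring. }
  set (t := exp (- (k * (L - b)))) in *. assert (Ht : 0 < t) by apply exp_pos.
  assert (Hqz : Cmod (q z) <= 2 * t).
  { assert (K := harnack_power q 2 z x r Zq Hz Hx Hmz (proj2 Hr)). unfold Rpower in K. fold k in K.
    replace (k * ln (Cmod (q x) / 2)) with (- (k * (L - b))) in K; [exact K|].
    assert (Pq : 0 < Cmod (q x)) by now apply Cmod_pos, Zq.
    unfold L, b. rewrite (Eq' x Hx), Cmod_mult, !ln_div, ln_mult by (auto using Rmult_lt_0_compat; lra). ring. }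
  assert (Hfz : Cmod (f z) <= 2 * t).
  { rewrite (Eq' z Hz), Cmod_mult. unfold disc in Hz. pose proof (Cmod_ge_0 z). pose proof (Cmod_ge_0 (q z)). nra. }
  assert (M1 := Rmin_l 1 d1). assert (M2 := Rmin_r 1 d1).
  assert (Hsmall : Cmod (f z) <= / 2) by nra.
  destruct (harnack (fun v => X v - v)%C 2 (f z)) as [[d [Ed Bd]] _].
  - now apply zero_free_displacement.
  - now apply (proj2 Hf).
  - cbv beta in Ed, Bd. replace (X 0 - 0)%C with (f x) in Ed, Bd by (rewrite X0; ring).
    fold L in Bd. rewrite Ed. replace (f x * cexp d - f x)%C with (f x * (cexp d - 1))%C by ring.
    rewrite Cmod_mult, Rmult_comm. apply Rmult_le_compat_r; [lra|]. apply Hexp.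
    eapply Rle_trans; [exact Bd|]. apply Rle_trans with (8 * t * L); [|lra].
    apply Rmult_le_compat_r; [lra|]. apply Rle_div_l; [lra|].
    assert (8 * t * / 2 <= 8 * t * (1 - Cmod (f z))) by (apply Rmult_le_compat_l; lra). lra.
Qed.

(** * A Bloch-type estimate *)

(** Since k z = z q z with q 0 = 1 and |q z - 1| <= 8 |z|, on the circle
    |z| = 1/16 the map stays at distance at least 1/32 from 0; if
    it omitted a value v with |v| < 1/64, then 1 / (k - v) would be larger at
    the centre than on the circle. *)
Lemma omitted_value_bound (k : C -> C) v : holomorphic k -> k 0 = 0%C -> C_derive k 0 = 1%C ->
  (forall z, disc z -> Cmod (k z) <= 4) -> (forall z, disc z -> k z <> v) -> / 64 <= Cmod v.
Proof.
  intros Hk k0 k1 B Nv. apply Rnot_lt_le. intros Hlt.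
  destruct (schwarz_quotient k 4 Hk k0 B) as [q (Hq & Eq & Bq)].
  assert (q0 : q 0 = 1%C).
  { rewrite <- k1. symmetry. apply is_C_derive_unique.
    apply (cderiv_ext_loc (fun z => z * q z)%C _ _ _ 1); [lra| |].
    - intros z Hz. symmetry. apply Eq. unfold disc. now replace (z - 0)%C with z in Hz by ring.
    - eapply cderiv_eq; [apply cderiv_mult; [apply cderiv_id|apply holo_cderiv; auto using disc_0]|].
      cbeta. ring. }
  assert (Nv0 : v <> 0%C) by (intros E; apply (Nv 0%C disc_0); now rewrite k0, E).
  assert (Pv := Cmod_pos v Nv0).
  assert (Q : Cmod (1 / (k 0 - v)) <= / (/ 32 - Cmod v)).
  { apply (modulus_le_of_circle (fun z => 1 / (k z - v))%C (/ 16) (/ (/ 32 - Cmod v)) 0).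
    2: rewrite Cmod_0; lra. 2: lra.
    - apply holo_div; [apply holo_const|apply holo_minus; auto; apply holo_const|].
      intros z Hz. now apply Cminus_eq_contra, Nv.
    - intros z Hz. assert (Dz : disc z) by (unfold disc; lra).
      assert (N := Cminus_eq_contra _ _ (Nv z Dz)).
      replace (1 / (k z - v))%C with (/ (k z - v))%C by (field; auto).
      rewrite Cmod_inv by auto. apply Rinv_le_contravar; [lra|].
      assert (T := bounded_lipschitz q 4 z 0 Hq Bq Dz disc_0). rewrite mob_0, q0, Hz in T.
      assert (T2 := Cmod_plus_ge 1 (q z - 1)). rewrite Cmod_1 in T2.
      replace (1 + (q z - 1))%C with (q z) in T2 by ring.
      assert (T3 := Cmod_minus_ge (k z) v). rewrite (Eq z Dz) in T3 at 1.
      rewrite Cmod_mult, Hz in T3. lra. }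
  rewrite k0 in Q. replace (1 / (0 - v))%C with (- / v)%C in Q by (field; auto).
  rewrite Cmod_opp, Cmod_inv in Q by auto.
  apply Rinv_le_contravar in Q; [|apply Rinv_0_lt_compat; auto].
  rewrite !Rinv_inv in Q. lra.
Qed.

(** Bloch's argument: choose z1 in the ball that nearly maximizes
    (eta - |z - z0|) |h' z|.  Then |h'| <= 4 |h' z1| on the ball about z1 of
    half the distance to the boundary, and on this ball h takes every value at
    distance less than a fixed multiple of that radius times |h' z1| from h z1.  The
    value h (phi z1) is within 2 of h z1 and is not taken there, because phi z1
    is outside the ball about z0 and h is injective.  The bound [M] makes the supremum
    finite.  The constant 512 is 2 * 64, from the disc covered, times 2 for the
    halved radius, times 2 for the near maximum. *)
Lemma bloch (h phi : C -> C) M z0 eta rho : univalent h -> (forall z, disc z -> Cmod (h z) <= M) ->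
  0 < eta -> Cmod z0 + eta <= rho -> rho < 1 ->
  (forall z, Cmod (z - z0) < eta -> disc (phi z) /\ eta <= Cmod (phi z - z0) /\
     Cmod (h (phi z) - h z) <= 2) ->
  Cmod (C_derive h z0) * eta <= 512.
Proof.
  intros [Hh Ih] HM He Hrho Hrho1 Hphi. pose proof (Cmod_ge_0 z0) as Z0.
  apply Rnot_lt_le. intros Hlt.
  assert (HM0 : 0 <= M) by (eapply Rle_trans; [apply Cmod_ge_0|apply (HM 0%C), disc_0]).
  assert (Bd : forall z, Cmod (z - z0) < eta -> Cmod z < rho).
  { intros z Hz. apply Cmod_near in Hz. lra. }
  assert (Bdisc : forall z, Cmod (z - z0) < eta -> disc z).
  { intros z Hz. apply Bd in Hz. unfold disc. lra. }
  set (m := fun z => (eta - Cmod (z - z0)) * Cmod (C_derive h z)).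
  assert (Cz0 := Cmod_minus_self z0).
  destruct (completeness (fun y => exists z, Cmod (z - z0) < eta /\ y = m z)) as [S [S1 S2]].
  - exists (1 * (2 * M / (1 - rho))). intros y [z [Hz ->]]. unfold m.
    apply Rmult_le_compat; try apply Cmod_ge_0; [lra| |].
    + pose proof (Cmod_ge_0 (z - z0)). lra.
    + eapply Rle_trans; [apply (derivative_bound h M z); auto|].
      apply Rmult_le_compat_l; [lra|]. apply Rinv_le_contravar; [lra|]. pose proof (Bd z Hz). lra.
  - exists (m z0), z0. rewrite Cz0. auto.
  - assert (HS : 512 < S).
    { apply Rlt_le_trans with (m z0); [|apply S1; exists z0; rewrite Cz0; auto].
      unfold m. rewrite Cz0. lra. }
    assert (Ex : exists z1, Cmod (z1 - z0) < eta /\ S / 2 < m z1).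
    { apply NNPP. intros N. assert (S <= S / 2); [|lra]. apply S2. intros y [z [Hz ->]].
      apply Rnot_lt_le. intros Hlt'. apply N. now exists z. }
    destruct Ex as [z1 [Hz1 Hm1]].
    set (A := C_derive h z1). set (t := (eta - Cmod (z1 - z0)) / 2).
    assert (Ht : 0 < t) by (unfold t; lra).
    assert (Em : m z1 = 2 * (t * Cmod A)) by (unfold m, t, A; field).
    assert (HA : 0 < t * Cmod A) by lra.
    assert (NA : A <> 0%C). { intros E. rewrite E, Cmod_0 in HA. lra. }
    assert (PA := Cmod_pos A NA).
    assert (ball : forall z, Cmod (z - z1) < t -> Cmod (z - z0) < eta /\ Cmod (C_derive h z) <= 4 * Cmod A).
    { intros z Hz. assert (T := Cmod_dist_triangle z z1 z0).
      assert (Hz' : Cmod (z - z0) < eta) by (unfold t in Hz; lra).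
      assert (Hd : t < eta - Cmod (z - z0)) by (unfold t in *; lra).
      split; auto. assert (Q : m z <= S) by (apply S1; exists z; auto).
      assert (t * Cmod (C_derive h z) <= m z).
      { unfold m. apply Rmult_le_compat_r; [apply Cmod_ge_0|lra]. }
      apply Rmult_le_reg_l with t; auto. lra. }
    assert (NtA : (RtoC t * A)%C <> 0%C).
    { apply Cmult_neq_0; auto. now apply RtoC_neq_0, Rgt_not_eq. }
    assert (CtA : Cmod (t * A) = t * Cmod A) by (rewrite Cmod_scal; lra).
    assert (in_ball : forall x, disc x -> Cmod ((RtoC t * x + z1) - z1) < t).
    { intros x Hx. replace ((t * x + z1) - z1)%C with (RtoC t * x)%C by ring.
      rewrite Cmod_scal by lra. unfold disc in Hx. nra. }
    (* h on the small ball, normalized to have derivative 1 at the centre *)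
    set (k := fun x : C => ((h (RtoC t * x + z1) - h z1) / (RtoC t * A))%C).
    set (v := ((h (phi z1) - h z1) / (RtoC t * A))%C).
    destruct (Hphi z1 Hz1) as (Dp & Np & Bp).
    assert (Cov := omitted_value_bound k v).
    assert (Hv : / 64 <= Cmod v).
    { apply Cov.
      - apply holo_div; [|apply holo_const|auto]. apply holo_minus; [|apply holo_const].
        intros x Hx. destruct (Hh (RtoC t * x + z1)%C) as [l Hl].
        { apply Bdisc, ball. now apply in_ball. }
        eexists. apply (cderiv_comp h (fun x => RtoC t * x + z1)%C); [apply cderiv_affine|exact Hl].
      - unfold k. replace (t * 0 + z1)%C with z1 by ring.
        replace (h z1 - h z1)%C with (RtoC 0) by ring. unfold Cdiv. ring.
      - apply is_C_derive_unique. eapply cderiv_eq.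
        + apply (cderiv_div (fun x => h (RtoC t * x + z1) - h z1)%C (fun _ => RtoC t * A)%C); auto.
          * apply (cderiv_minus (fun x => h (RtoC t * x + z1))%C (fun _ => h z1)); [|apply cderiv_const].
            apply (cderiv_comp h (fun x => RtoC t * x + z1)%C _ A (RtoC t)); [apply cderiv_affine|].
            cbv beta. replace (t * 0 + z1)%C with z1 by ring. apply holo_cderiv; auto.
          * apply cderiv_const.
        + cbeta. field. split; auto. now apply RtoC_neq_0, Rgt_not_eq.
      - intros x Hx. unfold k. rewrite Cmod_div, CtA by auto.
        apply Rmult_le_reg_r with (t * Cmod A); auto. unfold Rdiv. rewrite Rmult_assoc, Rinv_l, Rmult_1_r by lra.
        apply Rle_trans with (4 * Cmod A * Cmod ((RtoC t * x + z1) - z1)).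
        + apply (mean_value_inequality h (C_derive h)). intros s Hs.
          set (y := (z1 + RtoC s * (RtoC t * x + z1 - z1))%C).
          assert (Hy : Cmod (y - z1) < t).
          { unfold y. replace (z1 + s * (t * x + z1 - z1) - z1)%C with (RtoC s * (RtoC t * x + z1 - z1))%C by ring.
            rewrite Cmod_scal by lra. pose proof (in_ball x Hx).
            pose proof (Cmod_ge_0 (t * x + z1 - z1)). nra. }
          destruct (ball y Hy) as [Hy1 Hy2]. split; [|split]; auto.
          * apply holo_cderiv; auto.
          * apply holo_cont; [now apply holomorphic_derive|auto].
        + pose proof (in_ball x Hx).
          apply Rle_trans with (4 * Cmod A * t); [apply Rmult_le_compat_l; lra|lra].
      - intros x Hx E. unfold k, v in E.
        assert (E' : h (RtoC t * x + z1)%C = h (phi z1)).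
        { replace (h (RtoC t * x + z1)%C) with ((h (RtoC t * x + z1) - h z1) / (RtoC t * A) * (RtoC t * A) + h z1)%C
            by (field; split; auto; intros E'; apply RtoC_inj in E'; lra).
          rewrite E. field; split; auto; intros E'; apply RtoC_inj in E'; lra. }
        destruct (ball _ (in_ball x Hx)) as [Hb _].
        apply Ih in E'; auto. rewrite <- E' in Np. lra. }
    unfold v in Hv. rewrite Cmod_div, CtA in Hv by auto.
    apply (Rmult_le_compat_r (t * Cmod A)) in Hv; [|lra]. unfold Rdiv in Hv.
    rewrite Rmult_assoc, Rinv_l, Rmult_1_r in Hv by lra. lra.
Qed.

Lemma mob_uniform s rho : 0 <= s < 1 -> 0 <= rho < 1 ->
  exists r, 0 <= r < 1 /\ forall a z, Cmod a <= s -> Cmod z <= rho -> Cmod (mob a z) <= r.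
Proof.
  intros Hs Hr. set (c := (1 - s * s) * (1 - rho * rho) / 4).
  assert (Hc : 0 < c <= 1).
  { unfold c. assert (0 < 1 - rho * rho <= 1) by nra. assert (0 < 1 - s * s <= 1) by nra. split; nra. }
  exists (1 - c / 2). split; [lra|]. intros a z Ha Hz.
  assert (Da : disc a) by (unfold disc; lra). assert (Dz : disc z) by (unfold disc; lra).
  assert (E := mob_identity a z Da Dz). assert (B := mob_den_le a z Da Dz).
  assert (Hm : Cmod (mob a z) < 1) by now apply mob_disc.
  set (m := Cmod (mob a z)) in *. set (D := Cmod (1 - Cconj a * z)) in *.
  assert (0 <= D) by apply Cmod_ge_0. assert (0 <= m) by apply Cmod_ge_0.
  pose proof (Cmod_ge_0 z). pose proof (Cmod_ge_0 a).
  assert (K : c * 4 <= (1 - m * m) * (D * D)).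
  { rewrite E. unfold c. replace ((1 - s * s) * (1 - rho * rho) / 4 * 4) with
      ((1 - s * s) * (1 - rho * rho)) by field. apply Rmult_le_compat; nra. }
  assert (K2 : (1 - m * m) * (D * D) <= (1 - m * m) * 4) by (apply Rmult_le_compat_l; nra).
  nra.
Qed.

Lemma displacement_lower_bound phi rho : univalent_self_map phi -> non_elliptic phi -> 0 <= rho < 1 ->
  exists m, 0 < m /\ forall z, Cmod z <= rho -> m <= Cmod (phi z - z).
Proof.
  intros [[Hp _] Sp] Np Hr. assert (Zf := zero_free_displacement phi Hp Sp Np).
  assert (P0 := Cmod_pos _ (proj1 (proj2 Zf) 0%C disc_0)). cbv beta in P0.
  destruct (harnack_small 2 rho (Cmod (phi 0 - 0))) as [m [Hm H]]; auto; [lra|].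
  exists m. split; auto. intros z Hz. apply Rnot_lt_le. intros Hlt.
  assert (Dz : disc z) by (unfold disc; lra).
  assert (Q := H _ 0%C z Zf disc_0 Dz). cbv beta in Q.
  rewrite mob_at_0, Cmod_opp in Q. specialize (Q Hz Hlt). lra.
Qed.

(** * Linearization of an automorphism of the disc *)

Lemma complex_sqrt (d : C) : exists s : C, (s * s)%C = d.
Proof.
  destruct d as [x y]. set (m := Cmod (x, y)).
  assert (Em : m * m = x * x + y * y) by apply Cmod_sqr.
  assert (Hm : Rabs x <= m) by (destruct (components_le_Cmod (x, y)); auto).
  apply Rabs_le_between in Hm.
  set (p := sqrt ((m + x) / 2)). set (q := sqrt ((m - x) / 2)).
  assert (Ep : p * p = (m + x) / 2) by (apply sqrt_sqrt; lra).
  assert (Eq : q * q = (m - x) / 2) by (apply sqrt_sqrt; lra).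
  assert (Epq : p * q = Rabs y / 2).
  { unfold p, q. rewrite <- sqrt_mult by lra. replace ((m + x) / 2 * ((m - x) / 2)) with ((Rabs y / 2)²).
    - apply sqrt_Rsqr. pose proof (Rabs_pos y). lra.
    - unfold Rsqr. replace (Rabs y / 2 * (Rabs y / 2)) with (Rabs y * Rabs y / 4) by field.
      assert (Rabs y * Rabs y = y * y) by (rewrite <- Rabs_mult; apply Rabs_pos_eq; nra). nra. }
  destruct (Rle_dec 0 y) as [Hy|Hy].
  - exists (p, q). rewrite Rabs_pos_eq in Epq by auto. unfold Cmult; simpl. f_equal; lra.
  - exists (p, - q). rewrite Rabs_left in Epq by lra. unfold Cmult; simpl. f_equal; lra.
Qed.

Definition aut (b u z : C) : C := mob (- b) (u * z).
Definition aut_den (b u z : C) : C := (1 + Cconj b * u * z)%C.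
Definition aut_det (b u : C) : C := (u * (1 - b * Cconj b))%C.

Lemma aut_den_neq (b u z : C) : disc b -> Cmod u = 1 -> disc z -> aut_den b u z <> 0%C.
Proof.
  intros Hb Hu Hz. unfold aut_den. replace (1 + Cconj b * u * z)%C with (1 - Cconj (- b) * (u * z))%C
    by (rewrite Copp_conj; ring).
  apply mob_den; [now apply disc_opp|]. unfold disc. now rewrite Cmod_mult, Hu, Rmult_1_l.
Qed.

Lemma aut_eq (b u z : C) : disc b -> Cmod u = 1 -> disc z ->
  aut b u z = ((u * z + b) / aut_den b u z)%C.
Proof.
  intros Hb Hu Hz. unfold aut, mob, aut_den. rewrite Copp_conj.
  replace (1 - - Cconj b * (u * z))%C with (1 + Cconj b * u * z)%C by ring.
  replace (u * z - - b)%C with (u * z + b)%C by ring. reflexivity.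
Qed.

Lemma aut_disc (b u : C) : disc b -> Cmod u = 1 -> self_map (aut b u).
Proof.
  intros Hb Hu z Hz. apply mob_disc; [now apply disc_opp|].
  unfold disc. now rewrite Cmod_mult, Hu, Rmult_1_l.
Qed.

Lemma unimodular_neq_0 (u : C) : Cmod u = 1 -> u <> 0%C.
Proof. intros Hu. apply Cmod_gt_0. lra. Qed.

Lemma aut_det_neq (b u : C) : disc b -> Cmod u = 1 -> aut_det b u <> 0%C.
Proof. intros Hb Hu. apply Cmult_neq_0; [now apply unimodular_neq_0|now apply RtoC_1mod_neq]. Qed.

Lemma aut_difference (b u z w : C) : disc b -> Cmod u = 1 -> disc z -> disc w ->
  (aut b u z - aut b u w)%C = (aut_det b u * (z - w) / (aut_den b u z * aut_den b u w))%C.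
Proof.
  intros Hb Hu Hz Hw. rewrite !aut_eq by auto. unfold aut_det.
  assert (Nz := aut_den_neq b u z Hb Hu Hz). assert (Nw := aut_den_neq b u w Hb Hu Hw).
  unfold aut_den in *. field. auto.
Qed.

Lemma aut_cderiv (b u z : C) : disc b -> Cmod u = 1 -> disc z ->
  cderiv (aut b u) z (aut_det b u / (aut_den b u z * aut_den b u z))%C.
Proof.
  intros Hb Hu Hz. assert (N := aut_den_neq b u z Hb Hu Hz). eapply cderiv_eq.
  - apply (cderiv_comp (mob (- b)) (fun z => u * z)%C); [apply cderiv_scal, cderiv_id|].
    apply mob_cderiv; [now apply disc_opp|]. unfold disc. now rewrite Cmod_mult, Hu, Rmult_1_l.
  - unfold aut_det, aut_den in *. rewrite Copp_conj.
    replace (1 - - Cconj b * (u * z))%C with (1 + Cconj b * u * z)%C by ring. field. auto.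
Qed.

Section Automorphism.
Variables (b u : C).
Hypothesis Hb : disc b.
Hypothesis Hu : Cmod u = 1.
Hypothesis Hne : non_elliptic (aut b u).

(** The quadratic polynomial whose roots are the fixed points of the
    automorphism.  As a vector field it is invariant under the automorphism, and
    the linearizing coordinate is the time along the field, which is a
    primitive of its inverse. *)
Definition aut_field (z : C) : C := ((z - aut b u z) * aut_den b u z)%C.

Lemma aut_field_eq z : disc z -> aut_field z = (Cconj b * u * (z * z) + (1 - u) * z - b)%C.
Proof.
  intros Hz. unfold aut_field. rewrite aut_eq by auto.
  assert (N := aut_den_neq b u z Hb Hu Hz). unfold aut_den in *. field. auto.
Qed.

Lemma aut_field_neq z : disc z -> aut_field z <> 0%C.
Proof.
  intros Hz. apply Cmult_neq_0; [|now apply aut_den_neq].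
  apply Cminus_eq_contra. intros E. apply Hne. now exists z.
Qed.

Lemma aut_lead_neq : (Cconj b * u)%C <> 0%C.
Proof.
  apply Cmult_neq_0; [|now apply unimodular_neq_0]. intros E. apply (aut_field_neq 0%C disc_0).
  rewrite aut_field_eq, E by apply disc_0. replace b with (RtoC 0); [ring|].
  rewrite <- (Cconj_conj b), E. unfold Cconj, RtoC; simpl. f_equal. ring.
Qed.

(** Let tau1 and tau2 be the two roots.  If they coincide, then h is an affine
    function of 1 / (z - tau1); otherwise the exponential of a multiple of h is, up
    to a constant factor, the quotient (z - tau2) / (z - tau1), itself an affine
    function of 1 / (z - tau1). *)
Lemma aut_time_injective (h : C -> C) : (forall z, disc z -> cderiv h z (/ aut_field z)%C) ->
  forall z w, disc z -> disc w -> h z = h w -> z = w.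
Proof.
  intros Dh. pose proof aut_lead_neq as Nc. set (c := (Cconj b * u)%C) in *.
  destruct (complex_sqrt ((1 - u) * (1 - u) + 4 * c * b)%C) as [s Es].
  set (tau1 := ((u - 1 + s) / (2 * c))%C). set (tau2 := ((u - 1 - s) / (2 * c))%C).
  assert (Fac : forall z, disc z -> aut_field z = (c * (z - tau1) * (z - tau2))%C).
  { intros z Hz. rewrite aut_field_eq by auto. fold c. apply Cminus_0.
    replace (c * (z * z) + (1 - u) * z - b - c * (z - tau1) * (z - tau2))%C
      with ((s * s - ((1 - u) * (1 - u) + 4 * c * b)) / (4 * c))%C by (unfold tau1, tau2; field; auto).
    rewrite Es. field. auto. }
  assert (Ntau : forall z, disc z -> (z - tau1)%C <> 0%C /\ (z - tau2)%C <> 0%C).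
  { intros z Hz. split; intros E; apply (aut_field_neq z Hz); rewrite Fac, E by auto; ring. }
  assert (Eta : (tau1 - tau2)%C = (s / c)%C) by (unfold tau1, tau2; field; auto).
  assert (Inj : forall z w, disc z -> disc w -> (/ (z - tau1))%C = (/ (w - tau1))%C -> z = w).
  { intros z w Hz Hw E. destruct (Ntau z Hz), (Ntau w Hw). apply Cminus_0.
    replace (z - w)%C with (/ / (z - tau1) - / / (w - tau1))%C by (field; auto). rewrite E. ring. }
  assert (DW : forall z, disc z -> cderiv (fun z => / (z - tau1))%C z (- (1) / ((z - tau1) * (z - tau1)))%C).
  { intros z Hz. apply (cderiv_inv (fun z => z - tau1)%C); [now apply Ntau|apply cderiv_shift]. }
  destruct (Ceq_dec s 0) as [S0|Ns].
  - assert (K : forall z, disc z -> (c * h z + / (z - tau1))%C = (c * h 0 + / (0 - tau1))%C).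
    { apply (zero_derivative_const (fun z => c * h z + / (z - tau1))%C 1). intros z Hz. eapply cderiv_eq.
      - apply cderiv_plus; [apply cderiv_scal; now apply Dh|now apply DW].
      - cbeta. rewrite Fac by auto. replace tau2 with tau1.
        + field. destruct (Ntau z Hz). auto.
        + apply Cminus_0. rewrite Eta, S0. field. auto. }
    intros z w Hz Hw E. apply Inj; auto.
    assert (Q := K z Hz). rewrite <- (K w Hw), E in Q.
    replace (/ (z - tau1))%C with (c * h w + / (z - tau1) - c * h w)%C by ring. rewrite Q. ring.
  - set (R := fun z => (1 + (s / c) * / (z - tau1))%C).
    assert (K : forall z, disc z -> (R z * cexp (s * h z))%C = (R 0 * cexp (s * h 0))%C).
    { apply (zero_derivative_const (fun z => R z * cexp (s * h z))%C 1). intros z Hz. eapply cderiv_eq.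
      - apply cderiv_mult.
        + apply cderiv_plus; [apply cderiv_const|apply cderiv_scal; now apply DW].
        + apply (cderiv_comp cexp (fun z => s * h z)%C); [apply cderiv_scal; now apply Dh|apply cderiv_cexp].
      - cbeta. rewrite Fac by auto. unfold R. rewrite <- Eta. destruct (Ntau z Hz).
        replace s with (c * (tau1 - tau2))%C by (rewrite Eta; field; auto). field. auto. }
    intros z w Hz Hw E. apply Inj; auto.
    assert (Q := K z Hz). rewrite <- (K w Hw), E in Q.
    assert (Q' : R z = R w).
    { pose proof (cexp_neq_0 (s * h w)) as Ne.
      replace (R z) with (R z * cexp (s * h w) / cexp (s * h w))%C by (field; auto). rewrite Q. field. auto. }
    destruct (Ntau z Hz), (Ntau w Hw).
    replace (/ (z - tau1))%C with ((R z - 1) * c / s)%C by (unfold R; field; auto).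
    rewrite Q'. unfold R. field. auto.
Qed.

(** Apply the difference formula to both sides of the commutation relation at
    two points z and w: the quotient s of the two denominators satisfies
    s z s w = 1.  With a third point, s is constant. *)
Lemma commuting_sign (b' v : C) : disc b' -> Cmod v = 1 -> commute (aut b u) (aut b' v) ->
  exists sg, (sg * sg = 1)%C /\ forall z, disc z ->
    (aut_den b u (aut b' v z) * aut_den b' v z = sg * (aut_den b' v (aut b u z) * aut_den b u z))%C.
Proof.
  intros Hb' Hv Hc.
  set (P := fun z => (aut_den b u (aut b' v z) * aut_den b' v z)%C).
  set (Q := fun z => (aut_den b' v (aut b u z) * aut_den b u z)%C).
  assert (D1 := aut_disc b u Hb Hu). assert (D2 := aut_disc b' v Hb' Hv).
  assert (N : forall z, disc z -> P z <> 0%C /\ Q z <> 0%C).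
  { intros z Hz. split; apply Cmult_neq_0; apply aut_den_neq; auto. }
  assert (PQ : forall z w, disc z -> disc w -> z <> w -> (P z / Q z * (P w / Q w) = 1)%C).
  { intros z w Hz Hw Nzw. destruct (N z Hz), (N w Hw). apply Cminus_eq_contra in Nzw.
    pose proof (aut_det_neq b u Hb Hu). pose proof (aut_det_neq b' v Hb' Hv).
    set (T := (aut_det b u * aut_det b' v * (z - w))%C).
    assert (NT : T <> 0%C) by (apply Cmult_neq_0; [apply Cmult_neq_0|]; auto).
    assert (E : (T / (P z * P w))%C = (T / (Q z * Q w))%C).
    { transitivity (aut b u (aut b' v z) - aut b u (aut b' v w))%C.
      - rewrite !aut_difference by auto. unfold T, P.
        field. repeat split; apply aut_den_neq; auto.
      - rewrite (Hc z Hz), (Hc w Hw), !aut_difference by auto. unfold T, Q.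
        field. repeat split; apply aut_den_neq; auto. }
    replace (P z / Q z * (P w / Q w))%C with (T / (Q z * Q w) / (T / (P z * P w)))%C
      by (field; repeat split; auto).
    rewrite <- E. field. repeat split; auto. }
  assert (third : forall z : C, z <> 0%C -> exists x : C, disc x /\ x <> 0%C /\ z <> x).
  { intros z Nz. assert (H : forall r, 0 < r < 1 -> disc (RtoC r) /\ RtoC r <> 0%C).
    { intros r Hr. unfold disc. rewrite Cmod_R, Rabs_pos_eq by lra. split; [lra|]. apply RtoC_neq_0. lra. }
    destruct (H (1 / 2)) as [A1 A2]; [lra|]. destruct (H (1 / 3)) as [B1 B2]; [lra|].
    destruct (Ceq_dec z (RtoC (1 / 2))) as [->|Nh]; [|now exists (RtoC (1 / 2))].
    exists (RtoC (1 / 3)). repeat split; auto. intros E. apply RtoC_inj in E. lra. }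
  assert (Const : forall z, disc z -> (P z / Q z)%C = (P 0 / Q 0)%C).
  { intros z Hz. destruct (Ceq_dec z 0) as [->|Nz]; auto.
    destruct (third z Nz) as [x (Hx & Nx & Nzx)].
    destruct (N x Hx), (N z Hz), (N 0%C disc_0).
    replace (P z / Q z)%C with (P z / Q z * (P x / Q x) / (P x / Q x))%C by (field; auto).
    rewrite (PQ z x), <- (PQ 0%C x) by auto using disc_0. field. auto. }
  exists (P 0 / Q 0)%C. split.
  - assert (Hh : disc (RtoC (1 / 2))) by (unfold disc; rewrite Cmod_R, Rabs_pos_eq; lra).
    rewrite <- (Const _ Hh) at 1. apply PQ; auto using disc_0. apply RtoC_neq_0. lra.
  - intros z Hz. change (P z = P 0 / Q 0 * Q z)%C. rewrite <- (Const z Hz). field. now apply N.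
Qed.

(** An automorphism that commutes with the given one maps the field to itself up
    to a sign, so that it acts on the time by w -> sg w + k. *)
Lemma commuting_aut_time (h : C -> C) (b' v sg : C) :
  (forall z, disc z -> cderiv h z (/ aut_field z)%C) ->
  disc b' -> Cmod v = 1 -> commute (aut b u) (aut b' v) -> (sg * sg = 1)%C ->
  (forall z, disc z ->
    aut_den b u (aut b' v z) * aut_den b' v z = sg * (aut_den b' v (aut b u z) * aut_den b u z))%C ->
  exists k, forall z, disc z -> h (aut b' v z) = (sg * h z + k)%C.
Proof.
  intros Dh Hb' Hv Hc Hsg Es. set (B := aut b' v).
  assert (D1 := aut_disc b u Hb Hu). assert (D2 : self_map B) by now apply aut_disc.
  assert (Nsg : sg <> 0%C).
  { intros E. rewrite E, Cmult_0_l in Hsg. apply RtoC_inj in Hsg. lra. }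
  assert (Inv : forall z, disc z ->
    aut_field (B z) = (sg * (aut_det b' v / (aut_den b' v z * aut_den b' v z)) * aut_field z)%C).
  { intros z Hz. unfold aut_field. unfold B at 2. rewrite (Hc z Hz). fold B. unfold B at 1 2.
    rewrite aut_difference by auto. fold B.
    pose proof (aut_den_neq b' v z Hb' Hv Hz). pose proof (aut_den_neq b' v _ Hb' Hv (D1 z Hz)).
    replace (aut_den b u (B z)) with (sg * (aut_den b' v (aut b u z) * aut_den b u z) / aut_den b' v z)%C.
    - field. auto.
    - unfold B. rewrite <- (Es z Hz). field. auto. }
  exists (h (B 0) - sg * h 0)%C. intros z Hz.
  assert (K : (h (B z) - sg * h z)%C = (h (B 0) - sg * h 0)%C).
  { revert z Hz. apply (zero_derivative_const (fun z => h (B z) - sg * h z)%C 1). intros z Hz. eapply cderiv_eq.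
    - apply cderiv_minus; [|apply cderiv_scal; now apply Dh].
      apply (cderiv_comp h B); [now apply aut_cderiv|]. apply Dh; auto.
    - cbeta. rewrite Inv by auto. pose proof (aut_field_neq z Hz). pose proof (aut_det_neq b' v Hb' Hv).
      pose proof (aut_den_neq b' v z Hb' Hv Hz).
      transitivity ((1 - sg * sg) / (sg * aut_field z))%C; [field; auto|rewrite Hsg; field; auto]. }
  rewrite <- K. ring.
Qed.

(** The automorphism itself preserves the field, with sign 1, and translates the
    time.  A commuting map with sign -1 would conjugate this translation
    to its inverse. *)
Lemma aut_linearization : exists L, univalent L /\
  (forall z, disc z -> L (aut b u z) = (L z + 1)%C) /\
  forall b' v, disc b' -> Cmod v = 1 -> commute (aut b u) (aut b' v) ->
   exists c, forall z, disc z -> L (aut b' v z) = (L z + c)%C.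
Proof.
  assert (D1 := aut_disc b u Hb Hu).
  destruct (holomorphic_primitive (fun z => 1 / aut_field z)%C) as [h (_ & _ & Dh')].
  { apply holo_div; [apply holo_const| |apply aut_field_neq]. apply holo_mult.
    - apply holo_minus; [apply holo_id|]. intros z Hz. eexists. now apply aut_cderiv.
    - intros z Hz. eexists. apply cderiv_plus; [apply cderiv_const|apply cderiv_scal, cderiv_id]. }
  assert (Dh : forall z, disc z -> cderiv h z (/ aut_field z)%C).
  { intros z Hz. eapply cderiv_eq; [now apply Dh'|]. cbeta. field. now apply aut_field_neq. }
  assert (Inj := aut_time_injective h Dh).
  destruct (commuting_aut_time h b u 1 Dh Hb Hu) as [t Ht].
  { intros z Hz. reflexivity. } { ring. } { intros z Hz. ring. }
  assert (Nt : t <> 0%C).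
  { intros E. apply Hne. exists 0%C. split; [apply disc_0|]. apply Inj; auto using disc_0.
    rewrite Ht, E by apply disc_0. ring. }
  exists (fun z => h z / t)%C. split; [split|split].
  - apply holo_div; auto; [|apply holo_const]. intros z Hz. eexists. now apply Dh.
  - intros z w Hz Hw E. apply Inj; auto.
    replace (h z) with (h z / t * t)%C by (field; auto). rewrite E. field. auto.
  - intros z Hz. rewrite Ht by auto. field. auto.
  - intros b' v Hb' Hv Hc. destruct (commuting_sign b' v Hb' Hv Hc) as [sg [Hsg Es]].
    destruct (commuting_aut_time h b' v sg Dh Hb' Hv Hc Hsg Es) as [k Hk].
    assert (E1 : sg = 1%C).
    { assert (D2 := aut_disc b' v Hb' Hv 0%C disc_0).
      assert (Q := f_equal h (Hc 0%C disc_0)). cbv beta in Q.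
      rewrite Ht, !Hk, Ht in Q by auto using disc_0.
      apply Cminus_0. replace (sg - 1)%C with
        ((sg * (1 * h 0 + t) + k - (1 * (sg * h 0 + k) + t)) / t)%C by (field; auto).
      rewrite <- Q. field. auto. }
    exists (k / t)%C. intros z Hz. rewrite Hk, E1 by auto. field. auto.
Qed.
End Automorphism.

(** * The two cases of the theorem *)

Definition linearizable (Gamma : (C -> C) -> Prop) (phi : C -> C) : Prop :=
  exists h, univalent h /\ (forall z, disc z -> h (phi z) = (h z + 1)%C) /\
   forall psi, Gamma psi -> exists c, forall z, disc z -> h (psi z) = (h z + c)%C.

Lemma mob_isometry p x y : disc p -> disc x -> disc y ->
  Cmod (mob (mob p x) (mob p y)) = Cmod (mob x y).
Proof.
  intros Hp Hx Hy. apply Rle_antisym.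
  - apply (schwarz_pick (mob p)); auto using holo_mob, self_map_mob.
  - rewrite <- (mob_inv p x) at 1 by auto. rewrite <- (mob_inv p y) at 1 by auto.
    apply (schwarz_pick (mob (- p))); auto using holo_mob, self_map_mob, mob_disc, disc_opp.
Qed.

(** Bounded holomorphic maps are equicontinuous, so that a pointwise limit may
    be taken along converging arguments. *)
Lemma ulim_eval U {PU : ProperFilter U} (X : nat -> C -> C) (y : nat -> C) (w l : C) M :
  (forall n, holomorphic (X n)) -> (forall n z, disc z -> Cmod (X n z) <= M) ->
  disc w -> (forall n, disc (y n)) -> ulim U y w -> ulim U (fun n => X n w) l ->
  ulim U (fun n => X n (y n)) l.
Proof.
  intros HX HM Hw Hy Ly Lx.
  apply (ulim_ext U (fun n => X n (y n) - X n w + X n w)%C); [intros; ring|].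
  replace l with (0 + l)%C by ring. apply ulim_plus; auto.
  apply (ulim_0_le U _ (fun n => 2 * M * Cmod (mob w (y n)))).
  - apply filter_forall. intros n. apply bounded_lipschitz; auto.
  - apply (ulim_ext U (fun n => RtoC (2 * M) * RtoC (Cmod (mob w (y n))))%C).
    { intros n. now rewrite <- RtoC_mult. }
    replace (RtoC 0) with (RtoC (2 * M) * RtoC (Cmod (mob w w)))%C
      by (rewrite mob_self, Cmod_0; ring).
    apply ulim_scal; auto. apply ulim_Cmod; auto. apply ulim_mob; auto. now apply ulim_const.
Qed.

(** Since [g n] commutes with the members [chi] of the family, the renormalized map
    [f n] semi-conjugates each of them to the self-map [conj_at (g n 0) chi] of the
    disc.  Both cases pass to the limit in this relation. *)
Section Renormalization.
Variables (Gamma : (C -> C) -> Prop) (phi : C -> C) (g : nat -> C -> C).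
Variable U : (nat -> Prop) -> Prop.
Context {PU : ProperFilter U}.
Hypothesis U_ultra : forall P, U P \/ U (fun n => ~ P n).
Hypothesis g_univ : forall n, univalent_self_map (g n).
Hypothesis phi_Gamma : Gamma phi.
Hypothesis Gamma_univ : forall chi, Gamma chi -> univalent_self_map chi.
Hypothesis g_comm : forall n chi, Gamma chi -> commute (g n) chi.
Hypothesis phi_comm : forall chi, Gamma chi -> commute phi chi.
Hypothesis phi_ne : non_elliptic phi.

Let f n := renorm (g n).
Let a := phi 0.

Lemma g0_disc n : disc (g n 0).
Proof. apply (g_univ n), disc_0. Qed.

Lemma a_disc : disc a.
Proof. apply (Gamma_univ phi phi_Gamma), disc_0. Qed.

Lemma f_univ n : univalent_self_map (f n).
Proof. apply renorm_univalent, g_univ. Qed.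

Lemma f_0 n : f n 0 = 0%C.
Proof. apply renorm_0. Qed.

Lemma f_bound n z : disc z -> Cmod (f n z) <= 1.
Proof. intros Hz. left. now apply (f_univ n). Qed.

Lemma f_schwarz n z : disc z -> Cmod (f n z) <= Cmod z.
Proof.
  intros Hz. destruct (f_univ n) as [[Hf _] Sf]. apply schwarz; auto. apply f_0.
Qed.

Lemma non_elliptic_0 chi : non_elliptic chi -> chi 0 <> 0%C.
Proof. intros H E. apply H. exists 0%C. split; auto using disc_0. Qed.

Lemma f_a_neq n : f n a <> 0%C.
Proof.
  intros E. apply (non_elliptic_0 phi phi_ne). rewrite <- (f_0 n) in E.
  apply (f_univ n) in E; auto using disc_0, a_disc.
Qed.

Let X n chi := conj_at (g n 0) chi.

Lemma X_univ n chi : Gamma chi -> univalent_self_map (X n chi).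
Proof. intros Gc. apply conj_at_univalent; [apply g0_disc|auto]. Qed.

Lemma X_f n chi z : Gamma chi -> disc z -> X n chi (f n z) = f n (chi z).
Proof. intros Gc Hz. apply conj_at_renorm; auto. Qed.

Section ZeroStep.
Hypothesis zero_step : ulim U (fun n => f n a) 0.

Lemma f_lim_0 z : disc z -> ulim U (fun n => f n z) 0.
Proof.
  intros Hz.
  assert (Ch : forall n, exists q, zero_free q (2 * 1) /\ forall z, disc z -> f n z = (z * q z)%C).
  { intros n. destruct (univalent_quotient (f n) 1 0 (proj1 (f_univ n)) (f_bound n) disc_0) as [q [Zq Eq]].
    exists q. split; auto. intros v Hv. rewrite (Eq v Hv), f_0, mob_0. ring. }
  apply (boolp.choice (P := fun n q => _)) in Ch. destruct Ch as [q Hq].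
  assert (Na : a <> 0%C) by now apply non_elliptic_0.
  apply (ulim_ext U (fun n => z * q n z)%C).
  { intros n. symmetry. now apply Hq. }
  replace (RtoC 0) with (z * 0)%C by ring. apply ulim_scal; auto.
  apply (hurwitz U q (2 * 1) a); auto using a_disc.
  - apply filter_forall. intros n. apply Hq.
  - apply (ulim_ext U (fun n => / a * f n a)%C).
    + intros n. rewrite (proj2 (Hq n) a a_disc). field. auto.
    + replace (RtoC 0) with (/ a * 0)%C by ring. now apply ulim_scal.
Qed.

(** The displacement of 0 under the map that comes from [phi] is f n a.  With
    this unit of length [phi] acts nearly as the translation by 1. *)
Let h n (z : C) : C := (f n z / f n a)%C.

Lemma h_univ n : univalent (h n).
Proof.
  destruct (f_univ n) as [[Hf If] Sf]. split.
  - apply holo_div; auto; [apply holo_const|]. intros; apply f_a_neq.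
  - intros z w Hz Hw E. apply If; auto. unfold h in E.
    replace (f n z) with (f n z / f n a * f n a)%C by (field; apply f_a_neq).
    rewrite E. field. apply f_a_neq.
Qed.

Lemma h_crude_bound n z : disc z -> Cmod (h n z) <= / Cmod (f n a).
Proof.
  intros Hz. unfold h. rewrite Cmod_div by apply f_a_neq. rewrite <- (Rmult_1_l (/ _)).
  apply Rmult_le_compat_r; [|now apply f_bound].
  left. apply Rinv_0_lt_compat, Cmod_pos, f_a_neq.
Qed.

(** The maps [f n] tend to 0, so that the displacement estimate applies with an
    arbitrarily small error to each fixed point free member of the family. *)
Lemma h_displacement chi rho eta : Gamma chi -> non_elliptic chi -> 0 <= rho < 1 -> 0 < eta ->
  U (fun n => forall z, Cmod z <= rho ->
     Cmod (h n (chi z) - h n z - h n (chi 0)) <= eta * Cmod (h n (chi 0))).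
Proof.
  intros Gc Nc Hrho He. destruct (Gamma_univ chi Gc) as [_ Sc].
  assert (Dx : disc (chi 0)) by apply Sc, disc_0.
  destruct (mob_uniform (Cmod (chi 0)) rho (conj (Cmod_ge_0 _) Dx) Hrho) as [r [Hr Hmr]].
  destruct (displacement (chi 0) r eta Dx (non_elliptic_0 chi Nc) Hr He) as [d [Hd H]].
  refine (filter_imp _ _ _ (f_lim_0 (chi 0) Dx d Hd)). intros n Hn z Hz.
  replace (f n (chi 0) - 0)%C with (f n (chi 0)) in Hn by ring.
  assert (Dz : disc z) by (unfold disc; lra). destruct (X_univ n chi Gc) as [[HX _] SX]. unfold h.
  replace (f n (chi z) / f n a - f n z / f n a - f n (chi 0) / f n a)%C with
    ((f n (chi z) - f n z - f n (chi 0)) / f n a)%C by (field; apply f_a_neq).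
  rewrite !Cmod_div by apply f_a_neq. unfold Rdiv. rewrite <- Rmult_assoc.
  apply Rmult_le_compat_r; [left; apply Rinv_0_lt_compat, Cmod_pos, f_a_neq|].
  rewrite <- (X_f n chi z Gc Dz). apply (H (f n) (X n chi)); auto using f_univ, f_0.
  - apply conj_at_non_elliptic; auto using g0_disc.
  - assert (Q := X_f n chi 0%C Gc disc_0). now rewrite f_0 in Q.
  - apply Hmr; [lra|exact Hz].
Qed.

Lemma h_a n : h n (phi 0) = 1%C.
Proof. unfold h. fold a. field. apply f_a_neq. Qed.

(** Bloch's argument applies with the translation by about 1 that [phi] induces
    on the image of h_n: a small ball is disjoint from its image under phi, so
    that the image of the ball under h_n contains no large disc. *)
Lemma h_locally_bounded rho : 0 <= rho < 1 ->
  exists K, 0 <= K /\ U (fun n => forall z, Cmod z <= rho -> Cmod (h n z) <= K).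
Proof.
  intros Hrho. destruct (Gamma_univ phi phi_Gamma) as [Hp Sp].
  set (rho' := (1 + rho) / 2). assert (Hr' : 0 <= rho' < 1) by (unfold rho'; lra).
  destruct (displacement_lower_bound phi rho' (conj Hp Sp) phi_ne Hr') as [m [Hm Hmz]].
  set (eta := Rmin (m / 2) ((1 - rho) / 2)).
  assert (He : 0 < eta) by (apply Rmin_pos; lra).
  assert (He1 : eta <= m / 2) by apply Rmin_l. assert (He2 : eta <= (1 - rho) / 2) by apply Rmin_r.
  assert (HK : 0 < 512 / eta) by (apply Rdiv_lt_0_compat; lra).
  exists (512 / eta). split; [lra|].
  refine (filter_imp _ _ _ (h_displacement phi rho' 1 phi_Gamma phi_ne Hr' Rlt_0_1)).
  intros n Hn z Hz. rewrite h_a, Cmod_1 in Hn.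
  assert (Dh : forall w, Cmod w <= rho -> Cmod (C_derive (h n) w) <= 512 / eta).
  { intros w Hw. apply Rmult_le_reg_r with eta; auto.
    replace (512 / eta * eta) with 512 by (field; lra).
    apply (bloch (h n) phi (/ Cmod (f n a)) w eta rho'); auto.
    - apply h_univ.
    - intros v Hv. now apply h_crude_bound.
    - unfold rho'. lra.
    - lra.
    - intros v Hv. assert (Hv' := Cmod_near _ _ _ Hv).
      assert (Cv : Cmod v <= rho') by (unfold rho'; lra).
      split; [|split].
      + apply Sp. unfold disc. lra.
      + specialize (Hmz v Cv). assert (T := Cmod_dist_triangle (phi v) w v).
        rewrite (Cmod_minus_sym w v) in T. lra.
      + specialize (Hn v Cv).
        replace (h n (phi v) - h n v)%C with ((h n (phi v) - h n v - 1) + 1)%C by ring.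
        eapply Rle_trans; [apply Cmod_triangle|]. rewrite Cmod_1. lra. }
  assert (h0 : h n 0 = 0%C). { unfold h. rewrite f_0. unfold Cdiv. ring. }
  replace (h n z) with (h n z - h n 0)%C by (rewrite h0; ring).
  apply Rle_trans with (512 / eta * Cmod (z - 0)).
  - apply (mean_value_inequality (h n) (C_derive (h n))). intros t Ht.
    assert (C : Cmod (0 + t * (z - 0)) <= rho).
    { replace (0 + t * (z - 0))%C with (RtoC t * z)%C by ring.
      rewrite Cmod_scal by lra. pose proof (Cmod_ge_0 z). nra. }
    assert (D : disc (0 + t * (z - 0))) by (unfold disc; lra).
    split; [|split]; auto.
    + apply holo_cderiv; auto. apply h_univ.
    + apply holo_cont; auto. apply holomorphic_derive, h_univ.
  - replace (z - 0)%C with z by ring.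
    apply Rle_trans with (512 / eta * 1); [apply Rmult_le_compat_l; lra|lra].
Qed.

Theorem zero_step_linearizable : linearizable Gamma phi.
Proof.
  assert (Hb : forall z, disc z -> exists K, U (fun n => Cmod (h n z) <= K)).
  { intros z Hz. destruct (h_locally_bounded (Cmod z)) as [K [_ HK]].
    - split; [apply Cmod_ge_0|exact Hz].
    - exists K. refine (filter_imp _ _ _ HK). intros n Hn. apply Hn. lra. }
  destruct (ulim_fun_exists U U_ultra h Hb) as [H HH].
  assert (Da := a_disc). assert (Na : a <> 0%C) by now apply non_elliptic_0.
  assert (H0 : H 0 = 0%C).
  { apply (ulim_of_const U (fun n => h n 0)); [|apply HH, disc_0].
    intros n. unfold h. rewrite f_0. unfold Cdiv. ring. }
  assert (Ha : H a = 1%C).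
  { apply (ulim_of_const U (fun n => h n a)); [intros n; apply h_a|now apply HH]. }
  assert (Scale : forall rho z, Cmod a < rho -> Cmod z < rho -> disc (/ RtoC rho * z) /\ (RtoC rho * (/ RtoC rho * z))%C = z).
  { intros rho z Hr Hz. pose proof (Cmod_ge_0 a).
    assert (Nr : RtoC rho <> 0%C) by (apply RtoC_neq_0; lra). split.
    - unfold disc. rewrite Cmod_mult, Cmod_inv, Cmod_R, Rabs_pos_eq by (auto; lra).
      apply Rmult_lt_reg_l with rho; [lra|]. rewrite <- Rmult_assoc, Rinv_r; lra.
    - field. auto. }
  (* The bounds on h n are uniform on smaller discs only, so that the limit
     theorem is applied to the restrictions. *)
  assert (UR : forall rho, Cmod a < rho < 1 -> univalent (fun z => H (RtoC rho * z)%C)).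
  { intros rho Hrho. pose proof (Cmod_ge_0 a).
    destruct (h_locally_bounded rho) as [K [HK HKn]]; [lra|].
    assert (S : forall z, disc z -> Cmod (RtoC rho * z) <= rho).
    { intros z Hz. rewrite Cmod_scal by lra. unfold disc in Hz. pose proof (Cmod_ge_0 z). nra. }
    assert (SD : self_map (fun z => RtoC rho * z)%C).
    { intros z Hz. specialize (S z Hz). unfold disc. lra. }
    assert (Nr : RtoC rho <> 0%C) by (apply RtoC_neq_0; lra).
    apply (ulim_univalent U U_ultra (fun n z => h n (RtoC rho * z)%C) _ K).
    - refine (filter_imp _ _ _ HKn). intros n Hn. destruct (h_univ n) as [Hh Ih]. split; [split|].
      + apply holo_comp; auto. apply holo_mult; [apply holo_const|apply holo_id].
      + intros z w Hz Hw E. apply Ih in E; auto.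
        replace z with (/ RtoC rho * (RtoC rho * z))%C by (field; auto). rewrite E. field. auto.
      + intros z Hz. apply Hn, S, Hz.
    - intros z Hz. apply HH, SD, Hz.
    - destruct (Scale rho a) as [Ds Es]; [lra|lra|].
      exists 0%C, (/ RtoC rho * a)%C. split; [apply disc_0|]. split; auto.
      rewrite Es, Cmult_0_r, H0, Ha. intros E. apply RtoC_inj in E. lra. }
  assert (Small : forall z w, disc z -> disc w -> exists rho, Cmod a < rho < 1 /\ Cmod z < rho /\ Cmod w < rho).
  { intros z w Hz Hw. unfold disc in *.
    set (M := Rmax (Cmod a) (Rmax (Cmod z) (Cmod w))).
    assert (M < 1) by (repeat apply Rmax_lub_lt; auto).
    assert (Cmod a <= M) by apply Rmax_l.
    assert (Rmax (Cmod z) (Cmod w) <= M) by apply Rmax_r.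
    pose proof (Rmax_l (Cmod z) (Cmod w)). pose proof (Rmax_r (Cmod z) (Cmod w)).
    exists ((1 + M) / 2). lra. }
  assert (Fun : forall chi, Gamma chi -> non_elliptic chi -> forall z, disc z -> H (chi z) = (H z + H (chi 0))%C).
  { intros chi Gc Nc z Hz. destruct (Gamma_univ chi Gc) as [_ Sc].
    assert (Dc : disc (chi 0)) by apply Sc, disc_0.
    assert (L : ulim U (fun n => h n (chi z) - h n z - h n (chi 0))%C (H (chi z) - H z - H (chi 0))%C).
    { repeat apply ulim_minus; auto. }
    assert (Z : (H (chi z) - H z - H (chi 0))%C = 0%C).
    { apply Cmod_small. intros eps He.
      destruct (Hb (chi 0%C) Dc) as [K HK]. set (eta := eps / (1 + Rabs K)). pose proof (Rabs_pos K).
      assert (Heta : 0 < eta) by (apply Rdiv_lt_0_compat; lra).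
      apply (ulim_Cmod_le U _ _ _ L).
      refine (filter_imp _ _ _ (filter_and _ _ HK (h_displacement chi (Cmod z) eta Gc Nc (conj (Cmod_ge_0 z) Hz) Heta))).
      intros n [B1 B2]. eapply Rle_trans; [apply (B2 z); lra|].
      apply Rle_trans with (eta * (1 + Rabs K)).
      - apply Rmult_le_compat_l; [lra|]. pose proof (Rle_abs K). lra.
      - right. unfold eta. field. lra. }
    apply Cminus_0. replace (H (chi z) - (H z + H (chi 0)))%C with (H (chi z) - H z - H (chi 0))%C by ring.
    exact Z. }
  exists H. split; [split|split].
  - intros z Hz. destruct (Small z z Hz Hz) as [rho (Hr & Hz' & _)].
    destruct (Scale rho z) as [Dz Ez]; [lra|auto|].
    destruct (proj1 (UR rho Hr) _ Dz) as [l Hl].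
    eexists. apply (cderiv_ext_loc (fun w => H (RtoC rho * (/ RtoC rho * w + 0)))%C H z _ 1); [lra| |].
    + intros w _. f_equal. pose proof (Cmod_ge_0 a). field. intros E. apply RtoC_inj in E. lra.
    + apply (cderiv_comp (fun v => H (RtoC rho * v))%C (fun w => / RtoC rho * w + 0)%C); [apply cderiv_affine|].
      cbv beta. rewrite Cplus_0_r. exact Hl.
  - intros z w Hz Hw E. destruct (Small z w Hz Hw) as [rho (Hr & Hz' & Hw')].
    destruct (Scale rho z) as [Dz Ez]; [lra|auto|]. destruct (Scale rho w) as [Dw Ew]; [lra|auto|].
    rewrite <- Ez, <- Ew in E. apply (UR rho Hr) in E; auto. rewrite <- Ez, <- Ew. now f_equal.
  - intros z Hz. rewrite (Fun phi); auto. fold a. now rewrite Ha.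
  - intros psi Gpsi. destruct (Gamma_univ psi Gpsi) as [Hpsi Spsi].
    destruct (commuting_fixed_point phi psi) as [N|I]; auto.
    + apply (Gamma_univ phi phi_Gamma).
    + apply Hpsi.
    + exists (H (psi 0)). now apply Fun.
    + exists 0%C. intros z Hz. rewrite (I z Hz). ring.
Qed.
End ZeroStep.

Section PositiveStep.
Variable kappa : R.
Hypothesis kappa_pos : 0 < kappa.
Hypothesis step_lim : ulim U (fun n => RtoC (Cmod (f n a))) (RtoC kappa).
Hypothesis step_min : forall n chi, Gamma chi ->
  kappa <= Cmod (renorm (fun z => chi (g n z)) a).

Lemma X_bound n chi z : Gamma chi -> disc z -> Cmod (X n chi z) <= 1.
Proof. intros Gc Hz. left. now apply (X_univ n chi Gc). Qed.

(** The image of 0 stays in the disc of radius |chi 0|, so that the image of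
    any given point stays in a compact subset of the disc. *)
Lemma X_compact chi z : Gamma chi -> disc z ->
  exists r, r < 1 /\ forall n, Cmod (X n chi z) <= r.
Proof.
  intros Gc Hz. destruct (Gamma_univ chi Gc) as [_ Sc].
  assert (Dc : disc (chi 0)) by apply Sc, disc_0.
  destruct (mob_uniform (Cmod (chi 0)) (Cmod z) (conj (Cmod_ge_0 _) Dc) (conj (Cmod_ge_0 _) Hz)) as [r [Hr H]].
  exists r. split; [apply Hr|]. intros n. destruct (X_univ n chi Gc) as [[HX _] SX].
  set (b := X n chi 0). assert (Db : disc b) by apply SX, disc_0.
  assert (Eb : b = f n (chi 0)).
  { unfold b. rewrite <- (f_0 n) at 1. apply X_f; auto using disc_0. }
  rewrite <- (mob_inv b (X n chi z)) by auto. apply H.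
  - rewrite Cmod_opp, Eb. now apply f_schwarz.
  - assert (P := schwarz_pick (X n chi) z 0 HX SX Hz disc_0). now rewrite mob_0 in P.
Qed.

Theorem positive_step_linearizable : linearizable Gamma phi.
Proof.
  destruct (ulim_fun_exists U U_ultra f) as [H HH].
  { intros z Hz. exists 1. apply filter_forall. intros n. left. now apply (f_univ n). }
  assert (H0 : H 0 = 0%C).
  { apply (ulim_of_const U (fun n => f n 0)); [intros n; apply f_0|apply HH, disc_0]. }
  assert (Ha : Cmod (H a) = kappa).
  { apply RtoC_inj. apply (ulim_unique U (fun n => RtoC (Cmod (f n a)))); auto.
    apply ulim_Cmod; auto. apply HH, a_disc. }
  assert (Na : H a <> 0%C) by (apply Cmod_gt_0; lra).
  assert (SH : self_map H).
  { intros z Hz. unfold disc in *. apply Rle_lt_trans with (Cmod z); auto.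
    apply (ulim_Cmod_le U _ _ _ (HH z Hz)). apply filter_forall. intros n. now apply f_schwarz. }
  assert (UH : univalent H).
  { apply (ulim_univalent U U_ultra f H 1); auto.
    - apply filter_forall. intros n. split; [apply f_univ|]. intros z Hz. left. now apply (f_univ n).
    - exists a, 0%C. rewrite H0. auto using a_disc, disc_0. }
  assert (Lim : forall chi, Gamma chi -> exists Psi,
    holomorphic Psi /\ self_map Psi /\ (forall z, disc z -> ulim U (fun n => X n chi z) (Psi z)) /\
    forall z, disc z -> Psi (H z) = H (chi z)).
  { intros chi Gc. destruct (Gamma_univ chi Gc) as [_ Sc].
    destruct (ulim_fun_exists U U_ultra (fun n => X n chi)) as [Psi HPsi].
    { intros z Hz. exists 1. apply filter_forall. intros n. now apply X_bound. }
    exists Psi. split; [|split; [|split]]; auto.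
    - apply (ulim_holomorphic U U_ultra (fun n => X n chi) Psi 1); auto.
      apply filter_forall. intros n. split; [apply (X_univ n chi Gc)|]. intros z Hz. now apply X_bound.
    - intros z Hz. destruct (X_compact chi z Gc Hz) as [r [Hr Br]].
      unfold disc. apply Rle_lt_trans with r; auto.
      apply (ulim_Cmod_le U _ _ _ (HPsi z Hz)). now apply filter_forall.
    - intros z Hz. apply (ulim_unique U (fun n => X n chi (f n z))).
      + apply (ulim_eval U (fun n => X n chi) (fun n => f n z) (H z) _ 1); auto.
        * intros n. apply (X_univ n chi Gc).
        * intros n v Hv. now apply X_bound.
        * intros n. now apply (f_univ n).
      + apply (ulim_ext U (fun n => f n (chi z))); [|now apply HH, Sc].
        intros n. symmetry. now apply X_f. }
  (* By minimality the limits preserve the pseudo-hyperbolic distance from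
     H 0 to H a, hence they are automorphisms. *)
  assert (Aut : forall chi, Gamma chi -> exists b u, disc b /\ Cmod u = 1 /\
     (forall z, disc z -> ulim U (fun n => X n chi z) (aut b u z)) /\
     forall z, disc z -> aut b u (H z) = H (chi z)).
  { intros chi Gc. destruct (Gamma_univ chi Gc) as [[Hc Ic] Sc].
    destruct (Lim chi Gc) as [Psi (HP & SP & LP & EP)].
    assert (Da := SH a a_disc).
    destruct (schwarz_equality Psi (H a)) as [u [Hu Eu]]; auto.
    - apply Rle_antisym.
      + assert (P := schwarz_pick Psi (H a) 0 HP SP Da disc_0). now rewrite mob_0 in P.
      + replace (Psi 0) with (Psi (H 0)) by now rewrite H0. rewrite Ha, !EP by auto using disc_0, a_disc.
        assert (L : ulim U (fun n => RtoC (Cmod (mob (f n (chi 0)) (f n (chi a)))))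
                      (RtoC (Cmod (mob (H (chi 0)) (H (chi a)))))).
        { apply ulim_Cmod; auto. apply ulim_mob; auto using disc_0, a_disc. }
        apply Rnot_lt_le. intros Hlt.
        apply (filter_const (F := U)). refine (filter_imp _ _ _ (L (kappa - Cmod (mob (H (chi 0)) (H (chi a)))) _)); [|lra].
        intros n Hn. rewrite <- RtoC_minus, Cmod_R in Hn. apply Rabs_lt_between in Hn.
        assert (Q := step_min n chi Gc). unfold renorm in Q.
        unfold f, renorm in Hn. pose proof (g0_disc n).
        assert (Dg : disc (g n a)) by (apply (g_univ n), a_disc).
        rewrite mob_isometry in Hn.
        * rewrite (g_comm n chi Gc 0%C disc_0), (g_comm n chi Gc a a_disc) in Hn. lra.
        * auto.
        * apply (g_univ n), Sc, disc_0.
        * apply (g_univ n), Sc, a_disc.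
    - exists (Psi 0), u. split; [apply SP, disc_0|]. split; auto. split.
      + intros z Hz. unfold aut. rewrite <- Eu by auto. auto.
      + intros z Hz. unfold aut. rewrite <- Eu by auto. auto. }
  destruct (Aut phi phi_Gamma) as [b [u (Hb & Hu & LPhi & EPhi)]].
  (* A fixed point of the limit makes the maps X n phi, which have none, tend to
     the identity by Hurwitz's theorem; this contradicts H 0 <> H a. *)
  assert (NE : non_elliptic (aut b u)).
  { intros [p [Hp Ep]].
    assert (Z : forall z, disc z -> ulim U (fun n => X n phi z - z)%C 0).
    { apply (hurwitz U (fun n z => X n phi z - z)%C 2 p); auto.
      - apply filter_forall. intros n. destruct (X_univ n phi phi_Gamma) as [[HX _] SX].
        apply zero_free_displacement; auto.
        apply conj_at_non_elliptic; auto using g0_disc. apply (Gamma_univ phi phi_Gamma).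
      - replace (RtoC 0) with (aut b u p - p)%C by (rewrite Ep; ring).
        apply ulim_minus; auto. now apply ulim_const. }
    apply Na. rewrite <- H0. unfold a. rewrite <- EPhi by apply disc_0. rewrite H0.
    apply (ulim_unique U (fun n => X n phi 0)); [apply LPhi, disc_0|].
    apply (ulim_ext U (fun n => X n phi 0 - 0)%C); [intros; ring|]. apply Z, disc_0. }
  destruct (aut_linearization b u Hb Hu NE) as [L (UL & EL & CL)].
  exists (fun z => L (H z)). split; [|split].
  - destruct UL as [HL IL], UH as [HHo IH]. split.
    + now apply holo_comp.
    + intros z w Hz Hw E. apply IH; auto.
  - intros z Hz. rewrite <- EPhi, EL; auto.
  - intros psi Gp. destruct (Aut psi Gp) as [b' [v (Hb' & Hv & LPsi & EPsi)]].
    destruct (CL b' v Hb' Hv) as [c Hc].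
    { intros z Hz. cbv beta. assert (D1 := aut_disc b' v Hb' Hv z Hz). assert (D2 := aut_disc b u Hb Hu z Hz).
      apply (ulim_unique U (fun n => X n phi (X n psi z))).
      - apply (ulim_eval U (fun n => X n phi) (fun n => X n psi z) (aut b' v z) _ 1); auto.
        + intros n. apply (X_univ n phi phi_Gamma).
        + intros n w Hw. now apply X_bound.
        + intros n. now apply (X_univ n psi Gp).
      - apply (ulim_ext U (fun n => X n psi (X n phi z))).
        + intros n. unfold X, conj_at. pose proof (g0_disc n) as Dp.
          assert (Dq := mob_disc _ _ (disc_opp _ Dp) Hz).
          rewrite !mob_inv by (auto; apply (Gamma_univ _ Gp) || apply (Gamma_univ _ phi_Gamma); auto).
          f_equal. symmetry. now apply (phi_comm psi Gp).
        + apply (ulim_eval U (fun n => X n psi) (fun n => X n phi z) (aut b u z) _ 1); auto.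
          * intros n. apply (X_univ n psi Gp).
          * intros n w Hw. now apply X_bound.
          * intros n. now apply (X_univ n phi phi_Gamma). }
    exists c. intros z Hz. rewrite <- EPsi, Hc; auto.
Qed.
End PositiveStep.
End Renormalization.

(** * Minimizing sequences in the commutant *)

Definition commutant (Gamma : (C -> C) -> Prop) (g : C -> C) : Prop :=
  univalent_self_map g /\ forall chi, Gamma chi -> commute g chi.

Lemma commutant_comp Gamma chi g : (forall chi, Gamma chi -> univalent_self_map chi) ->
  abelian Gamma -> Gamma chi -> commutant Gamma g -> commutant Gamma (fun z => chi (g z)).
Proof.
  intros HG Hab Gc [Hg Cg]. split; [apply univalent_self_map_comp; auto|].
  intros psi Gp z Hz. rewrite (Cg psi Gp z Hz). apply Hab; auto. now apply Hg.
Qed.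

(** The sequence g_n minimizes, within the commutant of the family, the
    pseudo-hyperbolic distance from g 0 to g (phi 0).  The commutant is stable under
    composition with the members of the family, so that composing with them does not
    bring the distance below the infimum; this is the minimality that the
    positive case uses. *)
Lemma abelian_linearizable (Gamma : (C -> C) -> Prop) (phi : C -> C) :
  (forall chi, Gamma chi -> univalent_self_map chi) -> abelian Gamma -> Gamma phi ->
  non_elliptic phi -> linearizable Gamma phi.
Proof.
  intros HG Hab Gphi Nphi.
  set (a := phi 0). set (step := fun g => Cmod (renorm g a)).
  assert (Id : commutant Gamma (fun z => z)).
  { split; [split; [split; [apply holo_id|auto]|intros z Hz; exact Hz]|]. intros chi _ z Hz. reflexivity. }
  destruct (completeness (fun y => exists g, commutant Gamma g /\ y = - step g)) as [k [K1 K2]].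
  { exists 0. intros y [g [_ ->]]. pose proof (Cmod_ge_0 (renorm g a)). unfold step. lra. }
  { exists (- step (fun z => z)), (fun z => z). auto. }
  set (kappa := - k).
  assert (Kmin : forall g, commutant Gamma g -> kappa <= step g).
  { intros g Hg. assert (- step g <= k) by (apply K1; now exists g). unfold kappa. lra. }
  assert (Kinf : forall n : nat, exists g, commutant Gamma g /\ step g < kappa + / (INR n + 1)).
  { intros n. apply NNPP. intros N. pose proof (pos_INR n).
    assert (P : 0 < / (INR n + 1)) by (apply Rinv_0_lt_compat; lra).
    assert (k <= k - / (INR n + 1)); [|lra]. apply K2. intros y [g [Hg ->]].
    apply Rnot_lt_le. intros Hlt. apply N. exists g. split; auto. unfold kappa. lra. }
  apply (boolp.choice (P := fun n g => _)) in Kinf. destruct Kinf as [g Hg].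
  destruct ultrafilter_exists as [U (PU & Uev & UU)].
  assert (Lim : ulim U (fun n => RtoC (step (g n))) (RtoC kappa)).
  { intros eps He. apply Uev. refine (filter_imp _ _ _ (eventually_inv_lt eps He)). intros n HN.
    destruct (Hg n) as [Cg Hlt]. assert (Q := Kmin _ Cg).
    rewrite <- RtoC_minus, Cmod_R, Rabs_pos_eq; lra. }
  assert (Hk : 0 <= kappa).
  { apply Rnot_lt_le. intros Hlt. apply (filter_const (F := U)).
    refine (filter_imp _ _ _ (Lim (- kappa) _)); [|lra]. intros n Hn.
    rewrite <- RtoC_minus, Cmod_R in Hn. apply Rabs_lt_between in Hn.
    pose proof (Cmod_ge_0 (renorm (g n) a)). unfold step in Hn. lra. }
  assert (Gu : forall n, univalent_self_map (g n)) by (intros n; apply Hg).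
  assert (Gc : forall n chi, Gamma chi -> commute (g n) chi) by (intros n; apply Hg).
  destruct Hk as [Hk|Hk].
  - apply (positive_step_linearizable Gamma phi g U UU Gu Gphi HG Gc) with kappa; auto.
    intros n chi Hchi. apply Kmin. apply commutant_comp; auto. apply Hg.
  - apply (zero_step_linearizable Gamma phi g U UU Gu Gphi HG Gc); auto.
    intros eps He. refine (filter_imp _ _ _ (Lim eps He)). intros n Hn. fold a.
    rewrite <- Hk in Hn. rewrite <- RtoC_minus, Cmod_R, Rminus_0_r in Hn.
    replace (renorm (g n) a - 0)%C with (renorm (g n) a) by ring.
    unfold step in Hn. pose proof (Rle_abs (Cmod (renorm (g n) a))). lra.
Qed.

Theorem theorem4p1 (phi : C -> C) (Delta : (C -> C) -> Prop)
  (phi_univ : univalent_self_map phi)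
  (phi_neq_id : ~ eq_on_disc phi (fun z => z))
  (phi_non_elliptic : non_elliptic phi)
  (Delta_sub : forall psi, Delta psi -> centralizer phi psi)
  (Delta_abelian : abelian Delta) :
  exists h : C -> C,
    univalent h /\
    eq_on_disc (fun z => h (phi z)) (fun z => Cplus (h z) (RtoC 1)) /\
    (forall psi, Delta psi ->
       exists c : C, eq_on_disc (fun z => h (psi z)) (fun z => Cplus (h z) c)).
Proof.
  destruct (abelian_linearizable (fun chi => Delta chi \/ chi = phi) phi) as [h (Uh & Eh & Ch)]; auto.
  - intros chi [H| ->]; auto. now apply Delta_sub.
  - intros c1 c2 [H1| ->] [H2| ->] z Hz.
    + now apply Delta_abelian.
    + symmetry. now apply Delta_sub.
    + now apply Delta_sub.
    + reflexivity.
  - exists h. split; [exact Uh|split; [exact Eh|]]. intros psi Hpsi. apply Ch. now left.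
Qed.
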